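(* Let $\mathbf{a}=(a_\ell)_{\ell\ge1}$ be a sequence of positive integers, let $\alpha=[0;a_1,a_2,\ldots,a_\ell,\ldots]$, and let $(p_\ell/q_\ell)_{\ell\ge1}$ be the sequence of convergents to $\alpha$. If there exists a rational number $w\ge 2$ such that $\mathbf{a}$ satisfies Condition $( * )_w$, then $\alpha$ is transcendental. If there exists a rational number $w>1$ such that $\mathbf{a}$ satisfies Condition $( * )_w$ and the sequence $(q_\ell^{1/\ell})_{\ell\ge1}$ is bounded (which is in particular the case when $\mathbf{a}$ is bounded), then $\alpha$ is transcendental.
   Context: Infinite sequences are identified with infinite words $a_1a_2\ldots$. For a finite word $W$, $|W|$ is its length; for a positive integer $\ell$, $W^\ell$ is the $\ell$-fold concatenation of $W$; for a positive rational $x$, $W^x$ denotes the word $W^{[x]}W'$, where $W'$ is the prefix of $W$ of length $\lceil (x-[x])|W|\rceil$ ($[y]$ and $\lceil y\rceil$ are the integer part and upper integer part). For rational $w>1$, a sequence $\mathbf{a}$ satisfies Condition $( * )_w$ if $\mathbf{a}$ is not eventually periodic and there exists a sequence of finite words $(V_n)_{n\ge1}$ such that (i) for every $n\ge1$ the word $V_n^w$ is a prefix of $\mathbf{a}$, and (ii) the sequence $(|V_n|)_{n\ge1}$ is increasing. *)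

(* Defs.v *)
From HB Require Import structures.
From mathcomp Require Import all_boot all_order all_algebra.
From mathcomp Require Import all_classical all_reals all_analysis.
From mathcomp Require Import zify ring lra.

Set Implicit Arguments.
Unset Strict Implicit.
Unset Printing Implicit Defensive.

Import Order.TTheory GRing.Theory Num.Theory.
Import numFieldNormedType.Exports.

Local Open Scope classical_set_scope.
Local Open Scope ring_scope.

(* An infinite word a_1 a_2 ... is a function a : nat -> nat; the value a 0
   is not part of the word. *)

Definition is_prefix (W : seq nat) (a : nat -> nat) : Prop :=
  W = [seq a i | i <- iota 1 (size W)].

(* [x] is rendered by Num.truncn and the upper integer part by the absolute
   value of Num.ceil; both are the intended naturals since x is positive. *)
Definition rat_power (W : seq nat) (x : rat) : seq nat :=
  flatten (nseq (Num.truncn x) W) ++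
  take `|Num.ceil ((x - (Num.truncn x)%:R) * (size W)%:R)|%N W.

Definition eventually_periodic (a : nat -> nat) : Prop :=
  exists n0 T : nat, (0 < T)%N /\ forall n, (n0 <= n)%N -> a (n + T)%N = a n.

Definition condition_star (w : rat) (a : nat -> nat) : Prop :=
  ~ eventually_periodic a /\
  exists V : nat -> seq nat,
    (forall n, (1 <= n)%N -> is_prefix (rat_power (V n) w) a) /\
    (forall n, (1 <= n)%N -> (size (V n) < size (V n.+1))%N).

(* [0; a_1, ..., a_l] *)
Definition cf_fin (R : realType) (a : nat -> nat) (l : nat) : R :=
  foldr (fun b x => (b%:R + x)^-1) 0 [seq a i | i <- iota 1 l].

(* [0; a_1, a_2, ...]; see cf_fin_cvg for convergence *)
Definition cf_val (R : realType) (a : nat -> nat) : R :=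
  lim (cf_fin R a @ \oo).

(* Numerators and denominators of the convergents; see cf_finE and
   cf_pq_coprime. *)
Fixpoint cf_p (a : nat -> nat) (l : nat) : nat :=
  match l with
  | 0 => 0
  | l1.+1 => match l1 with
             | 0 => 1
             | l2.+1 => a l * cf_p a l1 + cf_p a l2
             end
  end%N.

Fixpoint cf_q (a : nat -> nat) (l : nat) : nat :=
  match l with
  | 0 => 1
  | l1.+1 => match l1 with
             | 0 => a 1
             | l2.+1 => a l * cf_q a l1 + cf_q a l2
             end
  end%N.

Definition cf_q_roots_bounded (R : realType) (a : nat -> nat) : Prop :=
  exists M : R, forall l, (1 <= l)%N -> `|(cf_q a l)%:R `^ (l%:R^-1)| <= M.

Definition transcendental (R : realType) (x : R) : Prop :=
  ~ algebraicOver (@ratr R) x.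

Section Facts.
Variables (R : realType) (a : nat -> nat).
Hypothesis a_gt0 : forall l, (1 <= l)%N -> (0 < a l)%N.

Lemma cf_pSS l : cf_p a l.+2 = (a l.+2 * cf_p a l.+1 + cf_p a l)%N.
Proof. by []. Qed.

Lemma cf_qSS l : cf_q a l.+2 = (a l.+2 * cf_q a l.+1 + cf_q a l)%N.
Proof. by []. Qed.

Lemma cf_q_gt0 l : (0 < cf_q a l)%N.
Proof.
suff: (0 < cf_q a l)%N && (0 < cf_q a l.+1)%N by case/andP.
elim: l => [|l /andP[h1 h2]]; first by rewrite /= a_gt0.
by rewrite h2 cf_qSS addn_gt0 h1 orbT.
Qed.

Lemma cf_det l :
  (cf_p a l.+1)%:R * (cf_q a l)%:R - (cf_p a l)%:R * (cf_q a l.+1)%:R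
  = (-1) ^+ l :> R.
Proof.
elim: l => [|l IH]; first by rewrite /= expr0; ring.
by rewrite cf_pSS cf_qSS exprS -IH !natrD !natrM; ring.
Qed.

Lemma cf_pq_coprime l : coprime (cf_p a l) (cf_q a l).
Proof.
have H k : (cf_p a k.+1 * cf_q a k + odd k = cf_p a k * cf_q a k.+1 + ~~ odd k)%N.
  elim: k => [|k IH]; first by rewrite /= mul0n.
  by rewrite cf_pSS cf_qSS /= !mulnDl !mulnDr; move: IH; case: (odd k) => /=; nia.
rewrite /coprime -dvdn1.
have /dvdnP[u eu] := dvdn_gcdl (cf_p a l) (cf_q a l).
have /dvdnP[v ev] := dvdn_gcdr (cf_p a l) (cf_q a l).
move: (H l); set g := gcdn _ _ in eu ev *; rewrite eu ev.
set x := cf_p a l.+1; set y := cf_q a l.+1.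
have d1 : (g %| x * (v * g))%N by rewrite mulnA dvdn_mull.
have d2 : (g %| u * g * y)%N by rewrite mulnAC dvdn_mull.
case: (odd l) => /= E.
  by rewrite -(dvdn_addr _ d1) E addn0.
by rewrite -(dvdn_addr _ d2) -E addn0.
Qed.

Lemma cf_foldE l (x : R) : 0 <= x ->
  foldr (fun b x => (b%:R + x)^-1) x [seq a i | i <- iota 1 l.+1] =
  ((cf_p a l.+1)%:R + x * (cf_p a l)%:R) /
  ((cf_q a l.+1)%:R + x * (cf_q a l)%:R).
Proof.
elim: l x => [|l IH] x x0; first by rewrite /= mulr0 addr0 mulr1 mul1r.
have -> : iota 1 l.+2 = iota 1 l.+1 ++ [:: l.+2].
  by have := iotaD 1 l.+1 1; rewrite addn1.
rewrite map_cat foldr_cat [X in foldr _ X _]/=.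
have ax : 0 < (a l.+2)%:R + x by rewrite ltr_wpDr // ltr0n a_gt0.
rewrite IH ?invr_ge0 ?ltW // cf_pSS cf_qSS !natrD !natrM.
have q0 : 0 < (cf_q a l)%:R :> R by rewrite ltr0n cf_q_gt0.
have q1 : 0 < (cf_q a l.+1)%:R :> R by rewrite ltr0n cf_q_gt0.
have d1 : 0 < ((a l.+2)%:R + x) * (cf_q a l.+1)%:R + (cf_q a l)%:R :> R.
  by rewrite addr_gt0 // mulr_gt0.
field; rewrite !lt0r_neq0 //.
by rewrite (_ : _ + _ = ((a l.+2)%:R + x) * (cf_q a l.+1)%:R + (cf_q a l)%:R) //; ring.
Qed.

Lemma cf_finE l : cf_fin R a l = (cf_p a l)%:R / (cf_q a l)%:R.
Proof.
case: l => [|l]; first by rewrite mul0r.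
by rewrite /cf_fin cf_foldE // !mul0r !addr0.
Qed.

Lemma cf_q_prod l : (2 ^ l <= cf_q a l * cf_q a l.+1)%N.
Proof.
elim: l => [|l IH]; first by rewrite mul1n /= a_gt0.
have qle : (cf_q a l <= cf_q a l.+1)%N.
  case: (l) => [|k]; first by rewrite /= a_gt0.
  by rewrite cf_qSS; have := a_gt0 (l := k.+2) isT; nia.
by rewrite cf_qSS expnS; have := a_gt0 (l := l.+2) isT; nia.
Qed.

Lemma cf_fin_cvg : cvgn (cf_fin R a).
Proof.
have H : cvgn (series (telescope (cf_fin R a))).
  apply: normed_cvg.
  apply: (@series_le_cvg _ _ (geometric 1 2^-1)) => [n|n|n|] //=.
  - rewrite /telescope /=.
    have q0 : 0 < (cf_q a n)%:R :> R by rewrite ltr0n cf_q_gt0.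
    have q1 : 0 < (cf_q a n.+1)%:R :> R by rewrite ltr0n cf_q_gt0.
    have -> : cf_fin R a n.+1 - cf_fin R a n =
        (-1) ^+ n / ((cf_q a n)%:R * (cf_q a n.+1)%:R).
      by rewrite !cf_finE -cf_det; field; rewrite !lt0r_neq0.
    rewrite normrM normrX normrN1 expr1n mul1r mul1r exprVn.
    rewrite ger0_norm; last by rewrite invr_ge0 mulr_ge0 // ltW.
    rewrite lef_pV2 ?posrE ?exprn_gt0 ?mulr_gt0 //.
    by rewrite -natrX -natrM ler_nat cf_q_prod.
  - by apply: is_cvg_geometric_series; rewrite ger0_norm //; lra.
rewrite (_ : cf_fin R a = fun n => cf_fin R a 0 + series (telescope (cf_fin R a)) n); last first.
  by apply/funext => n; exact: eq_sum_telescope.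
by apply: is_cvgD => //; exact: is_cvg_cst.
Qed.

End Facts.

(* Main.v *)
(* Suppose that al is algebraic of degree d. A prefix V^w of a with |V| = r makes the tail of
   the continued fraction after r quotients so close to al that al is nearly a root of
   q_(r-1) X^2 + (q_r - p_(r-1)) X - p_r. If d <= 2, Liouville's inequality makes it an
   exact root; then al equals its own tail and a is periodic.

   If d >= 3, put x = (q_(r-1), q_r, p_(r-1), p_r). Every integer triple z for which z0,
   al z0 - z1 and al z1 - z2 lie in a suitable box yields an integer vector orthogonal to x at
   which four linear forms with coefficients in Q(al) are small, the exponents of the four
   bounds having a negative sum. For some box in a finite list there is a basis of Z^3 made of
   such z: otherwise lattice reduction produces at every scale T an integer quadratic P with
   |P| <= T^(1+eta) and |P(al)| <= T^(-3+eta), which is excluded, as in the work of Davenport and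
   Schmidt, by comparing a determinant of three of them with a resultant of two.

   Hence the hyperplanes orthogonal to infinitely many such x are spanned by small integer
   points. This is impossible, by the method of Roth and Schmidt: Siegel's lemma gives a
   multihomogeneous auxiliary polynomial in m blocks of four variables whose expansion in the
   four forms is balanced. By Roth's lemma, at the rational points -x_0/x_1, one of its
   derivatives of low order does not vanish identically on a product of m hyperplanes; but on
   integer combinations of the small points this derivative has integer coefficients of
   absolute value less than 1. *)

From HB Require Import structures.
From mathcomp Require Import all_boot all_order all_algebra fingroup perm.
From mathcomp Require Import boolp reals.
From mathcomp.analysis Require Import sequences exp.
From mathcomp Require Import zify ring lra.

Set Implicit Arguments.
Unset Strict Implicit.
Unset Printing Implicit Defensive.
Import Order.TTheory GRing.Theory Num.Theory.
Local Open Scope ring_scope.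

(** * Polynomials in several variables *)

(** The hyperplane method needs several small integer points in each hyperplane and exponents fixed
    in advance. The former is why integer triples z enter: they parametrise the points orthogonal to
    x (see [hyp_vec]), so a basis of Z^3 in a box gives three points that span the hyperplane, and
    no compound lattices occur. The latter is why the boxes come from a finite list: a single scale
    can fail, but among K + 1 scales in ratio 101/100, with K independent of r, one succeeds, and
    each of these K + 1 systems of exponents is excluded for large q_r. With q = q_r, T = q^t and
    eta = 1/100, the box has sides T^(3-eta), T^(-1-eta), T^(-1-eta). The four forms then have sizes
    q T^(3-eta), q T^(-1-eta) and twice q^(-1) T^(-1-eta), with product T^(-4 eta). The repetition
    in the word serves the last two: there z, of size T^(3-eta), is multiplied by the value at al of
    the quadratic polynomial, which has to be at most q^(-1) T^(-4). So t is limited by the ratio of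
    the logarithms of q_s and q_r, where s is the length of the repetition; the bound on q_l^(1/l)
    keeps this ratio away from 0 when w < 2. *)

Section NestedPoly.
Variable R : realType.

(** The variable number n is the outermost one of [mp n.+1]. Every notion below is a recursion that
    peels it off, which is the shape of the induction in Roth's lemma. *)
Fixpoint mp (n : nat) : idomainType := if n is n'.+1 then {poly mp n'} else R.

Fixpoint cst n : {rmorphism R -> mp n} :=
  match n return {rmorphism R -> mp n} with
  | 0 => idfun
  | n'.+1 => polyC \o cst n'
  end.

Fixpoint ev n (v : nat -> R) : {rmorphism mp n -> R} :=
  match n return {rmorphism mp n -> R} with
  | 0 => idfun
  | n'.+1 => horner_eval (v n') \o map_poly (ev n' v)
  end.

Fixpoint var n (i : nat) : mp n :=
  match n return mp n with
  | 0 => 0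
  | n'.+1 => if i == n' then 'X else (var n' i)%:P
  end.

(** Divided derivatives preserve integer coefficients and enlarge the norm only by a power of 2. *)
Fixpoint hasse n (d : nat -> nat) : {additive mp n -> mp n} :=
  match n return {additive mp n -> mp n} with
  | 0 => idfun
  | n'.+1 => map_poly (hasse n' d) \o nderivn (d n')
  end.

Fixpoint pd n (h : nat) : {additive mp n -> mp n} :=
  match n return {additive mp n -> mp n} with
  | 0 => \0
  | n'.+1 => if h == n' then (@deriv (mp n') : {additive {poly mp n'} -> {poly mp n'}})
             else (map_poly (pd n' h) : {additive {poly mp n'} -> {poly mp n'}})
  end.

Fixpoint nrm n : mp n -> R :=
  match n return mp n -> R with
  | 0 => fun x => `|x|
  | n'.+1 => fun P : {poly mp n'} => \sum_(i < size P) nrm P`_i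
  end.

Fixpoint intp n : mp n -> Prop :=
  match n return mp n -> Prop with
  | 0 => fun x : R => x \is a Num.int
  | n'.+1 => fun P : {poly mp n'} => forall i, intp P`_i
  end.

Fixpoint degle n (r : nat -> nat) : mp n -> Prop :=
  match n return mp n -> Prop with
  | 0 => fun _ => True
  | n'.+1 => fun P : {poly mp n'} => (size P <= (r n').+1)%N /\ forall i, degle r P`_i
  end.

(* The index of the polynomial at the point xi, for the weights w, is at least t. *)
Fixpoint idx n (w xi : nat -> R) (t : R) : mp n -> Prop :=
  match n return mp n -> Prop with
  | 0 => fun x : R => x != 0 -> t <= 0
  | n'.+1 => fun P : {poly mp n'} =>
     forall i, idx w xi (t - i%:R * w n') (P \Po ('X + (cst n' (xi n'))%:P))`_i
  end.

Lemma cstE n (c : R) : cst n.+1 c = (cst n c)%:P. Proof. by []. Qed.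

Lemma cst_eq0 n (c : R) : (cst n c == 0) = (c == 0).
Proof. exact: fmorph_eq0. Qed.

Lemma ev_cst n v c : ev n v (cst n c) = c.
Proof. by elim: n => [|n IH] //=; rewrite map_polyC /= /horner_eval hornerC. Qed.

Lemma ev_var n v i : (i < n)%N -> ev n v (var n i) = v i.
Proof.
elim: n => [|n IH] //= lin; rewrite /horner_eval.
have [->|ne] := eqVneq i n; first by rewrite map_polyX hornerX.
rewrite map_polyC hornerC; apply: IH.
by move: lin; rewrite ltnS leq_eqVlt (negPf ne).
Qed.

Lemma nrm_ge0 n (P : mp n) : 0 <= nrm P.
Proof. by elim: n P => [|n IH] P /=; [exact: normr_ge0|exact: sumr_ge0]. Qed.

Lemma nrm0 n : nrm (0 : mp n) = 0.
Proof. by case: n => [|n] /=; rewrite ?normr0 // size_poly0 big_ord0. Qed.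

Lemma nrm_wide n N (P : mp n.+1) : (size (P : {poly mp n}) <= N)%N ->
  nrm P = \sum_(i < N) nrm (P : {poly mp n})`_i.
Proof.
move=> le; rewrite /= (big_ord_widen_cond _ (fun _ => true) (fun i => nrm (P : {poly mp n})`_i) le).
rewrite big_mkcond /=; apply: eq_bigr => i _; case: ltnP => // ge.
by rewrite nth_default // nrm0.
Qed.

Lemma nrmD n (P Q : mp n) : nrm (P + Q) <= nrm P + nrm Q.
Proof.
elim: n P Q => [|n IH] P Q; first exact: ler_normD.
set N := maxn (size (P : {poly mp n})) (size (Q : {poly mp n})).
rewrite (@nrm_wide _ N (P + Q)) ?(@nrm_wide _ N P) ?(@nrm_wide _ N Q) ?leq_maxl ?leq_maxr //.
  by rewrite -big_split /=; apply: ler_sum => i _; rewrite coefD IH.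
exact: size_polyD.
Qed.

Lemma nrmN n (P : mp n) : nrm (- P) = nrm P.
Proof.
elim: n P => [|n IH] P; first exact: normrN.
by rewrite /= size_polyN; apply: eq_bigr => i _; rewrite coefN IH.
Qed.

Lemma nrm_sum n I (r : seq I) (A : pred I) (F : I -> mp n) :
  nrm (\sum_(i <- r | A i) F i) <= \sum_(i <- r | A i) nrm (F i).
Proof.
elim/big_ind2: _ => //; first by rewrite nrm0.
by move=> x a y b h1 h2; apply: le_trans (nrmD _ _) _; apply: lerD.
Qed.

Lemma nrmMXaddC n (P : {poly mp n}) (c : mp n) :
  nrm (P * 'X + c%:P : mp n.+1) = nrm (P : mp n.+1) + nrm c.
Proof.
rewrite (@nrm_wide _ (size P).+1); last first.
  apply: leq_trans (size_polyD _ _) _; rewrite geq_max size_polyC.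
  by rewrite (leq_trans (leq_b1 _)) // (leq_trans (size_polyMleq _ _)) // size_polyX addn2.
rewrite big_ord_recl /= coefD coefMX coefC /= add0r addrC; congr (_ + _).
by apply: eq_bigr => i _; rewrite coefD coefMX coefC /= addr0.
Qed.

Lemma nrmC n (c : mp n) : nrm (c%:P : mp n.+1) = nrm c.
Proof. by have := nrmMXaddC 0 c; rewrite mul0r add0r nrm0 add0r. Qed.

Lemma nrmM n (P Q : mp n) : nrm (P * Q) <= nrm P * nrm Q.
Proof.
elim: n P Q => [|n IH] P Q; first by rewrite /= normrM.
have hC c (S : {poly mp n}) : nrm (c%:P * S : mp n.+1) <= nrm c * nrm (S : mp n.+1).
  rewrite (@nrm_wide _ (size S)).
    by rewrite /= mulr_sumr; apply: ler_sum => i _; rewrite coefCM IH.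
  by rewrite -scale_polyE // size_scale_leq.
have hX (S : {poly mp n}) : nrm (S * 'X : mp n.+1) = nrm (S : mp n.+1).
  by have := nrmMXaddC S 0; rewrite addr0 nrm0 addr0.
elim/poly_ind: P Q => [|P c IHP] Q; first by rewrite !mul0r nrm0 mul0r.
rewrite nrmMXaddC mulrDl; apply: le_trans (nrmD _ _) _.
rewrite -mulrA ['X * _]mulrC mulrA hX mulrDl; apply: lerD; last exact: hC.
exact: IHP.
Qed.

Lemma nrm_cst n c : nrm (cst n c) = `|c|.
Proof. by elim: n => [|n IH] //; rewrite cstE nrmC. Qed.

Lemma nrm1 n : nrm (1 : mp n) = 1.
Proof. by rewrite -(rmorph1 (cst n)) nrm_cst normr1. Qed.

Lemma nrm_prod n I (r : seq I) (A : pred I) (F : I -> mp n) :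
  nrm (\prod_(i <- r | A i) F i) <= \prod_(i <- r | A i) nrm (F i).
Proof.
suff: 0 <= nrm (\prod_(i <- r | A i) F i) <= \prod_(i <- r | A i) nrm (F i) by case/andP.
elim/big_ind2: _ => //; first by rewrite nrm1 lexx ler01.
move=> x a y b /andP[h1 h2] /andP[h3 h4]; rewrite nrm_ge0 /=.
  by apply: le_trans (nrmM _ _) _; apply: ler_pM; rewrite ?nrm_ge0.
by move=> i _; rewrite nrm_ge0 lexx.
Qed.

Lemma nrmX n (P : mp n) k : nrm (P ^+ k) <= nrm P ^+ k.
Proof.
have := @nrm_prod n _ (index_enum 'I_k) xpredT (fun _ => P).
by rewrite !prodr_const card_ord.
Qed.

Lemma nrmMn n (P : mp n) k : nrm (P *+ k) = nrm P *+ k.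
Proof.
elim: n P => [|n IH] P; first by rewrite /= normrMn.
rewrite (@nrm_wide _ (size (P : {poly mp n})) (P *+ k)); last first.
  by elim: k {IH} => [|k IHk]; rewrite ?mulr0n ?size_poly0 // mulrS (leq_trans (size_polyD _ _)) // geq_max leqnn.
by rewrite /= -sumrMnl; apply: eq_bigr => i _; rewrite coefMn IH.
Qed.

Lemma nrm_var n i : nrm (var n i) <= 1.
Proof.
elim: n => [|n IH]; first by rewrite /= normr0 ler01.
rewrite [var _ _]/=; case: ifP => _; last by rewrite nrmC.
by have := nrmMXaddC 1 (0 : mp n); rewrite mul1r addr0 => ->; rewrite nrm0 addr0 nrm1.
Qed.

Lemma nrm_coef n (P : {poly mp n}) i : nrm P`_i <= nrm (P : mp n.+1).
Proof.
have [lt|ge] := ltnP i (size P); last by rewrite nth_default // nrm0 nrm_ge0.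
rewrite /= (bigD1 (Ordinal lt)) //= lerDl sumr_ge0 // => j _; exact: nrm_ge0.
Qed.

Lemma intp0 n : intp (0 : mp n).
Proof. by elim: n => [|n IH] /=; [exact: rpred0|move=> i; rewrite coef0]. Qed.

Lemma intpD n (P Q : mp n) : intp P -> intp Q -> intp (P + Q).
Proof.
elim: n P Q => [|n IH] P Q /=; first exact: rpredD.
by move=> hP hQ i; rewrite coefD; apply: IH.
Qed.

Lemma intpN n (P : mp n) : intp P -> intp (- P).
Proof.
elim: n P => [|n IH] P /=; first by rewrite rpredN.
by move=> hP i; rewrite coefN; apply: IH.
Qed.

Lemma intp_sum n I (r : seq I) (A : pred I) (F : I -> mp n) :
  (forall i, A i -> intp (F i)) -> intp (\sum_(i <- r | A i) F i).
Proof. by move=> h; elim/big_ind: _ => //; [exact: intp0|exact: intpD]. Qed.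

Lemma intpM n (P Q : mp n) : intp P -> intp Q -> intp (P * Q).
Proof.
elim: n P Q => [|n IH] P Q /=; first exact: rpredM.
by move=> hP hQ i; rewrite coefM; apply: intp_sum => j _; apply: IH.
Qed.

Lemma intp_cst n c : c \is a Num.int -> intp (cst n c).
Proof.
move=> hc; elim: n => [|n IH] //= i; rewrite coefC.
by case: ifP => // _; exact: intp0.
Qed.

Lemma intp_prod n I (r : seq I) (A : pred I) (F : I -> mp n) :
  (forall i, A i -> intp (F i)) -> intp (\prod_(i <- r | A i) F i).
Proof.
move=> h; elim/big_ind: _ => //; last exact: intpM.
by rewrite -(rmorph1 (cst n)); apply: intp_cst; exact: rpred1.
Qed.

Lemma intpX n (P : mp n) k : intp P -> intp (P ^+ k).
Proof. by move=> h; rewrite -(card_ord k) -prodr_const; apply: intp_prod. Qed.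

Lemma intpMn n (P : mp n) k : intp P -> intp (P *+ k).
Proof. by move=> h; rewrite -(card_ord k) -sumr_const; apply: intp_sum. Qed.

Lemma intp_var n i : intp (var n i).
Proof.
elim: n => [|n IH] /=; first exact: rpred0.
move=> j; case: ifP => _; rewrite ?coefX ?coefC.
  by rewrite -(rmorph_nat (cst n)); apply: intp_cst; exact: rpred_nat.
by case: ifP => // _; exact: intp0.
Qed.

Lemma intp_det n l (M : 'M[mp n]_l) : (forall i j, intp (M i j)) -> intp (\det M).
Proof.
move=> h; apply: intp_sum => s _; apply: intpM; last by apply: intp_prod.
by apply: intpX; apply: intpN; rewrite -(rmorph1 (cst n)); apply: intp_cst; exact: rpred1.
Qed.

Lemma intp_small n (P : mp n) : intp P -> nrm P < 1 -> P = 0.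
Proof.
elim: n P => [|n IH] P.
  move=> /= /intrP[z ->]; rewrite -intr_norm ltrz1 => h.
  by have -> : z = 0 by lia.
move=> hP lt; apply/polyP => i; rewrite coef0; apply: IH; first exact: hP.
exact: le_lt_trans (nrm_coef _ _) lt.
Qed.

Lemma hasse_cstM n d c (P : mp n) : hasse n d (cst n c * P) = cst n c * hasse n d P.
Proof.
elim: n P => [|n IH] P //=.
apply/polyP => i; rewrite coefCM !coef_map !coef_nderivn coefCM -mulrnAr.
exact: IH.
Qed.

(** Every coefficient gets multiplied by one binomial coefficient per variable, which is at most 2
    to the degree in that variable. *)
Lemma nrm_hasse n d r (P : mp n) : degle r P ->
  nrm (hasse n d P) <= 2 ^+ (\sum_(h < n) r h) * nrm P.
Proof.
elim: n P => [|n IH] P /=; first by rewrite big_ord0 expr0 mul1r.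
move=> [sP dP]; set Q := map_poly _ _.
change (nrm (Q : mp n.+1) <= 2 ^+ (\sum_(h < n.+1) r h) * nrm (P : mp n.+1)).
rewrite (@nrm_wide _ (size (P : {poly mp n}) - d n) Q); last first.
  by rewrite (leq_trans (size_poly _ _)) // size_poly.
apply: (@le_trans _ _ (\sum_(i < size (P : {poly mp n}) - d n)
    2 ^+ (\sum_(h < n.+1) r h) * nrm (P : {poly mp n})`_(d n + i))).
  apply: ler_sum => i _; rewrite /Q coef_map coef_nderivn raddfMn nrmMn.
  have -> : (\sum_(h < n.+1) r h = \sum_(h < n) r h + r n)%N by rewrite big_ord_recr.
  rewrite -(mulr_natr (nrm _)) exprD mulrAC; apply: ler_pM => //.
  - exact: nrm_ge0.
  - exact/IH/dP.
  - rewrite -natrX ler_nat.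
    apply: (@leq_trans (2 ^ (d n + i))); last first.
      rewrite leq_pexp2l //.
      have lti : (i < size (P : {poly mp n}) - d n)%N := ltn_ord i.
      have sP' : (size (P : {poly mp n}) <= (r n).+1)%N := sP.
      by move: lti sP'; set z := size _; lia.
    have := @Pascal 1 1 (d n + i); rewrite addn1 => ->.
    have lt : (d n < (d n + i).+1)%N by lia.
    by rewrite (bigD1 (Ordinal lt)) //= !exp1n !muln1 leq_addr.
rewrite -mulr_sumr ler_wpM2l ?exprn_ge0 //.
case: (leqP (size (P : {poly mp n})) (d n)) => le.
  have -> : (size (P : {poly mp n}) - d n = 0)%N by lia.
  by rewrite big_ord0; apply: sumr_ge0 => i _; exact: nrm_ge0.
rewrite -(big_mkord xpredT (fun i => nrm (P : {poly mp n})`_(d n + i))).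
rewrite -[X in _ <= X](big_mkord xpredT (fun i => nrm (P : {poly mp n})`_i)).
rewrite (@big_cat_nat _ _ _ (d n) 0 (size (P : {poly mp n}))) //=; last exact: ltnW.
have -> : \sum_(d n <= i < size (P : {poly mp n})) nrm (P : {poly mp n})`_i =
    \sum_(0 <= i < size (P : {poly mp n}) - d n) nrm (P : {poly mp n})`_(d n + i).
  by rewrite -{1}(add0n (d n)) big_addn; apply: eq_bigr => i _; rewrite addnC.
by rewrite lerDr; apply: sumr_ge0 => i _; exact: nrm_ge0.
Qed.

Lemma intp_hasse n d (P : mp n) : intp P -> intp (hasse n d P).
Proof.
elim: n P => [|n IH] P //= hP i.
by rewrite coef_map coef_nderivn raddfMn; apply: intpMn; apply: IH; apply: hP.
Qed.

Lemma degle0 n r : degle r (0 : mp n).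
Proof. by elim: n => [|n IH] //=; split => [|i]; rewrite ?size_poly0 ?coef0. Qed.

Lemma degleMn n r (P : mp n) k : degle r P -> degle r (P *+ k).
Proof.
elim: n P => [|n IH] P //= [sP dP]; split => [|i]; last by rewrite coefMn; apply: IH.
rewrite (leq_trans _ sP) //.
by elim: k {IH} => [|k IHk]; rewrite ?mulr0n ?size_poly0 // mulrS (leq_trans (size_polyD _ _)) // geq_max leqnn.
Qed.

Lemma degleD n r (P Q : mp n) : degle r P -> degle r Q -> degle r (P + Q).
Proof.
elim: n P Q => [|n IH] P Q //= [sP dP] [sQ dQ]; split => [|i]; last by rewrite coefD; apply: IH.
by rewrite (leq_trans (size_polyD _ _)) // geq_max sP sQ.
Qed.

Lemma degle_sum n r I (s : seq I) (A : pred I) (F : I -> mp n) :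
  (forall i, A i -> degle r (F i)) -> degle r (\sum_(i <- s | A i) F i).
Proof. by move=> h; elim/big_ind: _ => //; [exact: degle0|exact: degleD]. Qed.

Lemma degleM n r s (P Q : mp n) : degle r P -> degle s Q ->
  degle (fun h => r h + s h)%N (P * Q).
Proof.
elim: n P Q => [|n IH] P Q //= [sP dP] [sQ dQ]; split => [|i].
  apply: leq_trans (size_polyMleq _ _) _.
  by rewrite -ltnS; case: (size _) sP => [|a] sP; case: (size _) sQ => [|b] sQ //=; lia.
by rewrite coefM; apply: degle_sum => j _; apply: IH.
Qed.

Lemma degle_cst n r c : degle r (cst n c).
Proof.
elim: n => [|n IH] //=; split => [|i]; first by rewrite size_polyC; case: (_ != _).
by rewrite coefC; case: ifP => // _; exact: degle0.
Qed.

Lemma degle_prod n r I (s : seq I) (F : I -> mp n) :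
  (forall i, degle r (F i)) -> degle (fun h => size s * r h)%N (\prod_(i <- s) F i).
Proof.
move=> h; elim: s => [|x s IH]; first by rewrite big_nil -(rmorph1 (cst n)); exact: degle_cst.
by rewrite big_cons; have := degleM (h x) IH.
Qed.

Lemma degle_hasse n d r (P : mp n) : degle r P -> degle r (hasse n d P).
Proof.
elim: n P => [|n IH] P //= [sP dP]; split => [|i].
  rewrite (leq_trans _ sP) // (leq_trans (size_poly _ _)) // (leq_trans (size_poly _ _)) //.
  exact: leq_subr.
by rewrite coef_map coef_nderivn raddfMn; apply: degleMn; apply: IH.
Qed.

Lemma degle_det n r l (M : 'M[mp n]_l) : (forall i j, degle r (M i j)) ->
  degle (fun h => l * r h)%N (\det M).
Proof.
move=> h; apply: degle_sum => s _.
have -> : (-1) ^+ s = cst n ((-1) ^+ s) by rewrite rmorphXn rmorphN rmorph1.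
have := degleM (@degle_cst n (fun=> 0%N) ((-1) ^+ s)) (degle_prod (index_enum 'I_l) (fun i => h i (s i))).
have -> : size (index_enum 'I_l) = l by rewrite -[RHS]card_ord -sum1_card -sum1_size.
by [].
Qed.

Lemma nrm_det n l (M : 'M[mp n]_l) B : 0 <= B -> (forall i j, nrm (M i j) <= B) ->
  nrm (\det M) <= (l`!)%:R * B ^+ l.
Proof.
move=> B0 h; apply: le_trans (nrm_sum _ _ _) _.
apply: (@le_trans _ _ (\sum_(s : 'S_l) B ^+ l)).
  apply: ler_sum => s _; apply: le_trans (nrmM _ _) _.
  have -> : (-1) ^+ s = cst n ((-1) ^+ s) by rewrite rmorphXn rmorphN rmorph1.
  rewrite nrm_cst normrX normrN1 expr1n mul1r; apply: le_trans (nrm_prod _ _ _) _.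
  rewrite -[X in B ^+ X](card_ord l) -prodr_const.
  by apply: ler_prod => i _; rewrite nrm_ge0 h.
by rewrite sumr_const card_Sn mulr_natl.
Qed.

Lemma nderivn_shift (A : comNzRingType) (P : {poly A}) c k :
  P^`N(k) \Po ('X + c%:P) = (P \Po ('X + c%:P))^`N(k).
Proof.
elim/poly_ind: P k => [|P a IH] k; first by rewrite !(linear0, comp_poly0).
case: k => [|k]; first by rewrite !nderivn0.
have eq (Q : {poly A}) b : Q * ('X + c%:P) + b%:P = Q * 'X + 0%:P + (c *: Q + b%:P).
  by rewrite -mul_polyC; ring.
rewrite nderivnMXaddC !comp_polyD !comp_polyM !comp_polyX !comp_polyC eq.
rewrite nderivnD nderivnMXaddC nderivnD nderivnC /= addr0 nderivnZ !IH.
by rewrite -mul_polyC; ring.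
Qed.

Lemma idx_le n w xi (t t' : R) (P : mp n) : t' <= t -> idx w xi t P -> idx w xi t' P.
Proof.
elim: n P t t' => [|n IH] P t t' le /= h.
  by move=> /h; exact: le_trans.
by move=> i; apply: IH (h i); rewrite lerB.
Qed.

Lemma idx_le0 n w xi (t : R) (P : mp n) : (forall h, 0 <= w h) -> t <= 0 -> idx w xi t P.
Proof.
move=> w0; elim: n P t => [|n IH] P t t0 //= i; apply: IH.
by rewrite subr_le0 (le_trans t0) // mulr_ge0.
Qed.

Lemma idx0 n w xi (t : R) : idx w xi t (0 : mp n).
Proof. by elim: n t => [|n IH] t /=; [rewrite eqxx|move=> i; rewrite comp_poly0 coef0]. Qed.

Lemma idxD n w xi (t : R) (P Q : mp n) : idx w xi t P -> idx w xi t Q -> idx w xi t (P + Q).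
Proof.
elim: n P Q t => [|n IH] P Q t /= hP hQ; last first.
  by move=> i; rewrite comp_polyD coefD; apply: IH.
have [->|/hP //] := eqVneq P 0; by rewrite add0r.
Qed.

Lemma idx_sum n w xi (t : R) I (s : seq I) (A : pred I) (F : I -> mp n) :
  (forall i, A i -> idx w xi t (F i)) -> idx w xi t (\sum_(i <- s | A i) F i).
Proof. by move=> h; elim/big_ind: _ => //; [exact: idx0|exact: idxD]. Qed.

Lemma idxMn n w xi (t : R) (P : mp n) k : idx w xi t P -> idx w xi t (P *+ k).
Proof. by move=> h; rewrite -(card_ord k) -sumr_const; apply: idx_sum. Qed.

Lemma idxM n w xi (t s : R) (P Q : mp n) : idx w xi t P -> idx w xi s Q ->
  idx w xi (t + s) (P * Q).
Proof.
elim: n P Q t s => [|n IH] P Q t s /= hP hQ; last first.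
  move=> i; rewrite comp_polyM coefM; apply: idx_sum => j _.
  have -> : t + s - i%:R * w n = (t - j%:R * w n) + (s - (i - j)%:R * w n).
    by rewrite natrB ?leq_ord //; ring.
  exact: IH.
rewrite mulf_eq0 negb_or => /andP[/hP t0 /hQ s0]; lra.
Qed.

Lemma idx_cstM n w xi (t : R) c (P : mp n) : idx w xi t P -> idx w xi t (cst n c * P).
Proof.
elim: n P t => [|n IH] P t /= hP.
  by rewrite mulf_eq0 negb_or => /andP[_ /hP].
by move=> i; rewrite comp_polyM comp_polyC coefCM; apply: IH.
Qed.

Lemma idx_prod n w xi I (s : seq I) (T : I -> R) (F : I -> mp n) :
  (forall h, 0 <= w h) ->
  (forall i, idx w xi (T i) (F i)) -> idx w xi (\sum_(i <- s) T i) (\prod_(i <- s) F i).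
Proof.
move=> w0 h; elim/big_ind2: _ => //; first exact: idx_le0.
by move=> x1 x2 y1 y2; exact: idxM.
Qed.

(** The bound depends on the column alone, and each term of the Leibniz expansion meets every column
    once. *)
Lemma idx_det n w xi l (T : 'I_l -> R) (M : 'M[mp n]_l) : (forall h, 0 <= w h) ->
  (forall i j, idx w xi (T j) (M i j)) -> idx w xi (\sum_j T j) (\det M).
Proof.
move=> w0 h; apply: idx_sum => s _.
have -> : (-1) ^+ s = cst n ((-1) ^+ s) by rewrite rmorphXn rmorphN rmorph1.
apply: idx_cstM; rewrite (reindex_inj (@perm_inj _ s)) /=.
by apply: (@idx_prod n w xi _ _ (fun i => T (s i))).
Qed.

Lemma map_hasse_shift n d (P : {poly mp n}) c :
  map_poly (hasse n d) P \Po ('X + (cst n c)%:P) =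
  map_poly (hasse n d) (P \Po ('X + (cst n c)%:P)).
Proof.
elim/poly_ind: P => [|P a IH]; first by rewrite comp_poly0 raddf0 comp_poly0.
rewrite !(raddfD, comp_polyD) /= !map_polyC !comp_polyC map_polyC; congr (_ + _).
have -> (Q : {poly mp n}) : map_poly (hasse n d) (Q * 'X) = map_poly (hasse n d) Q * 'X.
  by apply/polyP => -[|i]; rewrite coef_map !coefMX ?raddf0 ?coef_map.
rewrite comp_polyM comp_polyX IH comp_polyM comp_polyX.
apply/polyP => i; rewrite coef_map !mulrDr !coefD !coefMC !coefMX raddfD /=.
rewrite ![_ * cst n c]mulrC hasse_cstM !coef_map; congr (_ + _).
by case: i => [|i]; rewrite ?raddf0 ?coef_map.
Qed.

Lemma idx_hasse n w xi (d : nat -> nat) (t : R) (P : mp n) : idx w xi t P ->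
  idx w xi (t - \sum_(h < n) (d h)%:R * w h) (hasse n d P).
Proof.
elim: n P t => [|n IH] P t /=; first by rewrite big_ord0 subr0.
move=> hP i; rewrite big_ord_recr /= map_hasse_shift coef_map nderivn_shift coef_nderivn raddfMn.
apply: idxMn.
have -> : t - (\sum_(h < n) (d h)%:R * w h + (d n)%:R * w n) - i%:R * w n =
  t - (d n + i)%:R * w n - \sum_(h < n) (d h)%:R * w h by rewrite natrD; ring.
exact: IH.
Qed.

(** In [roth_lemma] this absorbs the factor l by which an l x l determinant raises all degrees. *)
Lemma idx_scale n w xi (t c : R) (P : mp n) : 0 < c ->
  idx (fun h => c * w h) xi (c * t) P -> idx w xi t P.
Proof.
move=> c0; elim: n P t => [|n IH] P t /= h.
  by move=> /h; rewrite pmulr_rle0.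
move=> i; apply: IH; have := h i.
by congr (idx _ _ _ _); ring.
Qed.

(** After the shift in the last variable, the coefficient i of the product is U times a nonzero
    constant. *)
Lemma idx_separate n w xi (t : R) (U : mp n) (V : {poly R}) i :
  (V \Po ('X + (xi n)%:P))`_i != 0 ->
  idx w xi t (U%:P * map_poly (cst n) V : mp n.+1) ->
  idx w xi (t - i%:R * w n) U.
Proof.
move=> v0 /(_ i); rewrite comp_polyM comp_polyC coefCM.
have -> : map_poly (cst n) V \Po ('X + (cst n (xi n))%:P) =
   map_poly (cst n) (V \Po ('X + (xi n)%:P)).
  by rewrite map_comp_poly rmorphD /= map_polyX map_polyC.
rewrite coef_map => h; have := idx_cstM ((V \Po ('X + (xi n)%:P))`_i)^-1 h.
by rewrite mulrCA -rmorphM mulVf // rmorph1 mulr1.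
Qed.

Definition incr (d : nat -> nat) h : nat -> nat := fun k => (d k + (k == h))%N.

Lemma hasse_ext n d e (P : mp n) : (forall h, (h < n)%N -> d h = e h) ->
  hasse n d P = hasse n e P.
Proof.
elim: n P => [|n IH] P //= h; rewrite h // ; apply/polyP => i.
by rewrite !coef_map; apply: IH => k lt; apply: h; rewrite ltnS ltnW.
Qed.

Lemma pd_hasse n h d (P : mp n) : (h < n)%N ->
  pd n h (hasse n d P) = hasse n (incr d h) P *+ (d h).+1.
Proof.
elim: n P => [|n IH] P //= hn; have [->|ne] := eqVneq h n.
  apply/polyP => i; rewrite coefMn coef_deriv !coef_map !coef_nderivn /= /incr eqxx addn1.
  have -> : hasse n (fun k => d k + (k == n))%N (P`_((d n).+1 + i) *+ 'C((d n).+1 + i, (d n).+1)) =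
     hasse n d (P`_((d n).+1 + i) *+ 'C((d n).+1 + i, (d n).+1)).
    by apply: hasse_ext => k lt; rewrite (ltn_eqF lt) addn0.
  rewrite addnS addSn !raddfMn -!mulrnA; congr (_ *+ _).
  by rewrite [RHS]mulnC mul_bin_left mulnC; congr (_ * _)%N; lia.
have hn' : (h < n)%N by move: hn; rewrite ltnS leq_eqVlt (negPf ne).
apply/polyP => i; rewrite coefMn !coef_map !coef_nderivn /= [incr d h n]/incr eq_sym (negPf ne) addn0.
by rewrite IH.
Qed.

Lemma pdM n h (P Q : mp n) : pd n h (P * Q) = pd n h P * Q + P * pd n h Q.
Proof.
elim: n P Q => [|n IH] P Q /=; first by rewrite mul0r mulr0 addr0.
case: ifP => _; first exact: derivM.
apply/polyP => i; rewrite coef_map coefD !coefM raddf_sum -big_split /=.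
by apply: eq_bigr => j _; rewrite IH !coef_map.
Qed.

Lemma char0_mp n (x : mp n) k : (x *+ k == 0) = (k == 0)%N || (x == 0).
Proof.
rewrite -mulr_natl -(rmorph_nat (cst n)) mulf_eq0 cst_eq0; congr (_ || _).
by rewrite pnatr_eq0.
Qed.

(** The top coefficients of the two sides are the same product of leading coefficients, taken deg A
    times and deg B times; the characteristic is 0. *)
Lemma size_deriv_eq n (A B : {poly mp n}) : A != 0 -> B != 0 ->
  B * A^`() = A * B^`() -> size A = size B.
Proof.
move=> A0 B0 e.
have := congr1 (fun p : {poly mp n} => p`_((size A).-1 + (size B).-1).-1) e.
have h (C D : {poly mp n}) : D != 0 -> C != 0 -> ((size D).-1 + (size C).-1 != 0)%N ->
    (D * C^`())`_((size D).-1 + (size C).-1).-1 = lead_coef D * lead_coef C *+ (size C).-1.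
  move=> D0 C0 nz.
  case sC : (size C).-1 nz => [|c].
    rewrite addn0 => nz; have : size C = 1%N by move: sC; have := C0; rewrite -size_poly_gt0; lia.
    move=> /eqP/size_poly1P[c0 _ ->]; rewrite derivC mulr0 coef0 mulr0n.
    by [].
  move=> _; rewrite addnS /= coefM.
  have lt : ((size D).-1 < ((size D).-1 + c).+1)%N by lia.
  rewrite (bigD1 (Ordinal lt)) //= addKn coef_deriv big1 => [|i /negP ne].
    by rewrite addr0 lead_coefE lead_coefE sC mulrnAr.
  have [lti|gei] := ltnP i (size D).-1.
    rewrite coef_deriv [C`__]nth_default ?mul0rn ?mulr0 //.
    have -> : size C = c.+2 by rewrite -sC prednK // size_poly_gt0.
    by move: lti; set z := (size D).-1; lia.
  rewrite [D`_i]nth_default ?mul0r //.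
  have : (i : nat) != (size D).-1 by apply/negP => /eqP ei; apply: ne; apply/eqP/val_inj.
  have sD : size D = (size D).-1.+1 := polySpred D0.
  by move=> nei; apply: leq_trans (eq_leq sD) _; rewrite ltn_neqAle eq_sym nei.
have [z|nz] := eqVneq ((size A).-1 + (size B).-1)%N 0%N.
  by move: z; have := A0; have := B0; rewrite -!size_poly_gt0; lia.
rewrite {1}addnC !h //; last by rewrite addnC.
rewrite [lead_coef B * _]mulrC => /eqP; rewrite -subr_eq0.
have nz1 : lead_coef A * lead_coef B != 0 by rewrite mulf_neq0 ?lead_coef_eq0.
case: (ltngtP (size A) (size B)) => // lt.
  rewrite -opprB oppr_eq0 -mulrnBr; last by lia.
  rewrite char0_mp (negPf nz1) orbF.
  by have := A0; rewrite -size_poly_gt0; lia.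
rewrite -mulrnBr; last by lia.
rewrite char0_mp (negPf nz1) orbF.
by have := B0; rewrite -size_poly_gt0; lia.
Qed.

(** The hypothesis says that all partial derivatives of a / b vanish. The last variable shows that A
    and B are proportional to their leading coefficients, and these satisfy the hypothesis in one
    variable less. *)
Lemma prop_of_pd n (a b : mp n) : b != 0 ->
  (forall h, (h < n)%N -> b * pd n h a = a * pd n h b) ->
  exists c c0 : R, c0 != 0 /\ cst n c0 * a = cst n c * b.
Proof.
elim: n a b => [|n IH] a b b0 H.
  by exists a, b; split => //=; rewrite mulrC.
have [->|a0] := eqVneq a 0; first by exists 0, 1; split; rewrite ?oner_neq0 // mulr0 rmorph0 mul0r.
have Hn : (b : {poly mp n}) * (a : {poly mp n})^`() = (a : {poly mp n}) * (b : {poly mp n})^`().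
  by have := H n (ltnSn n); rewrite /= eqxx.
set A : {poly mp n} := a; set B : {poly mp n} := b.
have sAB : size A = size B by apply: size_deriv_eq.
(* If nonzero, [E] would have the size of [B], as it satisfies the same differential relation; but
   its coefficient in that degree cancels. *)
pose E := lead_coef B *: A - lead_coef A *: B.
have E0 : E = 0.
  apply/eqP/negPn/negP => nE.
  have e : B * E^`() = E * B^`().
    rewrite /E derivB !derivZ mulrBr mulrBl -!scalerAr -!scalerAl.
    by rewrite Hn.
  have sE := size_deriv_eq nE b0 e.
  have : E`_(size B).-1 != 0.
    by rewrite -sE -lead_coefE lead_coef_eq0.
  by rewrite coefB !coefZ -lead_coefE -sAB -lead_coefE mulrC subrr eqxx.
have eAB : lead_coef B *: A = lead_coef A *: B by apply/eqP; rewrite -subr_eq0 -/E E0.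
have lb0 : lead_coef B != 0 by rewrite lead_coef_eq0.
have [h hn|c [c0 [c00 e]]] := IH (lead_coef A) (lead_coef B) lb0.
  have := H h (ltnW hn : (h < n.+1)%N); rewrite /= (ltn_eqF hn) => e.
  have := congr1 (fun p : {poly mp n} => p`_((size B).-1 + (size B).-1)) e.
  have hc (C D : {poly mp n}) : size C = size B -> size D = size B ->
      (C * map_poly (pd n h) D)`_((size B).-1 + (size B).-1) = lead_coef C * pd n h (lead_coef D).
    move=> sC sD; rewrite coefM.
    have lt : ((size B).-1 < ((size B).-1 + (size B).-1).+1)%N by lia.
    rewrite (bigD1 (Ordinal lt)) //= addnK coef_map big1 => [|i /negP ne].
      by rewrite addr0 !lead_coefE sC sD.
    have [lti|gei] := ltnP i (size B).-1.
      rewrite coef_map [D`__]nth_default ?raddf0 ?mulr0 // sD.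
      have sB : size B = (size B).-1.+1 := polySpred b0.
      by rewrite {1}sB; move: lti; set z := (size B).-1; lia.
    rewrite [C`_i]nth_default ?mul0r // sC.
    have : (i : nat) != (size B).-1 by apply/negP => /eqP ei; apply: ne; apply/eqP/val_inj.
    have sB : size B = (size B).-1.+1 := polySpred b0.
    by move=> nei; apply: leq_trans (eq_leq sB) _; rewrite ltn_neqAle eq_sym nei.
  by rewrite !hc.
exists c, c0; split => //.
have eAB' : (lead_coef B)%:P * A = (lead_coef A)%:P * B by rewrite !mul_polyC.
have e' : (cst n c0)%:P * (lead_coef A)%:P = (cst n c)%:P * (lead_coef B)%:P.
  by rewrite -!polyCM e.
apply: (@mulfI {poly mp n} (lead_coef B)%:P); first by rewrite polyC_eq0.
etransitivity; first exact: (mulrCA (lead_coef B)%:P (cst n c0)%:P A).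
rewrite eAB'; etransitivity; first exact: (mulrA (cst n c0)%:P (lead_coef A)%:P B).
etransitivity; first exact: (congr1 (fun p : {poly mp n} => p * B) e').
by rewrite -mulrA; exact: mulrCA.
Qed.

Definition free_over n l (f : 'I_l -> mp n) :=
  forall c : 'I_l -> R, \sum_j cst n (c j) * f j = 0 -> forall j, c j = 0.

(** Induction on l: a nonzero Wronskian of all functions but the last is extended by one row. If
    every row of order at most l gave determinant 0, the cofactors of the new row would be constant
    multiples of one of them, and these constants would be a linear relation between the
    functions. *)
Lemma gen_wronskian n l (f : 'I_l -> mp n) : free_over f ->
  exists D : 'I_l -> nat -> nat,
    (forall i, (\sum_(h < n) D i h < l)%N) /\
    \det (\matrix_(i, j) hasse n (D i) (f j)) != 0.
Proof.
elim: l f => [|l IH] f fr.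
  by exists (fun _ _ => 0%N); split => [[]//|]; rewrite det_mx00 oner_neq0.
have [|D [Ds Dd]] := IH (fun j => f (lift ord_max j)).
  move=> c hc j.
  pose c' (k : 'I_l.+1) := if unlift ord_max k is Some k' then c k' else 0.
  have : \sum_j cst n (c' j) * f j = 0.
    rewrite (bigD1_ord ord_max) //= /c' unlift_none rmorph0 mul0r add0r -[RHS]hc.
    by apply: eq_bigr => k _; rewrite liftK.
  by move=> /fr/(_ (lift ord_max j)); rewrite /c' liftK.
pose M (e : nat -> nat) : 'M_l.+1 := \matrix_(i, j)
  if unlift ord_max i is Some i' then hasse n (D i') (f j) else hasse n e (f j).
pose v j := cofactor (M (fun=> 0%N)) ord_max j.
have cofE e j : cofactor (M e) ord_max j = v j.
  rewrite /v /cofactor; congr (_ * \det _); apply/matrixP => a b.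
  by rewrite !mxE liftK.
have detE e : \det (M e) = \sum_j hasse n e (f j) * v j.
  rewrite (expand_det_row _ ord_max); apply: eq_bigr => j _.
  by rewrite cofE mxE unlift_none.
have vmax : v ord_max != 0.
  rewrite /v /cofactor mulf_neq0 //; first by rewrite signr_eq0.
  have -> // : row' ord_max (col' ord_max (M (fun=> 0%N))) =
    \matrix_(i, j) hasse n (D i) (f (lift ord_max j)).
  by apply/matrixP => a b; rewrite !mxE liftK.
apply/not_existsP => Hno.
have H0 (e : nat -> nat) : (\sum_(h < n) e h < l.+1)%N -> \sum_j hasse n e (f j) * v j = 0.
  move=> se; rewrite -detE; apply/eqP/negPn/negP => nz.
  apply: (Hno (fun i => if unlift ord_max i is Some i' then D i' else e)); split.
    by move=> i; case: unliftP => [i' _|_] //; rewrite ltnW // ltnS Ds.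
  move: nz; congr (\det _ != 0); apply/matrixP => a b; rewrite !mxE.
  by case: unliftP.
(* Differentiating [H0] produces a relation of order one higher, which vanishes by [H0] again, plus
   the sum with the derivative on the cofactors. *)
have Hp h (e : nat -> nat) : (h < n)%N -> (\sum_(h < n) e h < l)%N -> \sum_j hasse n e (f j) * pd n h (v j) = 0.
  move=> hn se; have := congr1 (pd n h) (H0 e (ltnW se)).
  rewrite raddf0 raddf_sum /=.
  under eq_bigr do rewrite pdM pd_hasse //.
  rewrite big_split /=.
  under eq_bigr do rewrite mulrnAl.
  rewrite sumrMnl H0 ?mul0rn ?add0r //.
  rewrite ltnS /incr big_split /= [X in (_ + X)%N](bigD1 (Ordinal hn)) //= eqxx.
  rewrite [X in (_ + (_ + X) <= _)%N]big1 => [|k /negPf ne]; first by rewrite addn0 addn1.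
  by rewrite [_ == _]ne.
(* The vector [w] of the differences of both sides has entry 0 at [ord_max], so it is killed by the
   nonzero Wronskian of the remaining functions. *)
have Hw h j : (h < n)%N -> v ord_max * pd n h (v j) = v j * pd n h (v ord_max).
  move=> hn; have [->//|] := eqVneq j ord_max; move=> jm.
  have [j' ej _] : {j' | lift ord_max j' = j & True}.
    by case: (unliftP ord_max j) jm => [j' -> _|->]; [exists j'|rewrite eqxx].
  pose w (k : 'I_l) := v ord_max * pd n h (v (lift ord_max k)) - v (lift ord_max k) * pd n h (v ord_max).
  suff : w j' = 0 by rewrite /w ej => /eqP; rewrite subr_eq0 => /eqP.
  pose wv : 'rV_l := \row_k w k.
  have : wv *m (\matrix_(i, j) hasse n (D i) (f (lift ord_max j)))^T = 0.
    apply/rowP => i; rewrite !mxE.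
    have e1 := Hp h (D i) hn (Ds i); have e2 := H0 (D i) (ltnW (Ds i : (_ < l)%N) : (_ < l.+1)%N).
    have : \sum_k hasse n (D i) (f k) * (v ord_max * pd n h (v k) - v k * pd n h (v ord_max)) = 0.
      under eq_bigr do rewrite mulrBr mulrCA [_ * (v _ * _)]mulrA.
      by rewrite sumrB -mulr_sumr -mulr_suml e1 e2 mulr0 mul0r subr0.
    rewrite (bigD1_ord ord_max) //= subrr mulr0 add0r => e3; rewrite -[RHS]e3.
    by apply: eq_bigr => k _; rewrite !mxE mulrC.
  move=> e; have : wv == 0.
    apply/negPn/negP => nz; move: Dd; rewrite -det_tr => /negP; apply.
    by apply/det0P; exists wv.
  by move=> /eqP/rowP/(_ j'); rewrite !mxE.
have Hc j : {cc : R * R | cc.1 != 0 & cst n cc.1 * v j = cst n cc.2 * v ord_max}.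
  apply: cid2; have [c [c0 [c00 e]]] := prop_of_pd vmax (fun h hn => Hw h j hn).
  by exists (c0, c).
pose c j := (s2val (Hc j)).2 / (s2val (Hc j)).1.
have cv j : v j = cst n (c j) * v ord_max.
  rewrite /c; case: (Hc j) => -[c0 c1] /= c00 e.
  apply: (@mulfI _ (cst n c0)); first by rewrite cst_eq0.
  by rewrite e mulrA -rmorphM [c0 * _]mulrC divfK.
have : \sum_j cst n (c j) * f j = 0.
  apply: (@mulIf _ (v ord_max)) => //; rewrite mul0r mulr_suml.
  have := H0 (fun=> 0%N); rewrite big1 // => /(_ isT) e; rewrite -[RHS]e.
  apply: eq_bigr => j _; rewrite mulrAC -cv mulrC; congr (_ * _).
  elim: (n) (f j) => [|k IHk] P //=; rewrite nderivn0; apply/polyP => i.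
  by rewrite coef_map -IHk.
move=> /fr/(_ ord_max) c0; have := cv ord_max; rewrite c0 rmorph0 mul0r => /eqP.
by rewrite (negPf vmax).
Qed.

End NestedPoly.

Arguments cst {R} n.
Arguments ev {R} n v.
Arguments var {R} n i.
Arguments hasse {R} n d.
Arguments pd {R} n h.

(** * Roth's lemma *)

Section Roth.
Variable R : realType.

(** Gauss's lemma: q X - p is primitive because p and q are coprime, so the division over the
    rationals takes place over the integers. *)
Lemma int_root_factor (Q : {poly int}) (p : int) (q : nat) : (0 < q)%N -> coprimez p q ->
  root (map_poly intr Q : {poly R}) (p%:~R / q%:R) ->
  exists S : {poly int}, Q = (q%:Z%:P * 'X - p%:P) * S.
Proof.
move=> q0 cpq rt; set D := (_ - _)%R.
have q0' : (q%:Z)%:Q != 0 by rewrite intr_eq0; case: (q) q0.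
have rtQ : root (map_poly intr Q : {poly rat}) (p%:~R / q%:Z%:~R).
  have e : ratr (p%:~R / q%:Z%:~R) = p%:~R / q%:R :> R by rewrite fmorph_div /= !ratr_int.
  suff : root (map_poly (@ratr R) (map_poly intr Q)) (ratr (p%:~R / q%:Z%:~R)).
    by rewrite fmorph_root.
  by rewrite e -map_poly_comp (eq_map_poly (ratr_int R)).
have DQ : map_poly intr D = (q%:Z)%:Q *: ('X - (p%:~R / q%:Z%:~R)%:P) :> {poly rat}.
  rewrite /D rmorphB rmorphM /= !map_polyC map_polyX /= scalerBr -!mul_polyC -polyCM.
  by rewrite mulrCA mulfV // mulr1.
have : D %| Q by rewrite -dvdp_rat_int DQ dvdpZl // dvdp_XsubCl.
move=> /dvdpP_int[r Qr].
set a := zcontents D.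
have aD : D = a *: zprimitive D := zpolyEprim D.
have : (a %| zcontents D)%Z by exact: dvdzz.
rewrite dvdz_contents => /polyOverP aD'.
have a1 : (a %| q%:Z)%Z by have := aD' 1%N; rewrite coefB coefCM coefX coefC /= mulr1 subr0.
have a2 : (a %| p)%Z.
  by have := aD' 0%N; rewrite coefB coefCM coefX coefC /= mulr0 sub0r rpredN.
have a3 : (a %| gcdz p q)%Z by rewrite dvdz_gcd a1 a2.
have aa : a * a = 1.
  move: a3; rewrite (eqP cpq) dvdz1 => /eqP; case: (a) => // k; rewrite ?NegzE; lia.
have pD : zprimitive D = a *: D by rewrite [in RHS]aD scalerA aa scale1r.
by exists (a *: r); rewrite Qr pD -scalerAl -scalerAr.
Qed.

Lemma intpP1 (Q : {poly R}) : intp (Q : mp R 1) -> exists Qz : {poly int}, Q = map_poly intr Qz.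
Proof.
move=> iQ; exists (\poly_(i < size Q) Num.floor Q`_i); apply/polyP => i.
rewrite coef_map coef_poly; case: ltnP => [_|ge]; last by rewrite nth_default.
by rewrite /= floorK //; exact: iQ.
Qed.

(** The factor q X - p splits off k times over the integers, so q^k divides the leading coefficient
    of Q. *)
Lemma root_mult_bound (Q : {poly R}) (p : int) (q k : nat) : (0 < q)%N -> coprimez p q ->
  intp (Q : mp R 1) -> Q != 0 ->
  (forall i, (i < k)%N -> (Q \Po ('X + (p%:~R / q%:R)%:P))`_i = 0) ->
  q%:R ^+ k <= nrm (Q : mp R 1).
Proof.
move=> q0 cpq /intpP1[Qz ->]; move=> Qz0' h.
have Qz0 : Qz != 0 by apply: contraNneq Qz0' => ->; rewrite rmorph0.
have q0' : q%:R != 0 :> R by rewrite pnatr_eq0 -lt0n.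
suff [S eS] : exists S : {poly int}, Qz = (q%:Z%:P * 'X - p%:P) ^+ k * S.
  apply: le_trans (nrm_coef (map_poly intr Qz : {poly mp R 0}) (size Qz).-1).
  rewrite coef_map /= -lead_coefE eS lead_coefM lead_coef_exp.
  have -> : lead_coef (q%:Z%:P * 'X - p%:P) = q%:Z.
    rewrite lead_coefDl ?lead_coefM ?lead_coefC ?lead_coefX ?mulr1 //.
    rewrite size_polyN (leq_ltn_trans (size_polyC_leq1 _)) // size_Cmul ?size_polyX //.
    by case: (q) q0.
  have S0 : lead_coef S != 0.
    by rewrite lead_coef_eq0; apply: contraNneq Qz0 => S0; rewrite eS S0 mulr0.
  rewrite rmorphM rmorphXn /= normrM normrX normr_nat ler_peMr ?exprn_ge0 //.
  by rewrite -intr_norm ler1z -gtz0_ge1 normr_gt0.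
elim: k Qz {Qz0'} Qz0 h => [|k IH] Qz Qz0 h; first by exists Qz; rewrite expr0 mul1r.
have [|S eS] := @int_root_factor Qz p q q0 cpq.
  have := h 0%N (ltn0Sn k); rewrite -horner_coef0 horner_comp hornerD hornerX hornerC add0r.
  by move=> e; apply/eqP.
have S0 : S != 0 by apply: contraNneq Qz0 => S0; rewrite eS S0 mulr0.
have [i lik|S' eS'] := IH S S0.
  have eD : map_poly intr (q%:Z%:P * 'X - p%:P) = q%:R%:P * 'X - p%:~R%:P :> {poly R}.
    by rewrite rmorphB rmorphM /= !map_polyC map_polyX.
  have := h i.+1 lik; rewrite eS [map_poly _ (_ * S)]rmorphM /= eD.
  rewrite comp_polyM comp_polyB comp_polyM comp_polyX !comp_polyC.
  have -> : q%:R%:P * ('X + (p%:~R / q%:R)%:P) - p%:~R%:P = q%:R%:P * 'X :> {poly R}.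
    by rewrite mulrDr -polyCM mulrCA mulfV // mulr1 addrK.
  rewrite -mulrA coefCM mulrC coefXM /= => /eqP; rewrite mulf_eq0 (negPf q0') orbF.
  by move/eqP.
by exists S'; rewrite eS {1}eS' exprS mulrA.
Qed.

(** [phi] reads the coefficient of the leading monomial of U. Applied to the coefficients of a
    product of U with a polynomial V in a further variable, it recovers a multiple of V with control
    over integrality and size. *)
Lemma coef_functional n (U : mp R n) : U != 0 ->
  exists phi : mp R n -> R,
   [/\ forall x c, phi (x * cst n c) = phi x * c, phi U != 0,
       forall x, intp x -> phi x \is a Num.int & forall x, `|phi x| <= nrm x].
Proof.
elim: n U => [|n IH] U U0; first by exists id.
have l0 : lead_coef (U : {poly mp R n}) != 0 by rewrite lead_coef_eq0.
have [phi [h1 h2 h3 h4]] := IH _ l0.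
exists (fun x : {poly mp R n} => phi x`_(size (U : {poly mp R n})).-1); split => //.
- by move=> x c; rewrite cstE coefMC h1.
- by move=> x ix; apply: h3; apply: ix.
- by move=> x; apply: le_trans (h4 _) (nrm_coef _ _).
Qed.

(** [mu] is a permutation of the numbers below l. Those up to t (l - 1) / 2 number at least t l / 4,
    and each contributes at least t / 2, since l - 1 <= r. *)
Lemma truncated_sum_bound l r (t : R) (mu : 'I_l -> nat) : (0 < l)%N -> (l <= r.+1)%N ->
  (0 < r)%N -> 0 <= t -> t <= 1 -> injective mu -> (forall j, (mu j < l)%N) ->
  l%:R * (t ^+ 2 / 8) <= \sum_j Num.max 0 (t - (mu j)%:R / r%:R).
Proof.
move=> l0 lr r0 t0 t1 mi ml.
have inj : injective (fun j => Ordinal (ml j)) by move=> i j /(congr1 val)/mi.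
have -> : \sum_j Num.max 0 (t - (mu j)%:R / r%:R) = \sum_(i < l) Num.max 0 (t - i%:R / r%:R).
  by rewrite [RHS](reindex_inj inj).
set N := (Num.truncn (t * (l.-1)%:R / 2)).+1.
have x0 : 0 <= t * (l.-1)%:R / 2 by rewrite divr_ge0 ?mulr_ge0.
have Nlt : t * (l.-1)%:R / 2 < N%:R by apply: truncnS_gt.
have Nle : N.-1%:R <= t * (l.-1)%:R / 2 by rewrite /= truncn_le.
have Nl : (N <= l)%N.
  have : N.-1%:R <= (l.-1)%:R :> R.
    apply: le_trans Nle _; have : 0 <= (l.-1)%:R :> R by []; nra.
  by rewrite ler_nat /N; case: (l) l0 => //.
have -> : \sum_(i < l) Num.max 0 (t - i%:R / r%:R) =
  \sum_(i < l | (i < N)%N) Num.max 0 (t - i%:R / r%:R) + \sum_(i < l | ~~ (i < N)%N) Num.max 0 (t - i%:R / r%:R).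
  by rewrite (bigID (fun i : 'I_l => (i < N)%N)).
apply: (@le_trans _ _ (\sum_(i < l | (i < N)%N) Num.max 0 (t - i%:R / r%:R))); last first.
  by rewrite lerDl; apply: sumr_ge0 => i _; rewrite le_max lexx.
rewrite -(big_ord_widen _ (fun i => Num.max 0 (t - i%:R / r%:R)) Nl).
apply: (@le_trans _ _ (\sum_(i < N) t / 2)); last first.
  apply: ler_sum => i _; rewrite le_max; apply/orP; right.
  have r0' : 0 < r%:R :> R by rewrite ltr0n.
  have : i%:R / r%:R <= t / 2.
    rewrite ler_pdivrMr //; apply: (@le_trans _ _ (t * (l.-1)%:R / 2)).
      by apply: le_trans Nle; rewrite ler_nat -ltnS.
    have : (l.-1)%:R <= r%:R :> R by rewrite ler_nat; lia.
    nra.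
  lra.
rewrite sumr_const card_ord -[_ *+ N]mulr_natl.
have N1 : 1 <= N%:R :> R by rewrite ler1n.
suff : t * l%:R / 4 <= N%:R by nra.
case: (ltnP l 2) => l2.
  have -> : l = 1%N by lia.
  lra.
have : l%:R <= (l.-1)%:R * 2 :> R by rewrite -natrM ler_nat; lia.
nra.
Qed.

Definition separated n (P : {poly mp R n}) l :=
  exists (f : 'I_l -> mp R n) (g : 'I_l -> {poly R}),
    P = \sum_j (f j)%:P * map_poly (cst n) (g j).

(** With the least possible number of terms, a linear relation among the [f] or among the [g] would
    allow one term to be removed. *)
Lemma minimal_separation n (P : {poly mp R n}) : P != 0 ->
  exists l (f : 'I_l -> mp R n) (g : 'I_l -> {poly R}),
   [/\ P = \sum_j (f j)%:P * map_poly (cst n) (g j), (0 < l)%N, (l <= size P)%N,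
       free_over f & free_over (n := 1) g].
Proof.
move=> P0.
have ex : exists l, `[< separated P l >].
  exists (size P); apply/asboolP; exists (fun j => P`_j), (fun j : 'I__ => 'X^j).
  rewrite -{1}[P]coefK poly_def; apply: eq_bigr => j _.
  by rewrite map_polyXn mul_polyC.
case: (ex_minnP ex) => l /asboolP[f [g Pfg]] min.
have lsz : (l <= size P)%N.
  apply: min; apply/asboolP; exists (fun j => P`_j), (fun j : 'I__ => 'X^j).
  rewrite -{1}[P]coefK poly_def; apply: eq_bigr => j _.
  by rewrite map_polyXn mul_polyC.
have l0 : (0 < l)%N.
  by rewrite lt0n; apply/negP => /eqP l0; move: P0; rewrite Pfg; subst l; rewrite big_ord0 eqxx.
have hm1 a (x : {poly R}) : map_poly (cst n) (a%:P * x) = (cst n a)%:P * map_poly (cst n) x.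
  by rewrite rmorphM /= map_polyC.
have hm2 a (x y : {poly R}) : map_poly (cst n) (x - a%:P * y) =
    map_poly (cst n) x - (cst n a)%:P * map_poly (cst n) y.
  by rewrite rmorphB /= hm1.
exists l, f, g; split => //.
- move=> c hc k; apply/eqP/negPn/negP => ck.
  case: l => [|l] in f g Pfg min lsz l0 c hc k ck *; first by case: k ck.
  suff : (l.+1 <= l)%N by rewrite ltnn.
  apply: min; apply/asboolP.
  exists (fun j => f (lift k j)), (fun j => g (lift k j) - (c (lift k j) / c k)%:P * g k).
  rewrite Pfg (bigD1_ord k) //=.
  have fk : f k = - \sum_j cst n (c (lift k j) / c k) * f (lift k j).
    apply/eqP; rewrite -addr_eq0; apply/eqP.
    apply: (@mulfI _ (cst n (c k))); first by rewrite cst_eq0.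
    rewrite mulr0 -[RHS]hc (bigD1_ord k) //= mulrDr; congr (_ + _).
    rewrite mulr_sumr; apply: eq_bigr => j _.
    by rewrite mulrA -rmorphM [c k * _]mulrC divfK.
  rewrite fk polyCN rmorph_sum /= mulNr mulr_suml -sumrN -big_split /=.
  apply: eq_bigr => j _; rewrite hm2 polyCM mulrBr addrC.
  by congr (_ - _); rewrite mulrCA mulrA.
- move=> c hc k; apply/eqP/negPn/negP => ck.
  case: l => [|l] in f g Pfg min lsz l0 c hc k ck *; first by case: k ck.
  suff : (l.+1 <= l)%N by rewrite ltnn.
  apply: min; apply/asboolP.
  exists (fun j => f (lift k j) - cst n (c (lift k j) / c k) * f k), (fun j => g (lift k j)).
  rewrite Pfg (bigD1_ord k) //=.
  have gk : g k = - \sum_j (c (lift k j) / c k)%:P * g (lift k j).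
    apply/eqP; rewrite -addr_eq0; apply/eqP.
    apply: (@mulfI _ (c k)%:P); first by rewrite polyC_eq0.
    rewrite mulr0 -[RHS]hc (bigD1_ord k) //= mulrDr; congr (_ + _).
    rewrite mulr_sumr; apply: eq_bigr => j _.
    by rewrite mulrA -polyCM [c k * _]mulrC divfK.
  rewrite gk rmorphN rmorph_sum /= mulrN mulr_sumr -sumrN -big_split /=.
  apply: eq_bigr => j _; rewrite hm1 polyCB polyCM mulrBl addrC.
  by congr (_ - _); rewrite -mulrA mulrCA.
Qed.

Lemma expR_natX (x : R) k : expR x ^+ k = expR (k%:R * x).
Proof. by rewrite expRM_natl. Qed.

(* The determinant of the derivatives of P = \sum_j f_j g_j splits as a Wronskian
   of the f_j times a Wronskian of the g_j, while each of its entries still has a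
   large index; this is what makes the induction on the number of variables work. *)
Lemma separated_wronskian n (P : {poly mp R n}) : P != 0 ->
  exists l (D : 'I_l -> nat -> nat) (mu : 'I_l -> nat) (U : mp R n) (V : {poly R}),
   [/\ (0 < l)%N /\ (l <= size P)%N, (forall i, (\sum_(h < n) D i h < l)%N) /\ (forall j, (mu j < l)%N),
       injective mu, U != 0 /\ V != 0 &
      \det (\matrix_(i, j) hasse n.+1 (fun h => if h == n then mu j else D i h) (P : mp R n.+1))
        = U%:P * map_poly (cst n) V].
Proof.
move=> P0; have [l [f [g [Pfg l0 lsz ff fg]]]] := minimal_separation P0.
have [D [Ds Dd]] := gen_wronskian ff.
have [E [Es Ed]] := gen_wronskian fg.
exists l, D, (fun j => E j 0%N), (\det (\matrix_(i, j) hasse n (D i) (f j))),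
  (\det (\matrix_(j, i) (g j)^`N(E i 0%N))).
have hE : (\matrix_(j, i) (g j)^`N(E i 0%N)) = (\matrix_(i, j) hasse 1 (E i) (g j : mp R 1))^T.
  by apply/matrixP => i j; rewrite !mxE /= map_poly_id.
split => //.
- by split => // j; have := Es j; rewrite big_ord1.
- move=> i j e; apply/eqP/negPn/negP => ne; move: Ed => /negP; apply; apply/eqP.
  apply: (determinant_alternate ne) => k; rewrite !mxE.
  by apply: hasse_ext => h; rewrite ltnS leqn0 => /eqP ->.
- by split => //; rewrite hE det_tr.
transitivity (\det (map_mx polyC (\matrix_(i, j) hasse n (D i) (f j)) *m
    map_mx (map_poly (cst n)) (\matrix_(j, i) (g j)^`N(E i 0%N)))); last first.
  by rewrite det_mulmx !det_map_mx.
congr (\det _); apply/matrixP => i j.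
rewrite !mxE /= eqxx {1}Pfg raddf_sum raddf_sum /=; apply: eq_bigr => k _; rewrite !mxE.
have -> : ((f k)%:P * map_poly (cst n) (g k))^`N(E j 0%N) = (f k)%:P * map_poly (cst n) (g k)^`N(E j 0%N).
  by rewrite mul_polyC nderivnZ nderivn_map mul_polyC.
apply/polyP => a; rewrite coef_map !coefCM !coef_map /= mulrC hasse_cstM mulrC; congr (_ * _).
by apply: hasse_ext => h lt; rewrite (ltn_eqF lt).
Qed.

Lemma fact_leq_expn k : (k`! <= k ^ k)%N.
Proof.
elim: k => [|k IH] //; rewrite factS expnS leq_mul2l /= (leq_trans IH) //.
by case: k {IH} => // k; rewrite leq_exp2r.
Qed.

(** Induction on the number of variables. The Wronskian W = U V has degrees at most l r, norm at
    most exp(3 l om lam) and index at least l e^2 / 32. The factor V, in the last variable alone,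
    takes at most 3 om l of this index, so U keeps l e^2 / 64, that is e^2 / 64 relative to the
    degrees l r. *)
Theorem roth_lemma n (e : R) : 0 < e -> e <= 1 ->
  exists om : R, [/\ 0 < om, om <= 1 &
  forall (r : nat -> nat) (p : nat -> int) (q : nat -> nat) (lam : R) (P : mp R n),
    0 <= lam ->
    (forall h, (h < n)%N -> [/\ (0 < r h)%N, (0 < q h)%N, coprimez (p h) (q h) &
                                lam <= (r h)%:R * ln ((q h)%:R : R)]) ->
    (forall h k, (h < k)%N -> (k < n)%N -> (r k)%:R <= om * (r h)%:R) ->
    P != 0 -> degle r P -> intp P -> nrm P <= expR (om * lam) ->
    (\sum_(h < n) r h)%:R * ln 2 <= om * lam ->
    ~ idx (fun h => (r h)%:R^-1) (fun h => (p h)%:~R / (q h)%:R) e P].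
Proof.
elim: n e => [|n IH] e e0 e1.
  exists 1; split => // r p q lam P _ _ _ P0 _ _ _ _ /= /(_ P0).
  by rewrite leNgt e0.
have [||om' [om'0 om'1 IH']] := IH (e ^+ 2 / 64); first by rewrite divr_gt0 ?exprn_gt0.
  by rewrite expr2; nra.
set om := Num.min (om' / 3) (e ^+ 2 / 192).
have om0 : 0 < om by rewrite lt_min !divr_gt0 ?exprn_gt0.
have omle1 : om * 3 <= om' by rewrite -ler_pdivlMr // ge_min lexx.
have omle2 : om * 192 <= e ^+ 2 by rewrite -ler_pdivlMr // ge_min lexx orbT.
have om1 : om <= 1 by lra.
exists om; split => // r p q lam P lam0 hq hr P0 dP iP nP sR hidx.
have [rn0 qn0 cpq lamn] := hq n (ltnSn n).
pose w h : R := (r h)%:R^-1; pose xi h : R := (p h)%:~R / (q h)%:R.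
have w0 h : 0 <= w h by rewrite invr_ge0.
have ln2 : 0 < ln 2 :> R by rewrite ln_gt0 // ltr1n.
have lam_gt0 : 0 < lam.
  rewrite lt_neqAle lam0 andbT; apply/eqP => l0; move: sR; rewrite -l0 mulr0.
  rewrite big_ord_recr natrD mulrDl leNgt => /negP; apply.
  by rewrite ltr_wpDl ?mulr_ge0 ?mulr_gt0 ?ltr0n // ltW.
have rn0' : 0 < (r n)%:R :> R by rewrite ltr0n.
have lnq : 0 < ln ((q n)%:R : R).
  by move: (lt_le_trans lam_gt0 lamn); rewrite pmulr_rgt0.
have [sP dP'] := dP.
have [l [D [mu [U [V [[l0 lsz] [Ds mul] mui [U0 V0] WE]]]]]] := separated_wronskian P0.
have lr : (l <= (r n).+1)%N := leq_trans lsz sP.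
set M : 'M[mp R n.+1]_l := \matrix_(i, j) _ in WE.
set W : mp R n.+1 := \det M.
have {}WE : W = (U%:P * map_poly (cst n) V : {poly mp R n}) := WE.
set Rs := (\sum_(h < n.+1) r h)%N.
have nM i j : nrm (M i j) <= 2 ^+ Rs * nrm P by rewrite mxE; exact: nrm_hasse.
have B0 : 0 <= 2 ^+ Rs * nrm P by rewrite mulr_ge0 ?exprn_ge0 ?nrm_ge0.
(* One factor exp(om lam) per row for each of three sources: the factorial of l, the divided
   derivatives and the norm of [P]. *)
have nW : nrm W <= expR (l%:R * (3 * (om * lam))).
  apply: le_trans (nrm_det B0 nM) _; rewrite -expR_natX.
  apply: (@le_trans _ _ ((2 ^+ Rs) ^+ l * (2 ^+ Rs * nrm P) ^+ l)).
    apply: ler_wpM2r; first exact: exprn_ge0.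
    rewrite -!natrX ler_nat; apply: leq_trans (fact_leq_expn l) _; rewrite leq_exp2r //.
    apply: leq_trans lr _; apply: (@leq_trans (2 ^ r n)); first exact: ltn_expl.
    by rewrite leq_exp2l // /Rs big_ord_recr /= leq_addl.
  rewrite -exprMn; apply: lerXn2r; rewrite ?nnegrE ?mulr_ge0 ?exprn_ge0 ?nrm_ge0 ?expR_ge0 //.
  have h2 : 2 ^+ Rs <= expR (om * lam) :> R.
    have -> : 2 ^+ Rs = expR (Rs%:R * ln 2) :> R by rewrite -expR_natX lnK // posrE.
    by rewrite ler_expR.
  have -> : 3 * (om * lam) = om * lam + (om * lam + om * lam) by ring.
  rewrite !expRD; apply: ler_pM => //; rewrite ?exprn_ge0 ?mulr_ge0 ?nrm_ge0 ?exprn_ge0 //.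
  by apply: ler_pM => //; rewrite ?exprn_ge0 ?nrm_ge0.
have iM i j : intp (M i j) by rewrite mxE; exact: intp_hasse.
have iW : intp W by exact: intp_det.
have dW : degle (fun h => l * r h)%N W.
  by apply: degle_det => i j; rewrite mxE; exact: degle_hasse.
(* The derivatives in the first n variables have order at most l - 1 <= r n and weights at most om /
   r n, so they cost at most [om]; the derivative in the last variable costs mu j / r n. *)
pose th (j : 'I_l) : R := Num.max 0 (e - om - (mu j)%:R / (r n)%:R).
have idW : idx w xi (\sum_j th j) W.
  apply: idx_det => // i j; rewrite /th; case: leP => _; last by apply: idx_le0.
  rewrite mxE; set d := fun h => _.
  apply: idx_le (idx_hasse d hidx).
  rewrite big_ord_recr /= {2}/d eqxx opprD addrA lerB // lerB //.
  apply: (@le_trans _ _ (\sum_(h < n) (D i h)%:R * (om / (r n)%:R))).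
    apply: ler_sum => h _; rewrite /d (ltn_eqF (ltn_ord h)); apply: ler_wpM2l => //.
    have := hr h n (ltn_ord h) (ltnSn n).
    have [rh0 _ _ _] := hq h (ltnW (ltn_ord h : (h < n)%N) : (h < n.+1)%N).
    have rh0' : 0 < (r h)%:R :> R by rewrite ltr0n.
    by rewrite /w => hh; rewrite ler_pdivlMr // [_^-1 * _]mulrC ler_pdivrMr.
  rewrite -mulr_suml -natr_sum mulrA ler_pdivrMr // mulrC; apply: ler_wpM2l; first exact: ltW.
  by rewrite ler_nat -ltnS (leq_trans (Ds i)).
have sth : l%:R * (e ^+ 2 / 32) <= \sum_j th j.
  apply: (@le_trans _ _ (l%:R * ((e - om) ^+ 2 / 8))).
    by apply: ler_wpM2l => //; rewrite !expr2 in omle2 *; nra.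
  by apply: truncated_sum_bound => //; rewrite ?expr2 in omle2 *; nra.
have shV : V \Po ('X + (xi n)%:P) != 0.
  apply: contraNneq V0 => e'; have := congr1 (fun p => p \Po ('X - (xi n)%:P)) e'.
  rewrite comp_poly0 -comp_polyA comp_polyD comp_polyX comp_polyC subrK comp_polyXr.
  by move=> ->.
have exi : exists i, (V \Po ('X + (xi n)%:P))`_i != 0.
  by exists (size (V \Po ('X + (xi n)%:P))).-1; rewrite -lead_coefE lead_coef_eq0.
case: (ex_minnP exi) => i0 vi0 imin.
have [phi [ph1 ph2 ph3 ph4]] := coef_functional U0.
have phW (i : nat) : (phi U *: V)`_i = phi (W : {poly mp R n})`_i.
  by rewrite WE coefZ coefCM coef_map ph1.
(* [V] itself may fail to have integer coefficients, but [phi U *: V] has them: they are the values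
   of [phi] at the coefficients of [W]. *)
have i0le : i0%:R <= 3 * om * l%:R * (r n)%:R :> R.
  have h : (q n)%:R ^+ i0 <= nrm (phi U *: V : mp R 1).
    apply: (@root_mult_bound _ (p n)) => //.
    - by move=> i; rewrite phW; apply: ph3; apply: iW.
    - by rewrite scaler_eq0 negb_or ph2 V0.
    - move=> i lt; rewrite comp_polyZ coefZ.
      by have [->|/imin] := eqVneq ((V \Po ('X + (xi n)%:P))`_i) 0; rewrite ?mulr0 // leqNgt lt.
  have h2 : nrm (phi U *: V : mp R 1) <= nrm W.
    rewrite (@nrm_wide _ _ (size (W : {poly mp R n}))).
      by apply: ler_sum => i _; rewrite phW; exact: ph4.
    apply/leq_sizeP => j hj; rewrite phW.
    by rewrite nth_default //; have := ph1 0 0; rewrite mul0r mulr0.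
  have : expR (i0%:R * ln ((q n)%:R : R)) <= expR (l%:R * (3 * (om * lam))).
    rewrite -expR_natX lnK ?posrE ?ltr0n //.
    by apply: le_trans h (le_trans h2 nW).
  rewrite ler_expR => h3.
  have : i0%:R * ln ((q n)%:R : R) <= 3 * om * l%:R * (r n)%:R * ln ((q n)%:R : R).
    apply: le_trans h3 _.
    have -> : l%:R * (3 * (om * lam)) = 3 * om * l%:R * lam by ring.
    by rewrite -[leRHS]mulrA ler_wpM2l // !mulr_ge0 // ltW.
  by rewrite ler_pM2r.
have idU : idx w xi (\sum_j th j - i0%:R * w n) U.
  by apply: (idx_separate vi0); rewrite -WE.
have exk : V`_(size V).-1 != 0 by rewrite -lead_coefE lead_coef_eq0.
set k := (size V).-1 in exk.
(* A constant multiple of [U] with integer coefficients, to which the induction hypothesis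
   applies. *)
pose Wk : mp R n := (W : {poly mp R n})`_k.
have WkE : Wk = cst n V`_k * U by rewrite /Wk WE coefCM coef_map mulrC.
have Wk0 : Wk != 0 by rewrite WkE mulf_neq0 ?cst_eq0.
have idWk : idx w xi (l%:R * (e ^+ 2 / 64)) Wk.
  rewrite WkE; apply: idx_cstM; apply: idx_le idU.
  have : i0%:R * w n <= 3 * om * l%:R by rewrite /w ler_pdivrMr.
  have : 3 * om * l%:R <= l%:R * (e ^+ 2 / 64).
    by rewrite mulrC ler_wpM2l //; lra.
  by lra.
have l0' : 0 < l%:R :> R by rewrite ltr0n.
have [sW dW'] := dW.
apply: (IH' (fun h => l * r h)%N p q (l%:R * lam) Wk) => //.
- by rewrite mulr_ge0.
- move=> h hn; have [a1 a2 a3 a4] := hq h (ltnW (hn : (h < n)%N) : (h < n.+1)%N).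
  by split => //; rewrite ?muln_gt0 ?l0 // natrM -mulrA ler_wpM2l.
- move=> h k' hk kn; rewrite !natrM mulrCA ler_wpM2l //.
  apply: le_trans (hr h k' hk (ltnW (kn : (k' < n)%N) : (k' < n.+1)%N)) _.
  by rewrite ler_wpM2r //; lra.
- exact: dW'.
- exact: iW.
- apply: le_trans (nrm_coef _ _) (le_trans nW _).
  by rewrite ler_expR [leRHS]mulrCA ler_wpM2l // mulrA ler_wpM2r // mulrC.
- rewrite -big_distrr /= natrM -mulrA [leRHS]mulrCA ler_wpM2l //.
  apply: (@le_trans _ _ (om * lam)); last by rewrite ler_wpM2r //; lra.
  apply: le_trans sR; rewrite /Rs big_ord_recr /= natrD mulrDl lerDl mulr_ge0 //.
  exact: ltW.
apply: (@idx_scale _ _ _ _ _ l%:R); first by [].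
move: idWk; congr (idx _ _ _ _); apply/funext => h.
by rewrite /w natrM invfM mulrA mulfV ?mul1r // gt_eqF.
Qed.

End Roth.

(** * The auxiliary polynomial *)

(** Pigeonhole: there are (S + 1)^|I| vectors with entries from 0 to S, and each form takes at most
    S^2 + 1 values on them, in an interval that [S * neg e] translates to start at 0. Since 2 |E| <=
    |I|, there are more vectors than systems of values; the solution is a difference of two
    vectors. *)
Lemma siegel (I E : finType) (A : E -> I -> int) (S : nat) :
  (0 < S)%N -> (0 < #|I|)%N -> (2 * #|E| <= #|I|)%N ->
  (forall e, (\sum_i `|A e i|%N <= S)%N) ->
  exists x : I -> int, [/\ exists i, x i != 0, forall i, (`|x i| <= S)%N &
    forall e, \sum_i A e i * x i = 0].
Proof.
move=> S0 I0 EI hS.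
pose neg e := (\sum_i (if (A e i < 0)%R then `|A e i| else 0))%N.
pose val (g : {ffun I -> 'I_S.+1}) e : int := \sum_i A e i * (g i : nat)%:Z.
have b1 g e : 0 <= val g e + (S * neg e)%N%:Z.
  rewrite /val PoszM /neg (big_morph Posz PoszD (erefl _)) mulr_sumr -big_split /=.
  by apply: sumr_ge0 => i _; have := leq_ord (g i); case: ltP; nia.
have b2 g e : val g e + (S * neg e)%N%:Z <= (S * S)%N%:Z.
  apply: (@le_trans _ _ (S%:Z * (\sum_i `|A e i|%N)%N%:Z)); last by rewrite PoszM ler_wpM2l // lez_nat hS.
  rewrite /val PoszM /neg !(big_morph Posz PoszD (erefl _)) !mulr_sumr -big_split /=.
  by apply: ler_sum => i _; have := leq_ord (g i); case: ltP; nia.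
have lt g e : (`|(val g e + (S * neg e)%N%:Z)%R| < (S * S).+1)%N.
  by have := b1 g e; have := b2 g e; lia.
pose F (g : {ffun I -> 'I_S.+1}) : {ffun E -> 'I_(S * S).+1} := [ffun e => Ordinal (lt g e)].
have : ~~ injectiveb F.
  apply/injectiveP => /leq_card; rewrite !card_ffun !card_ord leqNgt => /negP; apply.
  have [E0|E0] := posnP #|E|; first by rewrite E0 expn0 -{1}(exp1n #|I|) ltn_exp2r.
  apply: (@leq_trans (S.+1 ^ (2 * #|E|))); last by rewrite leq_exp2l.
  by rewrite expnM ltn_exp2r //; nia.
case/injectivePn => g [g' ne eq].
exists (fun i => (g i : nat)%:Z - (g' i : nat)%:Z); split.
- have [i ni] : exists i, g i != g' i.
    by apply/existsP; rewrite -negb_forall; apply: contra ne => /forallP h; apply/eqP/ffunP => i; apply/eqP.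
  by exists i; rewrite subr_eq0; apply: contra ni => /eqP[] /val_inj ->.
- by move=> i; have := leq_ord (g i); have := leq_ord (g' i); lia.
move=> e; have := congr1 (fun f : {ffun E -> 'I_(S * S).+1} => (f e : nat)) eq; rewrite !ffunE /= => h.
have : val g e = val g' e by have := b1 g e; have := b1 g' e; lia.
move=> h'; apply/eqP; rewrite -[X in _ == X](subrr (val g' e)) -{1}h' /val -sumrB.
by apply/eqP; apply: eq_bigr => i _; rewrite mulrBr.
Qed.

(** * Integer coordinates of polynomial values at an algebraic number *)

Section Reduction.
Variable R : realType.

Definition l1 (s : {poly int}) : R := nrm (map_poly intr s : mp R 1).

Lemma l1_coef (s : {poly int}) N : (size s <= N)%N -> l1 s = \sum_(k < N) `|(s`_k)%:~R|.
Proof.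
move=> h; rewrite /l1 (@nrm_wide _ 0 N); last exact: leq_trans (size_poly _ _) h.
by apply: eq_bigr => k _; rewrite coef_map.
Qed.

Lemma power_reduction (al : R) (F : {poly int}) d : size F = d.+1 -> (0 < d)%N ->
  root (map_poly intr F) al ->
  exists B : nat, (0 < B)%N /\ exists a : nat -> 'I_d -> int, forall k,
   [/\ (lead_coef F)%:~R ^+ k * al ^+ k = \sum_i (a k i)%:~R * al ^+ i,
       forall i, (`|a k i| <= B ^ k)%N & (`|lead_coef F| <= B)%N].
Proof.
move=> sF d0 /rootP rt; set c := lead_coef F.
exists (`|c| + \sum_(i < d) `|(F`_i)%R|)%N; set B := (_ + _)%N.
have c0 : (0 < `|c|)%N by rewrite absz_gt0 lead_coef_eq0 -size_poly_gt0 sF.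
have B0 : (0 < B)%N by rewrite addn_gt0 c0.
split => //.
have hF (i : 'I_d) : (`|c| + `|(F`_i)%R| <= B)%N.
  by rewrite leq_add2l (bigD1 i) //= leq_addr.
have top : c%:~R * al ^+ d = - \sum_(i < d) (F`_i)%:~R * al ^+ i.
  move: rt; rewrite horner_coef size_map_poly_id0 ?intr_eq0; last first.
    by rewrite lead_coef_eq0 -size_poly_gt0 sF.
  rewrite sF big_ord_recr /= coef_map /= => /eqP; rewrite addrC addr_eq0 => /eqP h.
  rewrite /c lead_coefE sF h; congr (- _); apply: eq_bigr => i _.
  by rewrite coef_map.
have step k (a : 'I_d -> int) :
   [/\ c%:~R ^+ k * al ^+ k = \sum_i (a i)%:~R * al ^+ i, forall i, (`|a i| <= B ^ k)%N & (`|c| <= B)%N] ->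
   exists a' : 'I_d -> int, [/\ c%:~R ^+ k.+1 * al ^+ k.+1 = \sum_i (a' i)%:~R * al ^+ i,
      forall i, (`|a' i| <= B ^ k.+1)%N & (`|c| <= B)%N].
  move=> [e ha _].
  case: d => [|d] // in sF d0 B B0 hF top a e ha *.
  exists (fun i => c * (if unlift ord0 i is Some j then a (widen_ord (leqnSn d) j) else 0) - a ord_max * F`_i).
  split; last by rewrite leq_addr.
    rewrite !exprS mulrACA e mulr_sumr big_ord_recr /=.
    have -> : c%:~R * al * ((a ord_max)%:~R * al ^+ d) = (a ord_max)%:~R * (c%:~R * al ^+ d.+1).
      by rewrite exprS; ring.
    rewrite top mulrN mulr_sumr.
    under [in RHS]eq_bigr do rewrite rmorphB !rmorphM mulrBl /=.
    rewrite sumrB; congr (_ - _); last by apply: eq_bigr => i _; rewrite mulrA.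
    rewrite [RHS]big_ord_recl /= unlift_none mulr0 mul0r add0r.
    apply: eq_bigr => i _; rewrite liftK /= /bump /= add1n exprS; ring.
  move=> i; rewrite expnS; apply: (@leq_trans ((`|c| + `|(F`_i)%R|) * B ^ k)); last first.
    by rewrite leq_mul2r hF orbT.
  have h1 := ha ord_max; case: (unlift ord0 i) => [j|]; last first.
    by rewrite mulr0 sub0r abszN abszM; nia.
  have h2 := ha (widen_ord (leqnSn d) j); move: h1 h2.
  set x := a _; set y := a _; set f := F`_i; set z := (B ^ k)%N => h1 h2.
  apply: (@leq_trans (`|(c * y)%R| + `|(x * f)%R|)); first by lia.
  by rewrite !abszM mulnDl; apply: leq_add; [rewrite leq_mul2l h2 orbT|rewrite mulnC leq_mul2l h1 orbT].
have ex k : exists a : 'I_d -> int, [/\ c%:~R ^+ k * al ^+ k = \sum_i (a i)%:~R * al ^+ i,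
      forall i, (`|a i| <= B ^ k)%N & (`|c| <= B)%N].
  elim: k => [|k [a ha]]; last exact: step ha.
  exists (fun i : 'I_d => ((i : nat) == 0)%N%:Z); split; last by rewrite leq_addr.
    rewrite !expr0 mulr1; case: (d) d0 => // d' _; rewrite big_ord_recl /= expr0 mulr1 big1 ?addr0 //.
    by move=> i _; rewrite mul0r.
  by move=> i; case: (_ == _).
exists (fun k => projT1 (cid (ex k))) => k.
by case: (cid (ex k)).
Qed.

(** [red s] lists the coordinates of lead_coef F ^ N * s(al) on 1, ..., al^(d-1). One linear
    equation over Q(al) thus follows from d equations over the integers, to which [siegel]
    applies. *)
Lemma poly_reduction (al : R) (F : {poly int}) d : size F = d.+1 -> (0 < d)%N ->
  root (map_poly intr F) al ->
  exists B : nat, (0 < B)%N /\ forall N, exists red : {poly int} -> 'I_d -> int,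
   [/\ forall s : {poly int}, (size s <= N.+1)%N -> forall i, `|(red s i)%:~R| <= l1 s * B%:R ^+ N &
       forall (I : finType) (x : I -> int) (s : I -> {poly int}),
         (forall i, size (s i) <= N.+1)%N ->
         (forall i, \sum_j x j * red (s j) i = 0) ->
         \sum_j (x j)%:~R * (map_poly intr (s j)).[al] = 0 :> R].
Proof.
move=> sF d0 rt; have [B [B0 [a ha]]] := power_reduction sF d0 rt.
exists B; split => // N; set c := lead_coef F.
have c0 : c%:~R != 0 :> R by rewrite intr_eq0 lead_coef_eq0 -size_poly_gt0 sF.
exists (fun s i => \sum_(k < N.+1) s`_k * (c ^+ (N - k) * a k i)); split.
  move=> s hs i; rewrite rmorph_sum /=; apply: le_trans (ler_norm_sum _ _ _) _.
  rewrite (l1_coef hs) mulr_suml; apply: ler_sum => k _.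
  rewrite rmorphM normrM; apply: ler_wpM2l => //.
  have [_ h1 h2] := ha k; have := h1 i => h3.
  have kN : (k <= N)%N := leq_ord k.
  rewrite -intr_norm -natrX -[X in _ <= X]/((B ^ N)%N%:Z%:~R) ler_int -abszE lez_nat.
  have eB : (B ^ N = B ^ (N - k) * B ^ k)%N by rewrite -expnD subnK.
  rewrite abszM abszX eB leq_mul //.
  by case: (N - k)%N => // n; rewrite leq_exp2r.
move=> I x s hs h0.
have hev (t : {poly int}) : (size t <= N.+1)%N ->
   c%:~R ^+ N * (map_poly intr t).[al] =
   \sum_i (\sum_(k < N.+1) t`_k * (c ^+ (N - k) * a k i))%:~R * al ^+ i.
  move=> ht; rewrite (@horner_coef_wide _ N.+1); last first.
    by apply: leq_trans ht; exact: size_poly.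
  rewrite mulr_sumr.
  under [in RHS]eq_bigr do rewrite rmorph_sum mulr_suml /=.
  rewrite exchange_big /=; apply: eq_bigr => k _; rewrite coef_map /=.
  have [h1 _ _] := ha k.
  have -> : c%:~R ^+ N * ((t`_k)%:~R * al ^+ k) = (t`_k)%:~R * c%:~R ^+ (N - k) * (c%:~R ^+ k * al ^+ k) :> R.
    by rewrite -{1}(subnK (leq_ord k)) exprD; ring.
  rewrite h1 mulr_sumr; apply: eq_bigr => i _; rewrite !rmorphM rmorphXn /=; ring.
apply: (@mulfI _ (c%:~R ^+ N)); first by rewrite expf_neq0.
rewrite mulr0 mulr_sumr.
under eq_bigr do rewrite mulrCA hev //.
under eq_bigr do rewrite mulr_sumr.
rewrite exchange_big /= big1 // => i _.
have := congr1 (fun z : int => z%:~R : R) (h0 i); rewrite rmorph_sum /= => e.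
under eq_bigr do rewrite mulrA -rmorphM.
by rewrite -mulr_suml e mul0r.
Qed.

End Reduction.

(** * Most exponents are balanced between the four variables *)

Section Chebyshev.
Variables (R : realType) (D : nat).
Local Notation quad := {ffun 'I_4 -> 'I_D.+1}.

Definition blk r : pred quad := fun j => (\sum_k (j k : nat) == r)%N.

Lemma sum_pred_const (T : finType) (P : pred T) (c : R) : \sum_(i | P i) c = #|P|%:R * c.
Proof. by rewrite -[LHS]/(\sum_(i in P) c) sumr_const mulr_natl. Qed.

Lemma blk_le r (j : quad) k : blk r j -> (j k <= r)%N.
Proof. by move=> /eqP <-; rewrite (bigD1 k) //= leq_addr. Qed.

(** Transposing two of the four positions shows that the four sums are equal; together they give
    #|blk r| * r. *)
Lemma blk_mean r k : ((\sum_(j : quad | blk r j) (j k : nat)) * 4 = #|blk r| * r)%N.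
Proof.
have sym k' : (\sum_(j : quad | blk r j) (j k : nat) = \sum_(j : quad | blk r j) (j k' : nat))%N.
  pose f (j : quad) : quad := [ffun x => j (tperm k k' x)].
  have fK : involutive f by move=> j; apply/ffunP => x; rewrite !ffunE tpermK.
  rewrite (reindex_inj (inv_inj fK)); apply: eq_big => [j|j _]; last by rewrite ffunE tpermL.
  rewrite /blk; congr (_ == _); rewrite [RHS](reindex_inj (@perm_inj _ (tperm k k'))).
  by apply: eq_bigr => x _; rewrite ffunE.
have -> : (#|blk r| * r = \sum_(j : quad | blk r j) \sum_k (j k : nat))%N.
  by rewrite -sum_nat_const; apply: eq_bigr => j /eqP.
rewrite [RHS]exchange_big /= [RHS](eq_bigr (fun _ => \sum_(j : quad | blk r j) (j k : nat))%N) => [|k' _].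
  by rewrite sum_nat_const card_ord mulnC.
by rewrite (sym k').
Qed.

Variables (m : nat) (r : 'I_m -> nat).
Hypothesis r0 : forall h, (0 < r h)%N.
Local Notation JJ := {ffun 'I_m -> quad}.

Definition idxs : pred JJ := family (fun h => blk (r h)).

Lemma idxsP J h : idxs J -> blk (r h) (J h).
Proof. by move=> /familyP/(_ h). Qed.

Definition dev k (J : JJ) : R := \sum_h ((J h k : nat)%:R / (r h)%:R - 4^-1).

(** [idxs] is a product of blocks, so for the uniform distribution the summands of [dev] are
    independent and centred: the mixed terms vanish and each square is at most 1. *)
Lemma dev_variance k : \sum_(J | idxs J) dev k J ^+ 2 <= m%:R * #|idxs|%:R.
Proof.
pose x h (j : quad) : R := (j k : nat)%:R / (r h)%:R - 4^-1.
have x0 h : \sum_(j | blk (r h) j) x h j = 0.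
  rewrite sumrB -mulr_suml -natr_sum sum_pred_const.
  have r0' : (r h)%:R != 0 :> R by rewrite pnatr_eq0 -lt0n.
  have := congr1 (fun n => n%:R : R) (blk_mean (r h) k); rewrite !natrM => e.
  apply: (@mulIf _ ((r h)%:R * 4)); first by rewrite mulf_neq0 // pnatr_eq0.
  by rewrite mul0r mulrBl mulrA divfK // e; field.
have -> : \sum_(J | idxs J) dev k J ^+ 2 =
   \sum_h \sum_h' \sum_(J | idxs J) x h (J h) * x h' (J h').
  rewrite exchange_big /=; under [RHS]eq_bigr do rewrite exchange_big /=.
  rewrite [RHS]exchange_big /=; apply: eq_bigr => J _.
  rewrite expr2 /dev mulr_suml [RHS]exchange_big /=; apply: eq_bigr => h _.
  by rewrite mulr_sumr.
have cross h h' : h != h' -> \sum_(J | idxs J) x h (J h) * x h' (J h') = 0.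
  move=> ne.
  (* Written as a product over all blocks, the mixed term lets the sum over [idxs] factor, with one
     factor 0. *)
  pose G g (j : quad) : R := (if g == h then x h j else 1) * (if g == h' then x h' j else 1).
  have -> : \sum_(J | idxs J) x h (J h) * x h' (J h') = \sum_(J | idxs J) \prod_g G g (J g).
    apply: eq_bigr => J _; rewrite (bigD1 h) //= (bigD1 h') //=; last by rewrite eq_sym.
    rewrite {1 2}/G !eqxx (negPf ne) eq_sym (negPf ne) mulr1 mul1r big1 ?mulr1 //.
    by move=> g /andP[/negPf g1 /negPf g2]; rewrite /G g1 g2 mulr1.
  have -> : \sum_(J | idxs J) \prod_g G g (J g) = \prod_g \sum_(j | blk (r g) j) G g j.
    by rewrite bigA_distr_big_dep.
  rewrite (bigD1 h) //=.
  have -> : \sum_(j | blk (r h) j) G h j = 0.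
    by rewrite -[RHS](x0 h); apply: eq_bigr => j _; rewrite /G eqxx (negPf ne) mulr1.
  by rewrite mul0r.
have -> : m%:R * #|idxs|%:R = \sum_(h < m) (#|idxs|%:R : R).
  by rewrite sumr_const card_ord mulr_natl.
apply: ler_sum => h _.
rewrite (bigD1 h) //= [X in _ + X]big1 ?addr0 => [|h' ne]; last by rewrite cross // eq_sym.
rewrite -[leRHS]mulr1 -sum_pred_const.
apply: ler_sum => J iJ; have bJ := idxsP h iJ.
have r0' : 0 < (r h)%:R :> R by rewrite ltr0n.
have : (J h k : nat)%:R / (r h)%:R <= 1 :> R.
  by rewrite ler_pdivrMr // mul1r ler_nat; exact: blk_le bJ.
have : 0 <= (J h k : nat)%:R / (r h)%:R :> R by rewrite divr_ge0.
by rewrite /x -expr2; nra.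
Qed.

Definition bad (e : R) : pred JJ := fun J => idxs J && [exists k, e * m%:R < `|dev k J|].

Lemma bad_card (e : R) : 0 < e -> (0 < m)%N -> #|bad e|%:R * (e ^+ 2 * m%:R) <= 4 * #|idxs|%:R :> R.
Proof.
move=> e0 m0.
have m0' : 0 < m%:R :> R by rewrite ltr0n.
suff h : #|bad e|%:R * (e * m%:R) ^+ 2 <= 4 * (m%:R * #|idxs|%:R) :> R.
  rewrite -(ler_pM2r m0').
  by move: h; rewrite expr2 expr2; set a := #|_|%:R; set b := #|_|%:R; lra.
apply: (@le_trans _ _ (\sum_(J | idxs J) \sum_k dev k J ^+ 2)); last first.
  rewrite exchange_big /=; apply: (@le_trans _ _ (\sum_(k < 4) m%:R * #|idxs|%:R)).
    by apply: ler_sum => k _; exact: dev_variance.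
  by set X := m%:R * _; rewrite sumr_const card_ord mulr_natl.
rewrite -sum_pred_const [leRHS](bigID (bad e)) /=.
rewrite -[leLHS]addr0; apply: lerD; last first.
  by apply: sumr_ge0 => J _; apply: sumr_ge0 => k _; exact: sqr_ge0.
rewrite [leRHS](eq_bigl (bad e)) => [|J]; last by rewrite /bad andbA andbb.
apply: ler_sum => J /andP[_ /existsP[k hk]]; rewrite (bigD1 k) //=.
rewrite -[leLHS]addr0; apply: lerD; last by apply: sumr_ge0 => k' _; exact: sqr_ge0.
rewrite -[leRHS]real_normK ?num_real //; apply: lerXn2r.
- by rewrite nnegrE mulr_ge0 // ltW.
- by rewrite nnegrE.
- exact: ltW.
Qed.

End Chebyshev.

(** * Expansion of monomials in the four forms, and the auxiliary polynomial *)

Section AuxPoly.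
Variables (R : realType) (m : nat) (r : 'I_m -> nat).
Let D := (\sum_h r h)%N.
Local Notation quad := {ffun 'I_4 -> 'I_D.+1}.
Local Notation JJ := {ffun 'I_m -> quad}.
Local Notation Pos := {h : 'I_m & 'I_(r h)}.

Definition mono (S : comPzRingType) (J : JJ) (v : 'I_m -> 'I_4 -> S) : S :=
  \prod_h \prod_k v h k ^+ J h k.

(** A word puts one of four letters at each of D positions, r h of them in block h; its type counts
    the letters. Sums over words need no multinomial coefficients. [inord] does no harm, as the
    counts are at most D. *)
Definition wtype (f : {ffun Pos -> 'I_4}) : JJ :=
  [ffun h => [ffun k => inord #|[pred p : Pos | (tag p == h) && (f p == k)]|]].

Lemma card_Pos : #|{: Pos}| = D.
Proof. by rewrite card_tagged sumnE big_map big_enum; apply: eq_bigr => h _; rewrite card_ord. Qed.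

Lemma card_fiber h : #|[pred p : Pos | tag p == h]| = r h.
Proof.
have -> : #|[pred p : Pos | tag p == h]| = #|[set (Tagged (fun h => 'I_(r h)) i : Pos) | i in 'I_(r h)]|.
  apply: eq_card => p; rewrite !inE; apply/eqP/imsetP => [|[i _ ->] //].
  by case: p => h' i /= e; subst h'; exists i.
rewrite card_imset ?card_ord // => i j /eqP; rewrite eq_Tagged => /eqP //.
Qed.

Lemma wtypeE f h k : (wtype f h k : nat) = #|[pred p : Pos | (tag p == h) && (f p == k)]|.
Proof. by rewrite !ffunE inordK // ltnS -card_Pos max_card. Qed.

Lemma wtype_idxs f : idxs r (wtype f).
Proof.
apply/familyP => h; rewrite -topredE /= /blk; apply/eqP; rewrite -[RHS]card_fiber.
rewrite -sum1_card (partition_big f xpredT) //=; apply: eq_bigr => k _.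
by rewrite wtypeE -sum1_card.
Qed.

Lemma prod_word (S : comPzRingType) (f : {ffun Pos -> 'I_4}) (v : 'I_m -> 'I_4 -> S) :
  \prod_(p : Pos) v (tag p) (f p) = mono (wtype f) v.
Proof.
rewrite (partition_big (fun p : Pos => tag p) xpredT) //=; apply: eq_bigr => h _.
rewrite (partition_big f xpredT) //=; apply: eq_bigr => k _.
rewrite wtypeE -prodr_const; apply: eq_big => p; first by rewrite inE.
by move=> /andP[/eqP -> /eqP ->].
Qed.

Lemma word_exists (J : JJ) : idxs r J -> exists f, wtype f = J.
Proof.
move=> iJ.
pose s h := flatten [seq nseq (J h k) k | k <- enum 'I_4].
have ss h : size (s h) = r h.
  have := idxsP h iJ => /eqP <-; rewrite size_flatten /shape -map_comp sumnE big_map big_enum /=.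
  by apply: eq_bigr => k _; rewrite size_nseq.
exists [ffun p : Pos => nth ord0 (s (tag p)) (tagged p)].
apply/ffunP => h; apply/ffunP => k; apply: val_inj; rewrite [LHS]wtypeE.
have -> : #|[pred p : Pos | (tag p == h) && ([ffun p : Pos => nth ord0 (s (tag p)) (tagged p)] p == k)]| =
   #|[pred i : 'I_(r h) | nth ord0 (s h) i == k]|.
  have inj : injective (fun i : 'I_(r h) => (Tagged (fun h => 'I_(r h)) i : Pos)).
    by move=> i j /eqP; rewrite eq_Tagged => /eqP.
  rewrite -(card_image inj); apply: eq_card => p; rewrite !inE ffunE.
  apply/andP/imageP => [[/eqP]|[i hi ->]]; last by rewrite !inE in hi *.
  by case: p => h' i /= e; subst h' => e2; exists i; rewrite ?inE.
rewrite -sum1_card (eq_bigl (fun i : 'I_(r h) => nth ord0 (s h) i == k)) //.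
rewrite -(big_mkord (fun i => nth ord0 (s h) i == k) (fun=> 1%N)) -ss -(big_nth ord0 (fun x => x == k) (fun=> 1%N)).
rewrite sum1_count count_flatten -map_comp sumnE big_map big_enum /= (bigD1 k) //=.
rewrite count_nseq /= eqxx mul1n big1 ?addn0 // => k' /negPf ne.
by rewrite count_nseq /= ne.
Qed.

Lemma card_idxs : (#|idxs (D := D) r| <= 4 ^ D)%N.
Proof.
have <- : #|{: {ffun Pos -> 'I_4}}| = (4 ^ D)%N by rewrite card_ffun card_ord card_Pos.
apply: leq_trans (leq_image_card wtype predT); apply: subset_leq_card.
apply/fintype.subsetP => J /word_exists[f <-]; exact: image_f.
Qed.

Variable lam : 'I_4 -> 'I_4 -> {poly int}.
Hypothesis lam_size : forall k l, (size (lam k l) <= 3)%N.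
Hypothesis lam_l1 : forall k l, l1 R (lam k l) <= 1.

(** The coefficient of the monomial J in the forms when the product with one linear form per letter
    of w is multiplied out, as a polynomial in al. *)
Definition scoef (J : JJ) (w : {ffun Pos -> 'I_4}) : {poly int} :=
  \sum_(f | wtype f == J) \prod_p lam (w p) (f p).

Lemma size_scoef J w : (size (scoef J w) <= (2 * D).+1)%N.
Proof.
apply: leq_trans (size_sum _ _ _) _; apply/bigmax_leqP => f _.
rewrite -card_Pos cardT enumT; have -> : \prod_p lam (w p) (f p) = \prod_(p <- Finite.enum {: Pos}) lam (w p) (f p).
  by rewrite -enumT big_enum.
elim: (Finite.enum _) => [|p s IH]; first by rewrite big_nil size_poly1.
rewrite big_cons /= (leq_trans (size_polyMleq _ _)) //.
apply: (@leq_trans (3 + (2 * size s).+1).-1).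
  by rewrite -!subn1 leq_sub2r // leq_add.
by rewrite mulnS -[X in (X <= _)%N]/(2 + (2 * size s).+1)%N addnS.
Qed.

Lemma scoef_out J w : ~~ idxs r J -> scoef J w = 0.
Proof.
move=> nJ; apply: big1 => f /eqP fJ.
by move: nJ; rewrite -fJ wtype_idxs.
Qed.

Lemma l1_scoef J w : l1 R (scoef J w) <= 4 ^+ D.
Proof.
rewrite /l1 /scoef rmorph_sum; apply: le_trans (@nrm_sum R 1 _ _ _ _) _.
apply: (@le_trans _ _ (\sum_(f : {ffun Pos -> 'I_4}) 1)); last first.
  by rewrite sumr_const card_ffun card_ord card_Pos natrX.
rewrite big_mkcond; apply: ler_sum => f _; case: ifP => // _.
rewrite rmorph_prod; apply: le_trans (@nrm_prod R 1 _ _ _ _) _.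
apply: (@le_trans _ _ (\prod_(p : Pos) 1)); last by rewrite big1_eq.
apply: ler_prod => p _.
by rewrite nrm_ge0 lam_l1.
Qed.

Lemma horner_l1 (s : {poly int}) (x : R) N : (size s <= N.+1)%N ->
  `|(map_poly intr s).[x]| <= l1 R s * (1 + `|x|) ^+ N.
Proof.
move=> hs; rewrite (@horner_coef_wide _ N.+1); last exact: leq_trans (size_poly _ _) hs.
apply: le_trans (ler_norm_sum _ _ _) _; rewrite (l1_coef _ hs) mulr_suml.
apply: ler_sum => k _; rewrite coef_map normrM; apply: ler_wpM2l => //.
rewrite normrX; apply: (@le_trans _ _ ((1 + `|x|) ^+ k)).
  by apply: lerXn2r; rewrite ?nnegrE ?addr_ge0 // lerDr.
by apply: ler_weXn2l; rewrite ?lerDl // leq_ord.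
Qed.

Lemma mono_expand (al : R) n (w : {ffun Pos -> 'I_4}) (Y : 'I_m -> 'I_4 -> mp R n) :
  mono (wtype w) (fun h k => \sum_l cst n (map_poly intr (lam k l)).[al] * Y h l) =
  \sum_J cst n (map_poly intr (scoef J w)).[al] * mono J Y.
Proof.
rewrite -prod_word bigA_distr_bigA /= (partition_big (fun f => wtype f) xpredT) //=.
apply: eq_bigr => J _; rewrite /scoef rmorph_sum horner_sum rmorph_sum mulr_suml /=.
apply: eq_bigr => f /eqP <-; rewrite big_split /= prod_word; congr (_ * _).
by rewrite rmorph_prod horner_prod rmorph_prod.
Qed.

End AuxPoly.

Lemma sum_swap (S : pzRingType) (I J : finType) (a : I -> S) (b : I -> J -> S) (M : J -> S) :
  \sum_i a i * (\sum_j b i j * M j) = \sum_j (\sum_i a i * b i j) * M j.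
Proof.
rewrite (eq_bigr (fun i => \sum_j a i * b i j * M j)) => [|i _]; last first.
  by rewrite mulr_sumr; apply: eq_bigr => j _; rewrite mulrA.
by rewrite exchange_big; apply: eq_bigr => j _; rewrite mulr_suml.
Qed.

(** The unknowns are the coefficients at the exponents in [idxs], and each [bad] exponent imposes d
    integer equations. By [bad_card] and the hypothesis on m there are at least twice as many
    unknowns as equations. *)
Lemma aux_poly (R : realType) (al : R) (F : {poly int}) d : size F = d.+1 -> (0 < d)%N ->
  root (map_poly intr F) al ->
  exists C : R, 1 <= C /\ forall (lam : 'I_4 -> 'I_4 -> {poly int}),
   (forall k l, (size (lam k l) <= 3)%N) -> (forall k l, l1 R (lam k l) <= 1) ->
   forall (e : R) m (r : 'I_m -> nat), 0 < e -> (0 < m)%N -> (8 * d)%:R <= e ^+ 2 * m%:R ->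
   (forall h, (0 < r h)%N) ->
   let D := (\sum_h r h)%N in
   exists (p : {ffun 'I_m -> {ffun 'I_4 -> 'I_D.+1}} -> int)
          (cf : {ffun 'I_m -> {ffun 'I_4 -> 'I_D.+1}} -> R),
   [/\ (exists J, p J != 0) /\ (forall J, p J != 0 -> idxs r J),
       forall J, `|(p J)%:~R| <= C ^+ D, forall J, `|cf J| <= C ^+ D,
       forall J, cf J != 0 -> idxs r J /\ forall k, `|dev R r k J| <= e * m%:R &
       forall n (Y : 'I_m -> 'I_4 -> mp R n),
       \sum_J cst n (p J)%:~R *
         mono J (fun h k => \sum_l cst n (map_poly intr (lam k l)).[al] * Y h l) =
       \sum_J cst n (cf J) * mono J Y].
Proof.
move=> sF d0 rt; have [B [B0 redP]] := poly_reduction sF d0 rt.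
(* The bound of [siegel] is (16 B^2)^D. For [cf], a further 4^D counts the unknowns and 4^D (1 +
   |al|)^(2 D) bounds the values of [scoef] at al. *)
pose C : R := (256 * B ^ 2)%N%:R * (1 + `|al|) ^+ 2.
have al1 : 1 <= 1 + `|al| by rewrite lerDl.
have B1 : 1 <= B%:R :> R by rewrite ler1n.
exists C; split.
  by rewrite /C -[leLHS]mulr1 ler_pM // ?exprn_ege1 // ler1n muln_gt0 expn_gt0 B0.
move=> lam ls ll e m r e0 m0 hm r0 D.
have [red [red1 red2]] := redP (2 * D)%N.
pose JJ := {ffun 'I_m -> {ffun 'I_4 -> 'I_D.+1}}.
pose I : finType := {J : JJ | idxs r J}.
pose E : finType := ({J : JJ | bad r e J} * 'I_d)%type.
pose w (J : I) := projT1 (cid (word_exists (valP J))).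
have wE (J : I) : wtype (w J) = val J by rewrite /w; case: (cid _).
pose A (x : E) (J : I) := red (scoef lam (val x.1) (w J)) x.2.
pose S := ((16 * B ^ 2) ^ D)%N.
have S0 : (0 < S)%N by rewrite expn_gt0 muln_gt0 expn_gt0 B0.
have cI : #|I| = #|idxs (D := D) r| by rewrite card_sig.
have I0 : (0 < #|I|)%N.
  rewrite cI; apply/card_gt0P; exists (wtype [ffun=> ord0]); exact: wtype_idxs.
have sumc (c : R) : \sum_(J : I) c = #|I|%:R * c by rewrite sumr_const mulr_natl.
have [||x [x0 xS xE]] := @siegel I E A S S0 I0.
- have := bad_card D r0 e0 m0; rewrite card_prod card_ord cI card_sig.
  set b := #|bad r e|; set i := #|_| => h.
  have : b%:R * (8 * d)%:R <= 4 * i%:R :> R.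
    by apply: le_trans h; apply: ler_wpM2l.
  rewrite -[4]/(4%:R) -!natrM ler_nat; set bd := (b * d)%N; nia.
- move=> [J' i]; rewrite -(@ler_nat R) natr_sum.
  apply: (@le_trans _ _ (\sum_(J : I) 4 ^+ D * B%:R ^+ (2 * D))).
    apply: ler_sum => J _; rewrite /A -[_%:R]/(`|_|%N%:Z%:~R) abszE intr_norm.
    have hr := red1 (scoef lam (val J') (w J)) (size_scoef ls _ _) i.
    apply: le_trans hr _.
    by apply: ler_wpM2r; rewrite ?exprn_ge0 //; exact: l1_scoef.
  rewrite sumc.
  apply: (@le_trans _ _ ((4 ^ D)%:R * (4 ^+ D * B%:R ^+ (2 * D)))).
    by apply: ler_wpM2r; rewrite ?mulr_ge0 ?exprn_ge0 // ler_nat cI card_idxs.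
  by rewrite -!natrX -!natrM ler_nat /S mulnA -expnMn expnM -expnMn.
pose p (J : JJ) : int := if insub J is Some J0 then x (J0 : I) else 0.
pose cf (J' : JJ) : R := \sum_(J : I) (x J)%:~R * (map_poly intr (scoef lam J' (w J))).[al].
have C0 : 0 <= C by rewrite /C mulr_ge0 ?exprn_ge0 ?addr_ge0.
have SC : S%:R <= C ^+ D.
  rewrite /S natrX; apply: lerXn2r; rewrite ?nnegrE //.
  rewrite /C -[leLHS]mulr1 ler_pM // ?exprn_ege1 //.
  by rewrite ler_nat leq_mul2r orbT.
exists p, cf; split.
- split.
    case: x0 => J xJ; exists (val J); rewrite /p insubT ?(valP J) // => h.
    by have -> : Sub (val J) h = J by apply: val_inj; rewrite SubK.
  by move=> J; rewrite /p; case: insubP => //; rewrite eqxx.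
- move=> J; apply: le_trans SC; rewrite -intr_norm -abszE -[leRHS]/(S%:Z%:~R) ler_int lez_nat.
  by rewrite /p; case: insubP => //= J0 _ _.
- move=> J; apply: le_trans (ler_norm_sum _ _ _) _.
  apply: (@le_trans _ _ (\sum_(J0 : I) S%:R * (4 ^+ D * (1 + `|al|) ^+ (2 * D)))).
    apply: ler_sum => J0 _; rewrite normrM; apply: ler_pM => //.
      by rewrite -intr_norm -abszE -[leRHS]/(S%:Z%:~R) ler_int lez_nat.
    apply: le_trans (horner_l1 _ (size_scoef ls _ _)) _.
    by apply: ler_wpM2r; rewrite ?exprn_ge0 ?addr_ge0 //; exact: l1_scoef.
  rewrite sumc.
  apply: (@le_trans _ _ ((4 ^ D)%:R * (S%:R * (4 ^+ D * (1 + `|al|) ^+ (2 * D))))).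
    apply: ler_wpM2r; last by rewrite ler_nat cI card_idxs.
    by rewrite !mulr_ge0 ?exprn_ge0 ?addr_ge0.
  rewrite /S !natrX exprM -!exprMn /C; apply: lerXn2r; rewrite ?nnegrE ?mulr_ge0 ?exprn_ge0 ?addr_ge0 //.
  have -> : (256 * B ^ 2)%:R = 16 * (16 * B ^ 2)%:R :> R by rewrite -natrM mulnA.
  move: ((16 * B ^ 2)%:R) => X; move: ((1 + `|al|) ^+ 2) => Z.
  by have -> : 4 * (X * (4 * Z)) = 16 * X * Z by ring.
- move=> J cJ; have iJ : idxs r J.
    apply/negPn/negP => nJ; move: cJ => /negP; apply; apply/eqP.
    by apply: big1 => J0 _; rewrite scoef_out // rmorph0 horner0 mulr0.
  split => // k; rewrite leNgt; apply/negP => hk.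
  have bJ : bad r e J by rewrite /bad iJ; apply/existsP; exists k.
  move: cJ => /negP; apply; apply/eqP; apply: red2 => [J0|i]; first exact: size_scoef.
  rewrite -[RHS](xE (Sub J bJ, i)); apply: eq_bigr => J0 _.
  by rewrite mulrC.
move=> n Y.
rewrite (bigID (fun J => idxs r J)) /= [X in _ + X]big1 ?addr0; last first.
  by move=> J /negPf nJ; rewrite /p insubF // rmorph0 mul0r.
have -> : \sum_(J : JJ | idxs r J) cst n (p J)%:~R *
         mono J (fun h k => \sum_l cst n (map_poly intr (lam k l)).[al] * Y h l) =
  \sum_(J0 : I) cst n (x J0)%:~R * \sum_J cst n (map_poly intr (scoef lam J (w J0))).[al] * mono J Y.
  rewrite [LHS](reindex_omap (fun J0 : I => val J0) insub) => [|J iJ] /=; last by rewrite insubT.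
  apply: eq_big => [J0|J0 _]; first by rewrite valK eqxx (valP J0).
  by rewrite -mono_expand // wE /p valK.
rewrite (@sum_swap _ I JJ (fun J0 => cst n (x J0)%:~R)
  (fun J0 J => cst n (map_poly intr (scoef lam J (w J0))).[al]) (fun J => mono J Y)).
apply: eq_bigr => J _; congr (_ * _); rewrite /cf rmorph_sum.
by apply: eq_bigr => J0 _; rewrite rmorphM.
Qed.

(** * Hyperplanes spanned by small integer points *)

Section Taylor.
Variable R : realType.

Lemma ev_horner n v (P : {poly mp R n}) c :
  ev n v P.[cst n c] = (map_poly (ev n v) P).[c].
Proof. by rewrite -{2}(ev_cst n v c) horner_map. Qed.

Lemma hasse_horner n d (P : {poly mp R n}) c :
  hasse n d P.[cst n c] = (map_poly (hasse n d) P).[cst n c].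
Proof.
have h0 (S : {poly mp R n}) : S.[cst n c] = (S \Po ('X + (cst n c)%:P))`_0.
  by rewrite -horner_coef0 horner_comp hornerD hornerX hornerC add0r.
by rewrite !h0 map_hasse_shift coef_map.
Qed.

(** The Taylor coefficient at xi that violates the bound is the value of a divided derivative, found
    one variable at a time. *)
Lemma not_idx n w xi (t : R) (P : mp R n) : ~ idx w xi t P ->
  exists d : nat -> nat, \sum_(h < n) (d h)%:R * w h < t /\ ev n xi (hasse n d P) != 0.
Proof.
elim: n P t => [|n IH] P t h.
  exists (fun=> 0%N); rewrite big_ord0 /=; split.
    by rewrite ltNge; apply/negP => t0; apply: h.
  by apply/eqP => P0; apply: h => /=; rewrite P0 eqxx.
have [i hi] : exists i, ~ idx w xi (t - i%:R * w n) ((P : {poly mp R n}) \Po ('X + (cst n (xi n))%:P))`_i.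
  by apply: contrapT => /forallNP h'; apply: h => i; apply: contrapT; apply: h'.
have [d [ds de]] := IH _ _ hi.
exists (fun h => if h == n then i else d h); split.
  rewrite big_ord_recr /= eqxx -ltrBrDr; apply: le_lt_trans ds.
  by apply: ler_sum => k _; rewrite (ltn_eqF (ltn_ord k)).
move: de; rewrite /= eqxx /horner_eval -ev_horner -hasse_horner; congr (_ != _).
have -> : hasse n (fun h => if h == n then i else d h) (P : {poly mp R n})^`N(i).[cst n (xi n)] =
   hasse n d (P : {poly mp R n})^`N(i).[cst n (xi n)].
  by apply: hasse_ext => k lt; rewrite (ltn_eqF lt).
congr (ev n xi (hasse n d _)).
have -> : (P : {poly mp R n})^`N(i).[cst n (xi n)] = ((P : {poly mp R n})^`N(i) \Po ('X + (cst n (xi n))%:P))`_0.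
  by rewrite -horner_coef0 horner_comp hornerD hornerX hornerC add0r.
by rewrite nderivn_shift coef_nderivn addn0 binn mulr1n.
Qed.

Fixpoint mon n (a : nat -> nat) : mp R n :=
  match n return mp R n with
  | 0 => 1
  | n'.+1 => (mon n' a)%:P * 'X^(a n')
  end.

Fixpoint coefn n (a : nat -> nat) : {additive mp R n -> R} :=
  match n return {additive mp R n -> R} with
  | 0 => idfun
  | n'.+1 => coefn n' a \o coefp (a n')
  end.

Lemma coefn_cstM n a c (P : mp R n) : coefn n a (cst n c * P) = c * coefn n a P.
Proof. by elim: n P => [|n IH] P //=; rewrite coefCM IH. Qed.

Lemma coefn_mon n a b : coefn n a (mon n b) = [forall h : 'I_n, a h == b h]%:R.
Proof.
elim: n => [|n IH] /=; first by case: forallP => // -[] [].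
rewrite coefCM coefXn; case: (eqVneq (a n) (b n)) => e.
  rewrite mulr1 IH; congr ((nat_of_bool _)%:R); apply/forallP/forallP => H h.
    by case: (unliftP ord_max h) => [j ->|->]; rewrite ?lift_max ?H //= e.
  by have := H (widen_ord (leqnSn n) h).
rewrite mulr0 raddf0; case: forallP => // /(_ ord_max) /=.
by rewrite (negPf e).
Qed.

Lemma nrm_mon n a : nrm (mon n a) <= 1.
Proof.
elim: n => [|n IH]; first by rewrite /= normr1.
apply: le_trans (nrmM _ _) _; rewrite nrmC -[leRHS]mulr1; apply: ler_pM; rewrite ?nrm_ge0 //.
apply: le_trans (nrmX _ _) _.
have -> : nrm ('X : mp R n.+1) = 1.
  by have := nrmMXaddC 1 (0 : mp R n); rewrite mul1r addr0 nrm0 addr0 nrm1.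
by rewrite expr1n.
Qed.

Lemma intp_mon n a : intp (mon n a).
Proof.
elim: n => [|n IH]; first by rewrite /=; exact: rpred1.
move=> i /=; rewrite coefCM coefXn; apply: intpM => //.
by rewrite -(rmorph_nat (cst n)); apply: intp_cst; exact: rpred_nat.
Qed.

Lemma degle_mon n a r : (forall h, (h < n)%N -> (a h <= r h)%N) -> degle r (mon n a).
Proof.
elim: n => [|n IH] h //=; split.
  apply: leq_trans (size_polyMleq _ _) _; rewrite size_polyXn addnS /=.
  have : (size (mon n a)%:P <= 1)%N by exact: size_polyC_leq1.
  by have := h n (ltnSn n); set x := size _; lia.
move=> i; rewrite coefCM coefXn mulr_natr; apply: degleMn; apply: IH => k lt.
by apply: h; rewrite ltnS ltnW.
Qed.

Lemma ev_hasse_mon n v d a : ev n v (hasse n d (mon n a)) =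
  \prod_(h < n) (v h ^+ (a h - d h) *+ 'C(a h, d h)).
Proof.
elim: n => [|n IH] /=; first by rewrite big_ord0.
rewrite big_ord_recr /= mul_polyC nderivnZ nderivnXn /horner_eval.
have -> : map_poly (ev n v) (map_poly (hasse n d) (mon n a *: ('X^(a n - d n) *+ 'C(a n, d n)))) =
   (ev n v (hasse n d (mon n a)))%:P * ('X^(a n - d n) *+ 'C(a n, d n)).
  apply/polyP => i; rewrite !coef_map coefZ coefMn coefXn coefCM coefMn coefXn.
  by rewrite -!mulrnA !mulr_natr !raddfMn.
by rewrite hornerM hornerC hornerMn hornerXn IH.
Qed.

(** [emb], [svar] and [ctop] adjoin j outer variables and read off the coefficient of one monomial
    in them. A divided derivative thereby becomes a Taylor coefficient along new parameters, which
    is compatible with linear substitutions. *)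
Fixpoint emb j k : {rmorphism mp R k -> mp R (j + k)} :=
  match j return {rmorphism mp R k -> mp R (j + k)} with
  | 0 => idfun
  | j'.+1 => polyC \o emb j' k
  end.

Fixpoint ctop j k (d : nat -> nat) : {additive mp R (j + k) -> mp R k} :=
  match j return {additive mp R (j + k) -> mp R k} with
  | 0 => idfun
  | j'.+1 => ctop j' k d \o coefp (d j')
  end.

(* [svar j k h] is the variable number [k + h], i.e. one of the [j] outermost ones. *)
Fixpoint svar j k (h : nat) : mp R (j + k) :=
  match j return mp R (j + k) with
  | 0 => 0
  | j'.+1 => if h == j' then 'X else (svar j' k h)%:P
  end.

Lemma emb_cst j k c : emb j k (cst k c) = cst (j + k) c.
Proof. by elim: j => //= j ->. Qed.

Lemma ctop_embM j k d a P : ctop j k d (emb j k a * P) = a * ctop j k d P.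
Proof. by elim: j P => [|j IH] P //=; rewrite coefCM IH. Qed.

Lemma coef_shiftX (A : comNzRingType) (c : A) n d :
  ((c%:P + 'X) ^+ n)`_d = c ^+ (n - d) *+ 'C(n, d).
Proof.
rewrite exprDn coef_sum.
have term (i : 'I_n.+1) : (c%:P ^+ (n - i) * 'X^i *+ 'C(n, i))`_d =
   (c ^+ (n - i) *+ 'C(n, i)) *+ (d == i).
  by rewrite coefMn -polyC_exp coefCM coefXn mulr_natr -!mulrnA mulnC.
under eq_bigr do rewrite term.
case: (ltnP d n.+1) => dn; last first.
  rewrite bin_small // mulr0n big1 // => i _.
  by rewrite gtn_eqF ?mulr0n // (leq_trans (ltn_ord i)).
rewrite (bigD1 (Ordinal dn)) //= eqxx mulr1n big1 ?addr0 // => i /negPf ne.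
by have -> : (d == i) = false by rewrite eq_sym.
Qed.

Lemma ctop_prod j k d (a : nat -> mp R k) (n : nat -> nat) :
  ctop j k d (\prod_(h < j) (emb j k (a h) + svar j k h) ^+ n h) =
  \prod_(h < j) (a h ^+ (n h - d h) *+ 'C(n h, d h)).
Proof.
elim: j => [|j IH]; first by rewrite !big_ord0.
rewrite !big_ord_recr /= eqxx.
have -> : \prod_(i < j) ((emb j k (a i))%:P + (if (i : nat) == j then 'X else (svar j k i)%:P)) ^+ n i =
   (\prod_(i < j) (emb j k (a i) + svar j k i) ^+ n i)%:P.
  rewrite rmorph_prod; apply: eq_bigr => i _.
  by rewrite (ltn_eqF (ltn_ord i)) rmorphXn rmorphD.
rewrite coefCM coef_shiftX mulrC.
have -> : emb j k (a j) ^+ (n j - d j) *+ 'C(n j, d j) = emb j k (a j ^+ (n j - d j) *+ 'C(n j, d j)).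
  by rewrite rmorphMn rmorphXn.
by rewrite ctop_embM IH mulrC.
Qed.

End Taylor.

Arguments mon {R} n a.
Arguments coefn {R} n a.
Arguments emb {R} j k.
Arguments ctop {R} j k d.
Arguments svar {R} j k h.

Definition extn (T : Type) (x0 : T) m (f : 'I_m -> T) (h : nat) : T :=
  if insub h is Some i then f i else x0.

Lemma extnE (T : Type) (x0 : T) m (f : 'I_m -> T) (h : 'I_m) : extn x0 f h = f h.
Proof. by rewrite /extn valK. Qed.

Definition k0 : 'I_4 := @Ordinal 4 0 isT.
Definition k1 : 'I_4 := @Ordinal 4 1 isT.
Definition k2 : 'I_4 := @Ordinal 4 2 isT.
Definition k3 : 'I_4 := @Ordinal 4 3 isT.

Lemma big4 (T : Type) (idx : T) (op : Monoid.law idx) (F : 'I_4 -> T) :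
  \big[op/idx]_k F k = op (F k0) (op (F k1) (op (F k2) (F k3))).
Proof.
rewrite !big_ord_recl big_ord0 Monoid.mulm1.
by congr (op (F _) (op (F _) (op (F _) (F _)))); apply: val_inj.
Qed.

Lemma ord4P (P : 'I_4 -> Prop) : P k0 -> P k1 -> P k2 -> P k3 -> forall k, P k.
Proof.
move=> h0 h1 h2 h3 [[|[|[|[|k]]]] lt] //.
- by have -> : Ordinal lt = k0 by apply: val_inj.
- by have -> : Ordinal lt = k1 by apply: val_inj.
- by have -> : Ordinal lt = k2 by apply: val_inj.
- by have -> : Ordinal lt = k3 by apply: val_inj.
Qed.

(** * Derivatives of the auxiliary polynomial in one variable of each block *)

Section Derived.
Variables (R : realType) (m D : nat).
Local Notation JJ := {ffun 'I_m -> {ffun 'I_4 -> 'I_D.+1}}.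

(** The divided derivative of order d h in the variable [kp] of each block h of the monomial J, at
    the point v. The binomial coefficient makes it 0 when d h exceeds the exponent. *)
Definition dmono (S : comPzRingType) (kp : 'I_4) (d : nat -> nat) (J : JJ) (v : 'I_m -> 'I_4 -> S) : S :=
  \prod_h ((\prod_(k | k != kp) v h k ^+ J h k) * (v h kp ^+ (J h kp - d h) *+ 'C(J h kp, d h))).

Definition gmono (S : comPzRingType) (J : JJ) (v : 'I_m -> 'I_4 -> S) : S :=
  \prod_h \prod_k v h k ^+ J h k.

Lemma dmono_morph (S S' : comPzRingType) (f : {rmorphism S -> S'}) kp d J v :
  f (dmono kp d J v) = dmono kp d J (fun h k => f (v h k)).
Proof.
rewrite /dmono rmorph_prod; apply: eq_bigr => h _; rewrite rmorphM rmorph_prod rmorphMn rmorphXn.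
by congr (_ * _); apply: eq_bigr => k _; rewrite rmorphXn.
Qed.

Lemma dmono_ext (S : comPzRingType) kp d J (v v' : 'I_m -> 'I_4 -> S) :
  (forall h k, v h k = v' h k) -> dmono kp d J v = dmono kp d J v'.
Proof.
move=> e; apply: eq_bigr => h _; rewrite e; congr (_ * _).
by apply: eq_bigr => k _; rewrite e.
Qed.

Lemma ctop_gmono k kp d J (v : 'I_m -> 'I_4 -> mp R k) :
  ctop m k d (gmono J (fun h i => emb m k (v h i) + svar m k h *+ (i == kp))) =
  dmono kp d J v.
Proof.
have -> : gmono J (fun h i => emb m k (v h i) + svar m k h *+ (i == kp)) =
  emb m k (\prod_h \prod_(i | i != kp) v h i ^+ J h i) *
  \prod_(h < m) (emb m k (extn 0 (fun h => v h kp) h) + svar m k h) ^+ (extn 0%N (fun h => J h kp : nat) h).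
  rewrite rmorph_prod -big_split /=; apply: eq_bigr => h _.
  rewrite (bigD1 kp) //= eqxx mulr1n mulrC !extnE rmorph_prod; congr (_ * _).
  by apply: eq_bigr => i /negPf ->; rewrite mulr0n addr0 rmorphXn.
rewrite ctop_embM ctop_prod /dmono big_split /=; congr (_ * _).
by apply: eq_bigr => h _; rewrite !extnE.
Qed.

(** The column [k3] of L is the unit vector at [k1], so adding a parameter to the last form moves
    the coordinate y_1 and no other: the derivatives in these two variables agree. *)
Lemma derived_identity (p : JJ -> int) (cf : JJ -> R) (L : 'I_4 -> 'I_4 -> R) :
  (forall n (Y : 'I_m -> 'I_4 -> mp R n),
    \sum_J cst n (p J)%:~R * gmono J (fun h k => \sum_l cst n (L k l) * Y h l) =
    \sum_J cst n (cf J) * gmono J Y) ->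
  (forall k, L k k3 = (k == k1)%:R) ->
  forall d k (Y : 'I_m -> 'I_4 -> mp R k),
    \sum_J cst k (p J)%:~R * dmono k1 d J (fun h i => \sum_l cst k (L i l) * Y h l) =
    \sum_J cst k (cf J) * dmono k3 d J Y.
Proof.
move=> Hid L3 d k Y.
pose Y' h l := emb m k (Y h l) + svar m k h *+ (l == k3).
have := congr1 (ctop m k d) (Hid _ Y'); rewrite !raddf_sum /= => e.
transitivity (\sum_i ctop m k d (cst (m + k) (cf i) * gmono i Y')); last first.
  by apply: eq_bigr => J _; rewrite -emb_cst ctop_embM /Y' ctop_gmono.
rewrite -e; apply: eq_bigr => J _; rewrite -emb_cst ctop_embM; congr (_ * _).
rewrite -ctop_gmono; congr (ctop m k d _); apply: eq_bigr => h _; apply: eq_bigr => i _.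
congr (_ ^+ _); rewrite /Y'.
under [RHS]eq_bigr do rewrite mulrDr.
rewrite big_split /= rmorph_sum; congr (_ + _).
  by apply: eq_bigr => l _; rewrite rmorphM emb_cst.
rewrite (bigD1 k3) //= big1 => [|l /negPf ->]; last by rewrite mulr0n mulr0.
by rewrite addr0 mulr1n L3 rmorph_nat mulr_natl.
Qed.

Lemma nrm_dmono n kp d J (v : 'I_m -> 'I_4 -> mp R n) (N : 'I_m -> 'I_4 -> R) :
  (forall h k, nrm (v h k) <= N h k) -> nrm (dmono kp d J v) <= dmono kp d J N.
Proof.
move=> hN; have N0 h k : 0 <= N h k := le_trans (nrm_ge0 _) (hN h k).
apply: le_trans (nrm_prod _ _ _) _; apply: ler_prod => h _; rewrite nrm_ge0 /=.
apply: le_trans (nrmM _ _) _; apply: ler_pM; rewrite ?nrm_ge0 //.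
  apply: le_trans (nrm_prod _ _ _) _; apply: ler_prod => k _; rewrite nrm_ge0 /=.
  by apply: le_trans (nrmX _ _) _; apply: lerXn2r; rewrite ?nnegrE ?nrm_ge0.
rewrite nrmMn lerMn2r; apply/orP; right.
by apply: le_trans (nrmX _ _) _; apply: lerXn2r; rewrite ?nnegrE ?nrm_ge0.
Qed.

Lemma intp_dmono n kp d J (v : 'I_m -> 'I_4 -> mp R n) :
  (forall h k, intp (v h k)) -> intp (dmono kp d J v).
Proof.
move=> iv; apply: intp_prod => h _; apply: intpM; last by apply: intpMn; apply: intpX.
by apply: intp_prod => k _; apply: intpX.
Qed.

(* On integer combinations of the points b the derived form is a polynomial with integer
   coefficients, and these are all less than 1 in absolute value. *)
Lemma vanish_on_span (p : JJ -> int) (cf : JJ -> R) (L : 'I_4 -> 'I_4 -> R) (d : nat -> nat)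
    (b : 'I_m -> 'I_3 -> 'I_4 -> int) (Yb : 'I_m -> 'I_3 -> 'I_4 -> R) :
  (forall n (Y : 'I_m -> 'I_4 -> mp R n),
    \sum_J cst n (p J)%:~R * dmono k1 d J (fun h i => \sum_l cst n (L i l) * Y h l) =
    \sum_J cst n (cf J) * dmono k3 d J Y) ->
  (forall h i k, (b h i k)%:~R = \sum_l L k l * Yb h i l) ->
  \sum_J `|cf J| * dmono k3 d J (fun h l => \sum_i `|Yb h i l|) < 1 ->
  forall u : 'I_m -> 'I_3 -> R,
    \sum_J (p J)%:~R * dmono k1 d J (fun h k => \sum_i u h i * (b h i k)%:~R) = 0.
Proof.
move=> Hid bY small u.
pose n := (3 * m)%N.
pose vr (h : 'I_m) (i : 'I_3) : mp R n := var n (3 * h + i)%N.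
pose Y h l : mp R n := \sum_i cst n (Yb h i l) * vr h i.
pose v h k : mp R n := \sum_i cst n (b h i k)%:~R * vr h i.
have vE h k : v h k = \sum_l cst n (L k l) * Y h l.
  rewrite /Y sum_swap; apply: eq_bigr => i _; congr (_ * _).
  by rewrite bY rmorph_sum; apply: eq_bigr => l _; rewrite rmorphM.
pose T : mp R n := \sum_J cst n (p J)%:~R * dmono k1 d J v.
have TE : T = \sum_J cst n (cf J) * dmono k3 d J Y.
  by rewrite -Hid; apply: eq_bigr => J _; congr (_ * _); apply: dmono_ext.
have iT : intp T.
  apply: intp_sum => J _; apply: intpM; first by apply: intp_cst; rewrite intr_int.
  apply: intp_dmono => h k; apply: intp_sum => i _; apply: intpM; last exact: intp_var.
  by apply: intp_cst; rewrite intr_int.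
have nT : nrm T < 1.
  apply: le_lt_trans small; rewrite TE; apply: le_trans (nrm_sum _ _ _) _.
  apply: ler_sum => J _; apply: le_trans (nrmM _ _) _; rewrite nrm_cst; apply: ler_wpM2l => //.
  apply: nrm_dmono => h l; apply: le_trans (nrm_sum _ _ _) _; apply: ler_sum => i _.
  apply: le_trans (nrmM _ _) _; rewrite nrm_cst -[leRHS]mulr1; apply: ler_wpM2l => //.
  exact: nrm_var.
have T0 := intp_small iT nT.
pose uu (j : nat) : R := if insub (j %/ 3)%N is Some h then u h (inord (j %% 3)) else 0.
have := congr1 (ev n uu) T0; rewrite rmorph0 rmorph_sum /= => e; rewrite -[RHS]e.
apply: eq_bigr => J _; rewrite rmorphM ev_cst dmono_morph; congr (_ * _).
apply: dmono_ext => h k; rewrite rmorph_sum; apply: eq_bigr => i _.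
rewrite rmorphM ev_cst mulrC; congr (_ * _).
have lt : (3 * h + i < n)%N by rewrite /n; have := ltn_ord h; have := ltn_ord i; lia.
rewrite /vr ev_var // /uu mulnC divnMDl // divn_small // addn0 valK modnMDl modn_small //.
by rewrite inord_val.
Qed.

End Derived.

Lemma digit_sum_lt m W (a : 'I_m -> nat) : (forall h, a h < W)%N ->
  (\sum_h a h * W ^ h < W ^ m)%N.
Proof.
elim: m a => [|m IH] a ha; first by rewrite big_ord0.
rewrite big_ord_recr /= expnS.
have := IH (fun h => a (widen_ord (leqnSn m) h)) (fun h => ha _).
have := ha ord_max; set s := (\sum_(_ < m) _)%N; set w := (W ^ m)%N; nia.
Qed.

Lemma euclid_inj a b x y w : (a < w)%N -> (b < w)%N -> (a + x * w = b + y * w)%N -> x = y /\ a = b.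
Proof.
move=> aw bw e; have w0 : (0 < w)%N by apply: leq_ltn_trans aw.
have exy : x = y.
  have := congr1 (fun n => n %/ w)%N e.
  by rewrite ![(_ + _ * w)%N]addnC !divnMDl // !divn_small // !addn0.
by split => //; move: e; rewrite exy => /addIn.
Qed.

Lemma digit_sum_inj m W (a b : 'I_m -> nat) : (forall h, a h < W)%N -> (forall h, b h < W)%N ->
  (\sum_h a h * W ^ h = \sum_h b h * W ^ h)%N -> a =1 b.
Proof.
elim: m a b => [|m IH] a b ha hb; first by move=> _ [].
rewrite !big_ord_recr /=.
have la := digit_sum_lt (a := fun h => a (widen_ord (leqnSn m) h)) (fun h => ha _).
have lb := digit_sum_lt (a := fun h => b (widen_ord (leqnSn m) h)) (fun h => hb _).
move=> e.
have em : a ord_max = b ord_max.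
  by have [] := euclid_inj la lb e.
move: e; rewrite em => /addIn e.
have ih := IH (fun h => a (widen_ord (leqnSn m) h)) (fun h => b (widen_ord (leqnSn m) h)) (fun h => ha _) (fun h => hb _) e.
move=> h; case: (unliftP ord_max h) => [j ->|->] //.
by have := ih j; congr (a _ = b _); apply: val_inj; rewrite /= /bump leqNgt ltn_ord.
Qed.

Lemma poly_nonroot (R : realType) (G : {poly R}) : G != 0 -> exists t, G.[t] != 0.
Proof.
move=> G0; apply: contrapT => /forallNP h.
have H1 : all (root G) [seq i%:R | i <- iota 0 (size G)].
  by apply/allP => x _; apply/rootP/eqP/negPn/negP => nx; apply: (h x).
have H2 : uniq [seq (i%:R : R) | i <- iota 0 (size G)].
  by rewrite map_inj_uniq ?iota_uniq // => i j /eqP; rewrite eqr_nat => /eqP.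
by have := max_poly_roots G0 H1 H2; rewrite size_map size_iota ltnn.
Qed.

(** Q collects the terms whose exponents of y_2 and y_3 have least weight, with y_0 = 1; homogeneity
    recovers the exponent of y_0, so nothing cancels. On the curve where y_2 and y_3 in block h are
    t^(W^h) and t^(W^(h+m)), the equation of the hyperplane makes y_1 equal to -x_0/x_1 plus
    positive powers of t, and the lowest coefficient of the derived polynomial is the derivative of
    Q at these fractions. The exponents are digits in base W = D + 1, so the weight determines
    them. *)
Lemma nonvanish (R : realType) m D (r : 'I_m -> nat) (p : {ffun 'I_m -> {ffun 'I_4 -> 'I_D.+1}} -> int) :
  (exists J, p J != 0) -> (forall J, p J != 0 -> idxs r J) ->
  exists Q : mp R m, [/\ Q != 0, degle (extn 0%N r) Q, intp Q, nrm Q <= \sum_J `|(p J)%:~R| &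
   forall (x : 'I_m -> 'I_4 -> int) (d : nat -> nat) (xi : nat -> R),
    (forall h, x h k1 != 0) -> (forall h : 'I_m, xi h = - (x h k0)%:~R / (x h k1)%:~R) ->
    ev m xi (hasse m d Q) != 0 ->
    exists y : 'I_m -> 'I_4 -> R, (forall h, \sum_k (x h k)%:~R * y h k = 0) /\
      \sum_J (p J)%:~R * dmono k1 d J y != 0].
Proof.
move=> [J0 pJ0] pidx.
pose JJ := {ffun 'I_m -> {ffun 'I_4 -> 'I_D.+1}}.
pose W := D.+1.
pose wt (J : JJ) := (\sum_h J h k2 * W ^ h + (\sum_h J h k3 * W ^ h) * W ^ m)%N.
case: (arg_minnP (P := fun J : JJ => p J != 0) wt pJ0) => Js pJs minJ.
have wtE (J : JJ) : wt J = wt Js -> forall h, J h k2 = Js h k2 /\ J h k3 = Js h k3.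
  rewrite /wt => e.
  have b2 (J' : JJ) : (\sum_h J' h k2 * W ^ h < W ^ m)%N by apply: digit_sum_lt => h; exact: ltn_ord.
  have e3 : (\sum_h J h k3 * W ^ h = \sum_h Js h k3 * W ^ h)%N.
    by have [] := euclid_inj (b2 J) (b2 Js) e.
  have e2 : (\sum_h J h k2 * W ^ h = \sum_h Js h k2 * W ^ h)%N by move: e; rewrite e3 => /addIn.
  move=> h; split; apply: val_inj.
    by apply: (digit_sum_inj (a := fun h => J h k2 : nat) (b := fun h => Js h k2 : nat) _ _ e2) => h'; exact: ltn_ord.
  by apply: (digit_sum_inj (a := fun h => J h k3 : nat) (b := fun h => Js h k3 : nat) _ _ e3) => h'; exact: ltn_ord.
pose ex (J : JJ) := extn 0%N (fun h => J h k1 : nat).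
pose Q : mp R m := \sum_(J : JJ | wt J == wt Js) cst m (p J)%:~R * mon m (ex J).
exists Q; split.
- have pJs' := pJs; apply: contraNneq pJs' => Q0.
  have := congr1 (coefn m (ex Js)) Q0; rewrite raddf0 raddf_sum /= (bigD1 Js) //= coefn_cstM coefn_mon.
  have -> : [forall h : 'I_m, ex Js h == ex Js h] by apply/forallP.
  rewrite mulr1 big1 ?addr0 => [/eqP|J /andP[/eqP wJ neJ]]; first by rewrite intr_eq0.
  rewrite coefn_cstM coefn_mon; case: forallP => [h|_]; last by rewrite mulr0.
  rewrite mulr1; have [->//|pJ] := eqVneq (p J) 0.
  case/negP: neJ; apply/eqP/ffunP => h'; apply/ffunP.
  have [e2 e3] := wtE J wJ h'.
  have e1 : J h' k1 = Js h' k1 by apply: val_inj; have := h h'; rewrite /ex !extnE => /eqP.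
  have := idxsP h' (pidx _ pJ); have := idxsP h' (pidx _ pJs); rewrite /blk !big4 /= e1 e2 e3 => /eqP <-.
  rewrite eqn_add2r => /eqP e0.
  by apply: ord4P => //; apply: val_inj.
- apply: degle_sum => J wJ; have [->|pJ] := eqVneq (p J) 0.
    by rewrite rmorph0 mul0r; exact: degle0.
  have := degleM (@degle_cst R m (fun=> 0%N) (p J)%:~R) (@degle_mon R m (ex J) (extn 0%N r) _).
  apply => h hm; have -> : h = (Ordinal hm : nat) by [].
  by rewrite /ex !extnE; apply: blk_le; exact: idxsP (pidx _ pJ).
- apply: intp_sum => J _; apply: intpM; last exact: intp_mon.
  by apply: intp_cst; rewrite intr_int.
- apply: le_trans (nrm_sum _ _ _) _; rewrite [leLHS]big_mkcond; apply: ler_sum => J _.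
  case: ifP => // _; apply: le_trans (nrmM _ _) _; rewrite nrm_cst -[leRHS]mulr1.
  by apply: ler_wpM2l => //; exact: nrm_mon.
move=> x d xi x0 xiE Qne.
pose vv (h : 'I_m) (k : 'I_4) : {poly R} :=
  if k == k0 then 1 else if k == k2 then 'X^(W ^ h) else if k == k3 then 'X^(W ^ h * W ^ m) else
  (xi h)%:P - ((x h k2)%:~R / (x h k1)%:~R)%:P * 'X^(W ^ h) - ((x h k3)%:~R / (x h k1)%:~R)%:P * 'X^(W ^ h * W ^ m).
pose K (J : JJ) : {poly R} := \prod_h (vv h k1 ^+ (J h k1 - d h) *+ 'C(J h k1, d h)).
have dE (J : JJ) : dmono k1 d J vv = K J * 'X^(wt J).
  have -> : 'X^(wt J) = \prod_(h < m) ('X^(W ^ h) ^+ J h k2 * 'X^(W ^ h * W ^ m) ^+ J h k3) :> {poly R}.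
    rewrite big_split /= /wt exprD big_distrl /=; congr (_ * _).
      rewrite (big_morph _ (exprD 'X) (expr0 'X)); apply: eq_bigr => h _.
      by rewrite -exprM mulnC.
    rewrite (big_morph _ (exprD 'X) (expr0 'X)); apply: eq_bigr => h _.
    by rewrite -exprM [in RHS]mulnC -mulnA.
  rewrite /dmono /K -big_split /=; apply: eq_bigr => h _; rewrite mulrC; congr (_ * _).
  by rewrite big_mkcond big4 /= /vv /= expr1n !mul1r.
pose G : {poly R} := \sum_J (p J)%:~R%:P * dmono k1 d J vv.
have vv0 h : (vv h k1).[0] = xi h.
  rewrite /vv /= !hornerD !hornerN !hornerM !hornerC !hornerXn !expr0n.
  have w0 : (W ^ h == 0)%N = false by rewrite expn_eq0.
  have w1 : (W ^ h * W ^ m == 0)%N = false by rewrite muln_eq0 !expn_eq0.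
  by rewrite w0 w1 !mulr0 !subr0.
(* Minimality of [Js] excludes terms of smaller weight, and those of larger weight are multiples of
   a higher power of t. *)
have Gc : G`_(wt Js) = ev m xi (hasse m d Q).
  rewrite /G coef_sum /Q raddf_sum raddf_sum /= [RHS]big_mkcond; apply: eq_bigr => J _.
  rewrite coefCM dE coefMXn; have [pJ|pJ] := eqVneq (p J) 0.
    by rewrite pJ !rmorph0 !mul0r !raddf0; case: ifP.
  have := minJ J pJ; rewrite leq_eqVlt => /orP[/eqP eJ|ltJ]; last first.
    by rewrite ltJ mulr0 gtn_eqF.
  rewrite -eJ eqxx ltnn subnn hasse_cstM rmorphM ev_cst ev_hasse_mon; congr (_ * _).
  rewrite -horner_coef0 /K horner_prod; apply: eq_bigr => h _.
  by rewrite hornerMn horner_exp vv0 /ex extnE.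
have G0 : G != 0 by apply: contraNneq Qne => G0; rewrite -Gc G0 coef0.
have [t Gt] := poly_nonroot G0.
exists (fun h k => (vv h k).[t]); split.
  move=> h; rewrite big4 /= /vv /= !hornerD !hornerN !hornerM !hornerC !hornerXn xiE.
  have q0 : (x h k1)%:~R != 0 :> R by rewrite intr_eq0.
  by field.
move: Gt; rewrite /G horner_sum; congr (_ != _); apply: eq_bigr => J _.
rewrite hornerM hornerC; congr (_ * _).
by rewrite -[LHS]/(horner_eval t _) dmono_morph.
Qed.

(* The coordinate y k of a vector is \sum_l (lamZ k l).[al] * Yform al y l. *)
Definition lamZ (k l : 'I_4) : {poly int} :=
  nth 0 (nth [::] [:: [:: - 'X^2; - 'X; 1; 0]; [:: - 'X; 0; 0; 1];
                      [:: 'X; 1; 0; 0]; [:: 1; 0; 0; 0]] k) l.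

Lemma lamZ_size k l : (size (lamZ k l) <= 3)%N.
Proof.
move: l; elim/ord4P: k => l; elim/ord4P: l;
by rewrite /lamZ /= ?size_polyN ?size_polyXn ?size_polyX ?size_poly1 ?size_poly0.
Qed.

(** * The four linear forms and the size of derived monomials *)

Section Forms.
Variable R : realType.

Lemma sum_ord_const m (x : R) : \sum_(h < m) x = m%:R * x.
Proof. by rewrite sumr_const card_ord mulr_natl. Qed.

Lemma lamZ_l1 k l : l1 R (lamZ k l) <= 1.
Proof.
have n0 : l1 R 0 <= 1 by rewrite /l1 rmorph0 (nrm0 R 1).
have n1 : l1 R 1 <= 1 by rewrite /l1 rmorph1 (nrm1 R 1).
have nN s : l1 R s <= 1 -> l1 R (- s) <= 1 by rewrite /l1 rmorphN (@nrmN R 1).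
have nX : l1 R 'X <= 1.
  by rewrite /l1 map_polyX; have := @nrm_mon R 1 (fun=> 1%N); rewrite /= mul1r expr1.
have nX2 : l1 R 'X^2 <= 1.
  by rewrite /l1 map_polyXn; have := @nrm_mon R 1 (fun=> 2%N); rewrite /= mul1r.
move: l; elim/ord4P: k => l; elim/ord4P: l; rewrite /lamZ /= //; exact: nN.
Qed.

Definition Lmat (al : R) (k l : 'I_4) : R := (map_poly intr (lamZ k l)).[al].

Definition Yform (al : R) (y : 'I_4 -> R) (l : 'I_4) : R :=
  match val l with
  | 0 => y k3
  | 1 => y k2 - al * y k3
  | 2 => y k0 + al * y k2
  | _ => y k1 + al * y k3
  end.

Lemma Lmat_k3 al k : Lmat al k k3 = (k == k1)%:R.
Proof.
by elim/ord4P: k; rewrite /Lmat /lamZ /= ?rmorph0 ?rmorph1 ?horner0 ?hornerC.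
Qed.

Lemma Lmat_Yform al (y : 'I_4 -> R) k : y k = \sum_l Lmat al k l * Yform al y l.
Proof.
rewrite big4 /=.
by elim/ord4P: k; rewrite /Lmat /lamZ /Yform /= ?(rmorphN, map_polyXn, map_polyX, rmorph0, rmorph1) /=
  ?(map_polyXn, map_polyX) ?(hornerN, hornerXn, hornerX, horner0, hornerC); ring.
Qed.

(** x is the normal vector. Coprimality makes -x_0/x_1 a fraction with reduced denominator q, as
    Roth's lemma requires. *)
Definition small_hyperplane (al : R) (c : 'I_4 -> R) (q : nat) (x : 'I_4 -> int)
    (b : 'I_3 -> 'I_4 -> int) :=
  [/\ (0 < q)%N, x k1 = q%:Z, coprimez (x k0) q,
      forall y : 'I_4 -> R, \sum_k (x k)%:~R * y k = 0 ->
        exists u : 'I_3 -> R, forall k, y k = \sum_i u i * (b i k)%:~R &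
      forall i l, `|Yform al (fun k => (b i k)%:~R) l| <= expR (c l * ln (q%:R : R))].

(** 6 = 2 * 3, with 2 from the binomial coefficients and 3 from the bound on N. The error 3 e
    collects the unequal products r h * ell h, the deviation of J from the mean, and the exponents
    lost to differentiation. *)
Lemma dmono_bound m D (r : 'I_m -> nat) (d : nat -> nat)
    (J : {ffun 'I_m -> {ffun 'I_4 -> 'I_D.+1}}) (N : 'I_m -> 'I_4 -> R) (c : 'I_4 -> R) (ell : 'I_m -> R)
    (lam e : R) :
  (forall h, (0 < r h)%N) -> (0 < m)%N -> 0 < e -> 0 <= lam ->
  (forall h, 0 <= ell h) ->
  (forall h, lam <= (r h)%:R * ell h) -> (forall h, (r h)%:R * ell h <= (1 + e) * lam) ->
  (forall h l, 0 <= N h l <= 3 * expR (c l * ell h)) ->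
  idxs r J -> (forall k, `|dev R r k J| <= e * m%:R) ->
  \sum_(h < m) (d h)%:R / (r h)%:R <= e ->
  dmono k3 d J N <= 6 ^+ (\sum_h r h) *
    expR (lam * m%:R * ((\sum_k c k) / 4 + 3 * e * \sum_k `|c k|)).
Proof.
move=> r0 m0 e0 lam0 ell0 rl1 rl2 hN iJ hdev hd.
have r0' h : 0 < (r h)%:R :> R by rewrite ltr0n.
pose J' h k := if k == k3 then (J h k - d h)%N else J h k : nat.
case: (boolP [exists h : 'I_m, J h k3 < d h])%N => [/existsP[h hh]|].
  rewrite /dmono (bigD1 h) //= bin_small // mulr0n mulr0 mul0r.
  by rewrite mulr_ge0 ?exprn_ge0 ?expR_ge0.
rewrite negb_exists => /forallP hge.
have dJ (h : 'I_m) : (d h <= J h k3)%N by have := hge h; rewrite -leqNgt.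
have J'le h k : (J' h k <= r h)%N.
  rewrite /J'; case: ifP => _; last exact: blk_le (idxsP h iJ).
  by apply: leq_trans (leq_subr _ _) _; exact: blk_le (idxsP h iJ).
have sJ' h : (\sum_k J' h k <= r h)%N.
  have := idxsP h iJ; rewrite /blk => /eqP <-; apply: leq_sum => k _.
  by rewrite /J'; case: ifP => // _; exact: leq_subr.
have N0 h l : 0 <= N h l by have /andP[] := hN h l.
have step1 : dmono k3 d J N <= \prod_h (6 ^+ r h * expR (\sum_k (J' h k)%:R * (c k * ell h))).
  apply: ler_prod => h _; apply/andP; split.
    rewrite mulr_ge0 ?mulrn_wge0 ?exprn_ge0 ?prodr_ge0 // => *; rewrite ?exprn_ge0 //.
  have -> : (\prod_(k | k != k3) N h k ^+ J h k) * (N h k3 ^+ (J h k3 - d h) *+ 'C(J h k3, d h)) =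
     'C(J h k3, d h)%:R * \prod_k N h k ^+ J' h k.
    rewrite [X in _ = _ * X](bigD1 k3) //= /J' eqxx mulrA mulrC -mulr_natl; congr (_ * _).
    by apply: eq_bigr => k /negPf ->.
  have -> : 6 = 2 * 3 :> R by ring.
  rewrite exprMn -mulrA; apply: ler_pM => //.
  - by apply: prodr_ge0 => k _; rewrite exprn_ge0 //; case/andP: (hN h k).
  - rewrite -natrX ler_nat; apply: (@leq_trans (2 ^ J h k3)); last first.
      by rewrite leq_exp2l //; exact: blk_le (idxsP h iJ).
    have := @Pascal 1 1 (J h k3); rewrite addn1 => ->.
    have lt : (d h < (J h k3).+1)%N by rewrite ltnS.
    by rewrite (bigD1 (Ordinal lt)) //= !exp1n !muln1 leq_addr.
  apply: (@le_trans _ _ (\prod_k (3 ^+ J' h k * expR ((J' h k)%:R * (c k * ell h))))).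
    apply: ler_prod => k _; have /andP[n0 n1] := hN h k; rewrite exprn_ge0 //= expRM_natl -exprMn.
    by apply: lerXn2r; rewrite ?nnegrE // mulr_ge0 ?expR_ge0.
  rewrite big_split /= -(big_morph (fun x => 3 ^+ x) (exprD 3) (expr0 3)) -expR_sum.
  by apply: ler_wpM2r; rewrite ?expR_ge0 // ler_weXn2l // ler1n.
apply: le_trans step1 _.
rewrite big_split /= -(big_morph (fun x => 6 ^+ x) (exprD 6) (expr0 6)) -expR_sum.
apply: ler_wpM2l; rewrite ?exprn_ge0 // ler_expR exchange_big /=.
have key k : `|\sum_h (J' h k)%:R * ell h - lam * m%:R / 4| <= 3 * e * (lam * m%:R).
  pose a h : R := (J' h k)%:R / (r h)%:R.
  have a0 h : 0 <= a h by rewrite divr_ge0.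
  have a1 h : a h <= 1 by rewrite ler_pdivrMr // mul1r ler_nat.
  have -> : \sum_h (J' h k)%:R * ell h - lam * m%:R / 4 =
     \sum_h a h * ((r h)%:R * ell h - lam) + lam * (\sum_h a h - m%:R / 4).
    rewrite mulrBr [lam * \sum_h a h]mulr_sumr addrA -big_split /= mulrA; congr (_ - _).
    apply: eq_bigr => h _; rewrite /a; field; exact: lt0r_neq0.
  apply: le_trans (ler_normD _ _) _.
  have t1 : `|\sum_h a h * ((r h)%:R * ell h - lam)| <= e * (lam * m%:R).
    apply: le_trans (ler_norm_sum _ _ _) _.
    apply: (@le_trans _ _ (\sum_(h < m) e * lam)); last by rewrite sum_ord_const [leRHS]mulrA [leLHS]mulrC.
    apply: ler_sum => h _; rewrite ger0_norm; last by rewrite mulr_ge0 ?subr_ge0.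
    rewrite -[leRHS]mul1r; apply: ler_pM; rewrite ?subr_ge0 //.
    by have := rl2 h; lra.
  have t2 : `|\sum_h a h - m%:R / 4| <= 2 * e * m%:R.
    have dE : dev R r k J = \sum_h (J h k : nat)%:R / (r h)%:R - m%:R / 4.
      by rewrite /dev sumrB sum_ord_const.
    have m1 : 1 <= m%:R :> R by rewrite ler1n.
    have aE : \sum_h a h = \sum_h (J h k : nat)%:R / (r h)%:R - (if k == k3 then \sum_(h < m) (d h)%:R / (r h)%:R else 0).
      rewrite /a /J'; case: eqVneq => [->|_]; last by rewrite subr0.
      by rewrite -sumrB; apply: eq_bigr => h _; rewrite natrB // mulrBl.
    have b1 : `|if k == k3 then \sum_(h < m) (d h)%:R / (r h)%:R else 0| <= e.
      case: ifP => _; last by rewrite normr0 ltW.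
      by rewrite ger0_norm // sumr_ge0 // => h _; rewrite divr_ge0.
    have := hdev k; rewrite dE => b2.
    rewrite aE addrAC; apply: le_trans (ler_normB _ _) _.
    apply: le_trans (lerD b2 b1) _; nra.
  rewrite normrM (ger0_norm lam0).
  have := ler_wpM2l lam0 t2; lra.
have -> : lam * m%:R * ((\sum_k c k) / 4 + 3 * e * \sum_k `|c k|) =
   \sum_k (c k * (lam * m%:R / 4) + `|c k| * (3 * e * (lam * m%:R))).
  by rewrite big_split /= -!mulr_suml; field.
apply: ler_sum => k _.
have -> : \sum_h (J' h k)%:R * (c k * ell h) =
   c k * (lam * m%:R / 4) + c k * (\sum_h (J' h k)%:R * ell h - lam * m%:R / 4).
  rewrite -mulrDr addrC subrK mulr_sumr; apply: eq_bigr => h _; ring.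
rewrite lerD2l; apply: le_trans (ler_norm _) _; rewrite normrM.
by apply: ler_wpM2l.
Qed.

End Forms.

(** * Choice of the parameters and the contradiction *)

Section Main.
Variable R : realType.

(** The logarithms [ell] of the denominators grow by factors of at least 2 / om, so that the degrees
    r h, about lam / ell h, decrease by om even after rounding. [lam] is large against [ell m],
    which makes all r h * ell h nearly equal to it, and [A0] makes [ell 0] so large that the total
    degree is small against [lam]. *)
Lemma block_parameters (T : Type) (qf : T -> nat) (P : T -> Prop) (m : nat) (e om K dl : R) :
  0 < e -> 0 < om -> om <= 1 -> 0 < K -> 0 < dl -> (0 < m)%N -> (forall t, P t -> (0 < qf t)%N) ->
  (forall Q0 : R, exists t, Q0 <= (qf t)%:R /\ P t) ->
  exists (z : nat -> T) (r : nat -> nat) (lam : R),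
  [/\ forall k, P (z k), 0 < lam /\ (forall h, (0 < r h)%N /\ 0 < ln (qf (z h))%:R :> R),
      forall h, lam <= (r h)%:R * ln (qf (z h))%:R /\
                ((h <= m)%N -> (r h)%:R * ln (qf (z h))%:R <= (1 + e) * lam),
      forall h k, (h < k)%N -> (k < m)%N -> (r k)%:R <= om * (r h)%:R &
      (\sum_(h < m) r h)%:R * K <= om * lam /\
      (\sum_(h < m) r h)%:R * K < lam * m%:R * (dl / 8)].
Proof.
move=> e0 om0 om1 K0 dl0 m0 Pq H'.
pose A0 := 1 + 2 * m%:R * K / om + 16 * K / dl.
have A01 : 0 <= 2 * m%:R * K / om by rewrite divr_ge0 ?mulr_ge0 // ltW.
have A02 : 0 <= 16 * K / dl by rewrite divr_ge0 ?mulr_ge0 // ltW.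
pose pick Q0 : T := projT1 (cid (H' Q0)).
have pickP Q0 : Q0 <= (qf (pick Q0))%:R /\ P (pick Q0).
  by rewrite /pick; case: (cid _).
pose Qs := fix Qs (k : nat) : R := if k is k'.+1 then expR ((2 / om) * ln ((qf (pick (Qs k')))%:R : R)) else expR A0.
pose z k := pick (Qs k).
have zP k : P (z k) by have [] := pickP (Qs k).
pose ell k : R := ln (qf (z k))%:R.
have q0 k : (0 < qf (z k))%N by exact: Pq.
have ell_ge k x : Qs k = expR x -> x <= ell k.
  move=> e'; have [h _] := pickP (Qs k); rewrite -ler_expR /ell lnK ?posrE ?ltr0n //.
  by rewrite -e'.
have ell0 : A0 <= ell 0%N by apply: ell_ge.
have ellS k : (2 / om) * ell k <= ell k.+1 by apply: ell_ge.
have om2 : 2 <= 2 / om by rewrite ler_pdivlMr //; lra.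
have ell_gt0 k : 0 < ell k.
  elim: k => [|k IH]; first by apply: lt_le_trans ell0; rewrite /A0; lra.
  by apply: lt_le_trans (ellS k); rewrite mulr_gt0 // divr_gt0.
have ell_mono h k : (h <= k)%N -> ell h <= ell k.
  elim: k => [|k IH]; first by rewrite leqn0 => /eqP ->.
  rewrite leq_eqVlt => /orP[/eqP ->//|/IH h1]; apply: le_trans h1 (le_trans _ (ellS k)).
  by have := ell_gt0 k; nra.
have ell_lt h k : (h < k)%N -> (2 / om) * ell h <= ell k.
  by move=> hk; apply: le_trans (ellS h) (ell_mono _ _ hk).
pose lam := (2 / om + e^-1) * ell m.
have ei0 : 0 < e^-1 by rewrite invr_gt0.
have lam1 h : (h <= m)%N -> (2 / om) * ell h <= lam.
  move=> hm'; have := ell_mono _ _ hm'; have := ell_gt0 h; have := om2; rewrite /lam.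
  move: (2 / om) => x x2 h0 h1; nra.
have lam2 h : (h <= m)%N -> ell h <= e * lam.
  move=> hm'; have h1 := ell_mono _ _ hm'; apply: le_trans h1 _.
  rewrite /lam mulrA mulrDr mulfV ?lt0r_neq0 // mulrDl mul1r lerDr.
  by rewrite !mulr_ge0 ?invr_ge0 // ltW.
have lam0 : 0 < lam by apply: lt_le_trans (lam1 m (leqnn m)); rewrite mulr_gt0 ?divr_gt0.
pose r h := (Num.truncn (lam / ell h)).+1.
have rlt h : lam / ell h < (r h)%:R by exact: truncnS_gt.
have rle h : (r h)%:R <= lam / ell h + 1.
  rewrite /r -natr1 lerD2r truncn_le // divr_ge0 // ltW //.
have rl1 h : lam <= (r h)%:R * ell h by rewrite -ler_pdivrMr // ltW.
have rl2 h : (h <= m)%N -> (r h)%:R * ell h <= (1 + e) * lam.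
  move=> hm'; have : (r h)%:R * ell h <= (lam / ell h + 1) * ell h by rewrite ler_pM2r.
  by rewrite mulrDl divfK ?lt0r_neq0 //; have := lam2 h hm'; lra.
pose D := (\sum_(h < m) r h)%N.
have ell00 := ell_gt0 0%N.
have DK : D%:R * K <= 2 * m%:R * K / ell 0%N * lam.
  have : D%:R <= m%:R * (2 * (lam / ell 0%N)).
    rewrite /D natr_sum; apply: (@le_trans _ _ (\sum_(h < m) (2 * (lam / ell 0%N)))); last first.
      by rewrite sum_ord_const.
    apply: ler_sum => h _; apply: le_trans (rle h) _.
    have l1 : lam / ell h <= lam / ell 0%N.
      apply: ler_wpM2l; first exact: ltW.
      by rewrite lef_pV2 ?posrE ?ell_gt0 // ell_mono.
    have l2 : 1 <= lam / ell 0%N.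
      rewrite ler_pdivlMr // mul1r; apply: le_trans (lam1 0%N (leq0n _)).
      by have := om2; move: (2 / om) => x x2; nra.
    lra.
  move=> h; have := ler_wpM2r (ltW K0) h; congr (_ <= _); field; exact: lt0r_neq0.
have DK1 : D%:R * K <= om * lam.
  apply: le_trans DK _; apply: ler_wpM2r; first exact: ltW.
  rewrite ler_pdivrMr // [leRHS]mulrC -ler_pdivrMr //; apply: le_trans ell0.
  by rewrite /A0; lra.
have DK2 : D%:R * K < lam * m%:R * (dl / 8).
  apply: le_lt_trans DK _.
  have : 16 * K / dl < ell 0%N by apply: lt_le_trans ell0; rewrite /A0; lra.
  rewrite ltr_pdivrMr // => h.
  have m0' : 0 < m%:R :> R by rewrite ltr0n.
  have -> : lam * m%:R * (dl / 8) = (m%:R * (dl / 8)) * lam by ring.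
  rewrite ltr_pM2r // ltr_pdivrMr //.
  have -> : 2 * m%:R * K = m%:R * (2 * K) by ring.
  by rewrite -mulrA ltr_pM2l //; lra.
exists z, r, lam; split; [exact: zP|by split => // h; split => //; exact: ell_gt0|by move=> h; split; [exact: rl1|exact: rl2]| |by []].
move=> h k hk km; have lh := ell_gt0 h; have lk := ell_gt0 k.
apply: le_trans (rle k) _; apply: (@le_trans _ _ (om * (lam / ell h))); last first.
  by rewrite ler_pM2l // ltW // rlt.
have i1 : lam / ell k <= om / 2 * (lam / ell h).
  have := ell_lt h k hk; rewrite ler_pdivrMr // => hh.
  have : lam <= om / 2 * (lam / ell h) * (2 / om * ell h).
    suff -> : om / 2 * (lam / ell h) * (2 / om * ell h) = lam by [].
    by field; rewrite !lt0r_neq0.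
  move=> hh2; apply: le_trans hh2 _; apply: ler_wpM2l => //.
  by apply: ltW; rewrite mulr_gt0 ?divr_gt0.
have i2 : 1 <= om / 2 * (lam / ell h).
  have := lam1 h (ltnW (ltn_trans hk km)) => hh.
  have : ell h * (2 / om) * (om / 2 / ell h) <= lam * (om / 2 / ell h).
    apply: ler_wpM2r; last by rewrite mulrC.
    by rewrite !mulr_ge0 ?invr_ge0 // ltW.
  have -> : ell h * (2 / om) * (om / 2 / ell h) = 1 by field; rewrite !lt0r_neq0.
  by move=> hh2; apply: le_trans hh2 _; suff -> : lam * (om / 2 / ell h) = om / 2 * (lam / ell h) by []; ring.
have -> : om * (lam / ell h) = om / 2 * (lam / ell h) + om / 2 * (lam / ell h) by field; exact: lt0r_neq0.
exact: lerD.
Qed.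

(** The sum that [vanish_on_span] wants below 1 has at most 4^D terms, with coefficients at most C^D
    and monomials at most 6^D exp(- lam m dl / 8). Taking ell 0 large makes (24 C)^D smaller than
    the exponential gain. *)
Theorem no_small_hyperplanes (al : R) (F : {poly int}) dg (c : 'I_4 -> R) :
  size F = dg.+1 -> (0 < dg)%N -> root (map_poly intr F) al -> \sum_k c k < 0 ->
  ~ (forall Q0 : R, exists (q : nat) (x : 'I_4 -> int) (b : 'I_3 -> 'I_4 -> int),
       Q0 <= q%:R /\ small_hyperplane al c q x b).
Proof.
move=> sF dg0 rt csum H.
set dl := - \sum_k c k.
have dl0 : 0 < dl by rewrite oppr_gt0.
pose cs : R := \sum_k `|c k|.
have cs0 : 0 <= cs by apply: sumr_ge0.
(* The error term of [dmono_bound] then uses at most half of the gain dl / 4. *)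
pose e : R := Num.min 1 (dl / (24 * (cs + 1))).
have cs1 : 0 < 24 * (cs + 1) by rewrite mulr_gt0 // ltr_wpDl.
have e0 : 0 < e by rewrite lt_min ltr01 divr_gt0.
have e1 : e <= 1 by rewrite ge_min lexx.
have e2 : 3 * e * cs <= dl / 8.
  have : e * (24 * (cs + 1)) <= dl by rewrite -ler_pdivlMr // ge_min lexx orbT.
  have : 0 <= e by exact: ltW.
  nra.
have e3 : (\sum_k c k) / 4 + 3 * e * \sum_k `|c k| <= - (dl / 8).
  have sc : \sum_k c k = - dl by rewrite opprK.
  have G (x d : R) : x <= d / 8 -> (- d) / 4 + x <= - (d / 8) by lra.
  by rewrite sc; apply: G.
have [C [C1 aux]] := aux_poly sF dg0 rt.
pose m := (Num.truncn ((8 * dg)%:R / e ^+ 2)).+1.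
have m0 : (0 < m)%N by [].
have hm : (8 * dg)%:R <= e ^+ 2 * m%:R.
  rewrite mulrC -ler_pdivrMr ?exprn_gt0 //; apply: ltW; exact: truncnS_gt.
have [om [om0 om1 roth]] := roth_lemma (R := R) m e0 e1.
pose K := ln (24 * C).
have C24 : 1 < 24 * C by lra.
have CC : (2 : R) <= 24 * C by lra.
have C24p : 0 < 24 * C by lra.
have C0 : 0 <= C by lra.
have K0 : 0 < K by rewrite ln_gt0.
pose dat := (nat * ('I_4 -> int) * ('I_3 -> 'I_4 -> int))%type.
have H' (Q0 : R) : exists t : dat, Q0 <= t.1.1%:R /\ small_hyperplane al c t.1.1 t.1.2 t.2.
  by have [q [x [b h]]] := H Q0; exists (q, x, b).
have Pq (t : dat) : small_hyperplane al c t.1.1 t.1.2 t.2 -> (0 < t.1.1)%N by case.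
have [z [r [lam [zP [lam0 rell] rl rr1 [DK1 DK2]]]]] := block_parameters e0 om0 om1 K0 dl0 m0 Pq H'.
pose ell k : R := ln (z k).1.1%:R.
have q0 k : (0 < (z k).1.1)%N by have [] := zP k.
pose rr (h : 'I_m) := r h.
have rr0 h : (0 < rr h)%N by have [] := rell h.
pose D := (\sum_h rr h)%N.
have [p [cf [[pex pidx] pC cfC cfdev Hid]]] := aux lamZ lamZ_size (lamZ_l1 R) e m rr e0 m0 hm rr0.
have K24 : (24 * C) ^+ D = expR (D%:R * K).
  by rewrite expRM_natl lnK // posrE.
have [Q [Q0 degQ iQ nQ nonv]] := nonvanish R pex pidx.
have cardI : (#|idxs (D := D) rr| <= 4 ^ D)%N by exact: card_idxs.
have nQ' : nrm Q <= expR (om * lam).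
  apply: le_trans nQ _; apply: (@le_trans _ _ (expR (D%:R * K))); last by rewrite ler_expR.
  rewrite -K24 (bigID (fun J => idxs rr J)) /= [X in _ + X]big1 ?addr0; last first.
    move=> J nJ; have [->|/pidx iJ] := eqVneq (p J) 0; first by rewrite normr0.
    by rewrite iJ in nJ.
  apply: (@le_trans _ _ (\sum_(J | idxs rr J) C ^+ D)); first by apply: ler_sum => J _; exact: pC.
  rewrite sum_pred_const exprMn; apply: ler_wpM2r; first exact: exprn_ge0.
  apply: (@le_trans _ _ ((4 ^ D)%:R)); first by rewrite ler_nat.
  by rewrite natrX; apply: lerXn2r; rewrite ?nnegrE // ler_nat.
pose pp h : int := - (z h).1.2 k0.
pose qq h := (z h).1.1.
have nidx : ~ idx (fun h => (extn 0%N rr h)%:R^-1) (fun h => (pp h)%:~R / (qq h)%:R) e Q.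
  have rrE h : (h < m)%N -> extn 0%N rr h = r h.
    by move=> hm'; have -> : h = (Ordinal hm' : nat) by []; rewrite extnE.
  apply: (roth (extn 0%N rr) pp qq lam Q) => //.
  - exact: ltW.
  - move=> h hm'; rewrite rrE //; have [r1 _] := rell h; have [r2 _] := rl h; split => //; first exact: q0.
    by have [_ _ cp _ _] := zP h; rewrite /coprimez gcdNz.
  - by move=> h k hk km; rewrite !rrE //; [exact: rr1|exact: ltn_trans km].
  - have -> : (\sum_(h < m) extn 0%N rr h = D)%N by apply: eq_bigr => h _; rewrite extnE.
    apply: (@le_trans _ _ (D%:R * K)); last exact: DK1.
    by apply: ler_wpM2l; [exact: ler0n|rewrite ler_ln ?posrE].
have [d [ds de]] := not_idx nidx.
have hd : \sum_(h < m) (d h)%:R / (rr h)%:R <= e.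
  by apply: ltW; apply: le_lt_trans ds; apply: ler_sum => h _; rewrite extnE.
have [||y [yH yne]] := nonv (fun h => (z h).1.2) d _ _ _ de.
- by move=> h; have [h1 -> _ _ _] := zP h; move: h1; case: ((z h).1.1).
- by move=> h; have [h1 -> _ _ _] := zP h; rewrite /pp rmorphN.
pose b (h : 'I_m) := (z h).2.
pose Yb (h : 'I_m) i l := Yform al (fun k => (b h i k)%:~R) l.
have uex (h : 'I_m) : exists u : 'I_3 -> R, forall k, y h k = \sum_i u i * (b h i k)%:~R.
  by have [_ _ _ sp _] := zP h; apply: sp; exact: yH.
pose u h := projT1 (cid (uex h)).
have uE h k : y h k = \sum_i u h i * (b h i k)%:~R by rewrite /u; case: (cid _).
move: yne => /negP; apply; apply/eqP.
have Hid' := derived_identity (L := Lmat al) Hid (Lmat_k3 al) d.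
rewrite -[RHS](@vanish_on_span R m D p cf (Lmat al) d b Yb Hid' _ _ u).
- by apply: eq_bigr => J _; congr (_ * _); apply: dmono_ext.
- by move=> h i k; exact: Lmat_Yform.
apply: (@le_lt_trans _ _ (\sum_(J | idxs rr J) C ^+ D * (6 ^+ D * expR (lam * m%:R * (- (dl / 8)))))).
  rewrite (bigID (fun J => idxs rr J)) /= [X in _ + X]big1 ?addr0; last first.
    move=> J nJ; have [->|/cfdev[iJ _]] := eqVneq (cf J) 0; first by rewrite normr0 mul0r.
    by rewrite iJ in nJ.
  apply: ler_sum => J _; have [->|cJ] := eqVneq (cf J) 0.
    by rewrite normr0 mul0r !mulr_ge0 ?exprn_ge0 ?expR_ge0.
  have [iJ dJ] := cfdev J cJ.
  have N0 h l : 0 <= \sum_i `|Yb h i l| by apply: sumr_ge0.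
  apply: ler_pM => //; first by apply: prodr_ge0 => h _; rewrite mulr_ge0 ?mulrn_wge0 ?exprn_ge0 ?prodr_ge0 // => k _; rewrite exprn_ge0.
  apply: le_trans (dmono_bound (c := c) (ell := fun h : 'I_m => ell h) (lam := lam) (e := e) rr0 m0 e0 (ltW lam0) _ _ _ _ iJ dJ hd) _ => //.
  - by move=> h; apply: ltW; have [] := rell h.
  - by move=> h; have [] := rl h.
  - by move=> h; have [_] := rl h; apply; apply: ltnW.
  - move=> h l; rewrite N0 /=; apply: (@le_trans _ _ (\sum_(i < 3) expR (c l * ell h))).
      by apply: ler_sum => i _; have [_ _ _ _ bd] := zP h; exact: bd.
    by rewrite sum_ord_const.
  apply: ler_wpM2l; first exact: exprn_ge0.
  rewrite ler_expR; apply: ler_wpM2l; first by rewrite mulr_ge0 // ltW.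
  exact: e3.
rewrite sum_pred_const.
apply: (@le_lt_trans _ _ ((24 * C) ^+ D * expR (lam * m%:R * (- (dl / 8))))).
  rewrite !mulrA; apply: ler_wpM2r; first exact: expR_ge0.
  have -> : 24 * C = 4 * C * 6 by ring.
  rewrite !exprMn -!mulrA; apply: ler_wpM2r; first by rewrite mulr_ge0 ?exprn_ge0.
  by rewrite -natrX ler_nat.
by rewrite K24 -expRD expR_lt1 mulrN subr_lt0.
Qed.

End Main.

(** * Integer quadratic forms with small values *)

Notation int3 := (int * int * int)%type.

Definition dot3 (p z : int3) : int := p.1.1 * z.1.1 + p.1.2 * z.1.2 + p.2 * z.2.

Definition cross3 (a b : int3) : int3 :=
  (a.1.2 * b.2 - a.2 * b.1.2, a.2 * b.1.1 - a.1.1 * b.2, a.1.1 * b.1.2 - a.1.2 * b.1.1).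

Definition det3 (a b c : int3) : int := dot3 (cross3 a b) c.

Definition comb3 (b : int3) (s : int) (c : int3) (t : int) (e : int3) : int3 :=
  (b.1.1 + s * c.1.1 + t * e.1.1, b.1.2 + s * c.1.2 + t * e.1.2, b.2 + s * c.2 + t * e.2).

Section Dim3.
Variable R : realType.
Implicit Types (z p : int3) (al A B N : R).

Definition val3 al p : R := p.1.1%:~R + p.1.2%:~R * al + p.2%:~R * al ^+ 2.

Definition err1 al z : R := al * z.1.1%:~R - z.1.2%:~R.
Definition err2 al z : R := al * z.1.2%:~R - z.2%:~R.

Definition bnd3 p N : Prop := [/\ `|p.1.1%:~R : R| <= N, `|p.1.2%:~R : R| <= N & `|p.2%:~R : R| <= N].

(** A descent by steps of at least d must stop. A minimum up to d is enough for the reduction theory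
    below. *)
Lemma approx_min (X : Type) (f : X -> R) (P : X -> Prop) (d : R) :
  0 < d -> (forall x, 0 <= f x) -> forall x, P x ->
  exists y, P y /\ forall y', P y' -> f y - d < f y'.
Proof.
move=> d0 f0 x; have [n hn] : exists n : nat, f x < n%:R * d.
  exists (Num.truncn (f x / d)).+1; rewrite -ltr_pdivrMr //; exact: truncnS_gt.
elim: n x hn => [|n IH] x hn Px; first by have := f0 x; rewrite mul0r in hn; lra.
case: (pselect (forall y', P y' -> f x - d < f y')) => [h|]; first by exists x.
move=> /existsNP[y] /not_implyP[Py /negP]; rewrite -leNgt => hy; apply: (IH y) => //.
by rewrite -natr1 mulrDl mul1r in hn; lra.
Qed.

(** A ternary form that is reduced up to d has diagonal product at most 8 times its determinant. If
    x y w >= 0, each subtracted term is at most 26/100 of a b c. Otherwise suitable signs s and t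
    make all three mixed terms negative, which bounds |x| + |y| + |w|. *)
Lemma gram_sorted (a b c x y w d : R) :
  0 < a -> 1000 * d <= a -> 0 < d -> a <= b -> b <= c ->
  2 * `|x| <= a + d -> 2 * `|y| <= a + d -> 2 * `|w| <= b + d ->
  (forall s t : R, (s = 1 \/ s = -1) -> (t = 1 \/ t = -1) ->
     - d <= a + b + 2 * s * y + 2 * t * w + 2 * (s * t) * x) ->
  a * b * c <= 8 * (a * b * c + 2 * x * y * w - a * w ^+ 2 - b * y ^+ 2 - c * x ^+ 2).
Proof.
move=> a0 da d0 ab bc hx hy hw hs.
have b0 : 0 < b by lra.
have c0 : 0 < c by lra.
pose X : R := `|x|; pose Y : R := `|y|; pose W : R := `|w|.
rewrite -/X in hx; rewrite -/Y in hy; rewrite -/W in hw.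
have X0 : 0 <= X by exact: normr_ge0.
have Y0 : 0 <= Y by exact: normr_ge0.
have W0 : 0 <= W by exact: normr_ge0.
have xX : x ^+ 2 = X ^+ 2 by rewrite real_normK // num_real.
have yY : y ^+ 2 = Y ^+ 2 by rewrite real_normK // num_real.
have wW : w ^+ 2 = W ^+ 2 by rewrite real_normK // num_real.
have alt : 0 <= x * y * w \/ (x * y * w = - (X * Y * W) /\ X + Y + W <= (a + b + d) / 2).
  have h1 : (1 : R) = 1 \/ (1 : R) = -1 by left.
  have h2 : (-1 : R) = 1 \/ (-1 : R) = -1 by right.
  have H1 := hs 1 1 h1 h1; have H2 := hs 1 (-1) h1 h2.
  have H3 := hs (-1) 1 h2 h1; have H4 := hs (-1) (-1) h2 h2.
  rewrite /X /Y /W.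
  case: (ger0P x) => sx; case: (ger0P y) => sy; case: (ger0P w) => sw.
  - by left; rewrite !mulr_ge0.
  - by right; split; [ring|lra].
  - by right; split; [ring|lra].
  - by left; rewrite -mulrA mulr_ge0 // mulr_le0 // ltW.
  - by right; split; [ring|lra].
  - by left; rewrite mulrAC mulr_ge0 // mulr_le0 // ltW.
  - by left; rewrite mulr_ge0 // mulr_le0 // ltW.
  - by right; split; [ring|lra].
rewrite xX yY wW.
have hX : X <= 501 / 1000 * a by lra.
have hY : Y <= 501 / 1000 * a by lra.
have hW : W <= 501 / 1000 * b by lra.
have sq (u v : R) : 0 <= u -> 0 <= v -> u <= 501 / 1000 * v -> u ^+ 2 <= 26 / 100 * v ^+ 2.
  move=> u0 v0 uv; have : u ^+ 2 <= (501 / 1000 * v) ^+ 2.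
    by rewrite lerXn2r ?nnegrE //; clear - v0; lra.
  by rewrite exprMn; have := sqr_ge0 v; clear; lra.
have X2 := sq _ _ X0 (ltW a0) hX; have Y2 := sq _ _ Y0 (ltW a0) hY.
have W2 := sq _ _ W0 (ltW b0) hW.
have aa : a ^+ 2 <= a * b by rewrite expr2 ler_pM2l.
have bb : b ^+ 2 <= b * c by rewrite expr2 ler_pM2l.
have ac : a ^+ 2 <= a * c by rewrite expr2 ler_pM2l // (le_trans ab).
have abc0 : 0 <= a * b * c by rewrite !mulr_ge0 // ltW.
case: alt => [h|[h hS]].
  have i1 : a * W ^+ 2 <= 26 / 100 * (a * b * c).
    have : a * W ^+ 2 <= a * (26 / 100 * (b * c)) by rewrite ler_pM2l //; clear - X2 Y2 W2 aa ac bb; lra.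
    by move=> h1; apply: le_trans h1 _; rewrite le_eqVlt; apply/orP; left; apply/eqP; ring.
  have i2 : b * Y ^+ 2 <= 26 / 100 * (a * b * c).
    have : b * Y ^+ 2 <= b * (26 / 100 * (a * c)) by rewrite ler_pM2l //; clear - X2 Y2 W2 aa ac bb; lra.
    by move=> h1; apply: le_trans h1 _; rewrite le_eqVlt; apply/orP; left; apply/eqP; ring.
  have i3 : c * X ^+ 2 <= 26 / 100 * (a * b * c).
    have : c * X ^+ 2 <= c * (26 / 100 * (a * b)) by rewrite ler_pM2l //; clear - X2 Y2 W2 aa ac bb; lra.
    by move=> h1; apply: le_trans h1 _; rewrite le_eqVlt; apply/orP; left; apply/eqP; ring.
  have -> : 2 * x * y * w = 2 * (x * y * w) by ring.
  by clear - h i1 i2 i3 abc0; lra.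
have -> : 2 * x * y * w = 2 * (x * y * w) by ring.
rewrite h.
have ab0 : 0 <= a * b by rewrite mulr_ge0 // ltW.
have j1 : 0 <= (7 / 8 * (a * b) - X ^+ 2) * (c - b).
  by rewrite mulr_ge0 //; [clear - X2 aa ab0; lra|rewrite subr_ge0].
have j2 : X ^+ 2 <= 501 / 1000 * a * X by rewrite expr2 ler_wpM2r.
have j3 : Y ^+ 2 <= 501 / 1000 * a * Y by rewrite expr2 ler_wpM2r.
have j4 : 2 * (X * Y) <= 501 / 1000 * a * (X + Y).
  have : 0 <= X * (501 / 1000 * a - Y) + Y * (501 / 1000 * a - X).
    by rewrite addr_ge0 // mulr_ge0 // subr_ge0.
  by clear; lra.
have j5 : b * (X ^+ 2 + Y ^+ 2) <= b * (501 / 1000 * a * (X + Y)).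
  by rewrite ler_pM2l //; clear - j2 j3; lra.
have j6 : 2 * (X * Y) * W <= 501 / 1000 * a * (X + Y) * W by rewrite ler_wpM2r.
have SW : X + Y <= 10005 / 10000 * b - W by clear - hS da ab; lra.
have j7 : (b + W) * (X + Y) <= (b + W) * (10005 / 10000 * b - W).
  by rewrite ler_wpM2l // addr_ge0 // ltW.
have j8 : 501 / 1000 * ((b + W) * (X + Y)) + W ^+ 2 <= 7 / 8 * b ^+ 2.
  have WB : W * b <= 501 / 1000 * b ^+ 2 by rewrite expr2 mulrA ler_pM2r.
  have := sqr_ge0 b; clear - j7 W2 WB; lra.
have j9 : a * (501 / 1000 * ((b + W) * (X + Y)) + W ^+ 2) <= a * (7 / 8 * b ^+ 2) by rewrite ler_pM2l.
clear - j1 j5 j6 j9; lra.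
Qed.

(** The hypothesis says that adding s b_j + t b_k to the basis vector b_i does not shorten its
    square by more than d. Taking t = 0 bounds the entries off the diagonal. *)
Lemma gram_bound (g : 'I_3 -> 'I_3 -> R) (d : R) :
  (forall i j, g i j = g j i) -> (forall i, 1000 * d <= g i i) -> 0 < d ->
  (forall i j k, i != j -> i != k -> j != k -> forall s t : R, (s = 1 \/ s = -1) -> (t = 1 \/ t = -1 \/ t = 0) ->
     - d <= g j j * s ^+ 2 + g k k * t ^+ 2 + 2 * s * g i j + 2 * t * g i k + 2 * (s * t) * g j k) ->
  forall i j k, i != j -> i != k -> j != k -> 
  g i i * g j j * g k k <= 8 * (g i i * g j j * g k k + 2 * g i j * g i k * g j k - g i i * g j k ^+ 2
     - g j j * g i k ^+ 2 - g k k * g i j ^+ 2).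
Proof.
move=> gC gd d0 hs.
have o1 : (1 : R) = 1 \/ (1 : R) = -1 by left.
have o2 : (-1 : R) = 1 \/ (-1 : R) = -1 by right.
have o0 : (0 : R) = 1 \/ (0 : R) = -1 \/ (0 : R) = 0 by right; right.
have key i j k : i != j -> i != k -> j != k -> g i i <= g j j -> g j j <= g k k ->
  g i i * g j j * g k k <= 8 * (g i i * g j j * g k k + 2 * g i j * g i k * g j k - g i i * g j k ^+ 2
     - g j j * g i k ^+ 2 - g k k * g i j ^+ 2).
  move=> ij ik jk h1 h2.
  have pr u v w : u != v -> u != w -> v != w -> 2 * `|g u v| <= g v v + d.
    move=> uv uw vw; have := hs u v w uv uw vw 1 0 o1 o0; have := hs u v w uv uw vw (-1) 0 o2 o0.
    by case: (ger0P (g u v)) => s; lra.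
  have ji : j != i by rewrite eq_sym.
  have ki : k != i by rewrite eq_sym.
  have kj : k != j by rewrite eq_sym.
  apply: (@gram_sorted _ _ _ _ _ _ d) => //.
  - by have := gd i; lra.
  - by rewrite gC; apply: (pr j i k).
  - by rewrite gC; apply: (pr k i j).
  - by rewrite gC; apply: (pr k j i).
  - move=> s t hs' ht'.
    have ht : t = 1 \/ t = -1 \/ t = 0 by case: ht'; tauto.
    have := hs k i j ki kj ij s t hs' ht; rewrite (gC k i) (gC k j).
    have -> : s ^+ 2 = 1 by case: hs' => ->; rewrite ?sqrrN expr1n.
    have -> : t ^+ 2 = 1 by case: ht' => ->; rewrite ?sqrrN expr1n.
    by lra.
move=> i j k ij ik jk.
have ji : j != i by rewrite eq_sym.
have ki : k != i by rewrite eq_sym.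
have kj : k != j by rewrite eq_sym.
case: (lerP (g i i) (g j j)) => [h1|/ltW h1]; case: (lerP (g j j) (g k k)) => [h2|/ltW h2];
  case: (lerP (g i i) (g k k)) => [h3|/ltW h3].
- exact: key.
- by have := key i j k ij ik jk h1 h2.
- by have := key i k j ik ij kj h3 h2; rewrite (gC k j); lra.
- by have := key k i j ki kj ij h3 h1; rewrite (gC k j) (gC k i); lra.
- by have := key j i k ji jk ik h1 h3; rewrite (gC j i); lra.
- by have := key j k i jk ji ki h2 h3; rewrite (gC j i) (gC k i); lra.
- by have := key k j i kj ki ji h2 h1; rewrite (gC k j) (gC k i) (gC j i); lra.
- by have := key k j i kj ki ji h2 h1; rewrite (gC k j) (gC k i) (gC j i); lra.
Qed.

Lemma norm_le_sqr (x y : R) : 0 <= y -> x ^+ 2 <= y ^+ 2 -> `|x| <= y.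
Proof. by move=> y0 h; rewrite -ler_sqr ?nnegrE // real_normK // num_real. Qed.

Definition i0 : 'I_3 := @Ordinal 3 0 isT.
Definition i1 : 'I_3 := @Ordinal 3 1 isT.
Definition i2 : 'I_3 := @Ordinal 3 2 isT.

Lemma ord3P (i : 'I_3) : [\/ i = i0, i = i1 | i = i2].
Proof.
by case: i => [[|[|[|//]]]] h; [constructor 1|constructor 2|constructor 3]; apply: val_inj.
Qed.

Lemma big3 (f : 'I_3 -> R) : \sum_i f i = f i0 + f i1 + f i2.
Proof.
by rewrite !big_ord_recl big_ord0 addr0 addrA; congr (f _ + f _ + f _); apply: val_inj.
Qed.

(** A scalar product whose unit ball lies in the box with sides A, B, B; Gram determinants of three
    vectors are det3^2 / (A^2 B^4). *)
Definition ip3 al A B (z z' : int3) : R :=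
  A^-1 ^+ 2 * (z.1.1%:~R * z'.1.1%:~R) +
  B^-1 ^+ 2 * (err1 al z * err1 al z' + err2 al z * err2 al z').

Lemma ip3C al A B z z' : ip3 al A B z z' = ip3 al A B z' z.
Proof. by rewrite /ip3; ring. Qed.

Lemma ip3_comb al A B b s c t e :
  ip3 al A B (comb3 b s c t e) (comb3 b s c t e) =
  ip3 al A B b b + (ip3 al A B c c * s%:~R ^+ 2 + ip3 al A B e e * t%:~R ^+ 2
   + 2 * s%:~R * ip3 al A B b c + 2 * t%:~R * ip3 al A B b e + 2 * (s%:~R * t%:~R) * ip3 al A B c e).
Proof. by rewrite /ip3 /err1 /err2 /comb3 /= !rmorphD !rmorphM /=; ring. Qed.

Lemma ip3_gram al A B a b c : A != 0 -> B != 0 ->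
  A ^+ 2 * B ^+ 4 * (ip3 al A B a a * ip3 al A B b b * ip3 al A B c c
   + 2 * ip3 al A B a b * ip3 al A B a c * ip3 al A B b c
   - ip3 al A B a a * ip3 al A B b c ^+ 2 - ip3 al A B b b * ip3 al A B a c ^+ 2
   - ip3 al A B c c * ip3 al A B a b ^+ 2) = (det3 a b c)%:~R ^+ 2.
Proof.
move=> A0 B0; set n := A ^+ 2 * B ^+ 4.
have -> : (det3 a b c)%:~R =
   (a.1.2%:~R * b.2%:~R - a.2%:~R * b.1.2%:~R) * c.1.1%:~R +
   (a.2%:~R * b.1.1%:~R - a.1.1%:~R * b.2%:~R) * c.1.2%:~R +
   (a.1.1%:~R * b.1.2%:~R - a.1.2%:~R * b.1.1%:~R) * c.2%:~R :> R.
  by rewrite /det3 /dot3 /cross3 /= !rmorphD !rmorphM !rmorphB !rmorphM.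
pose f0 z := A^-1 * z.1.1%:~R; pose f1 z := B^-1 * err1 al z; pose f2 z := B^-1 * err2 al z.
have fE z z' : ip3 al A B z z' = f0 z * f0 z' + f1 z * f1 z' + f2 z * f2 z'.
  by rewrite /ip3 /f0 /f1 /f2; ring.
have G (x0 x1 x2 y0 y1 y2 w0 w1 w2 : R) :
  let dt u0 u1 u2 v0 v1 v2 := u0 * v0 + u1 * v1 + u2 * v2 in
  dt x0 x1 x2 x0 x1 x2 * dt y0 y1 y2 y0 y1 y2 * dt w0 w1 w2 w0 w1 w2
  + 2 * dt x0 x1 x2 y0 y1 y2 * dt x0 x1 x2 w0 w1 w2 * dt y0 y1 y2 w0 w1 w2
  - dt x0 x1 x2 x0 x1 x2 * dt y0 y1 y2 w0 w1 w2 ^+ 2 - dt y0 y1 y2 y0 y1 y2 * dt x0 x1 x2 w0 w1 w2 ^+ 2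
  - dt w0 w1 w2 w0 w1 w2 * dt x0 x1 x2 y0 y1 y2 ^+ 2 =
  ((x1 * y2 - x2 * y1) * w0 + (x2 * y0 - x0 * y2) * w1 + (x0 * y1 - x1 * y0) * w2) ^+ 2.
  by rewrite /=; ring.
rewrite !fE G.
have -> : n = (A * B ^+ 2) ^+ 2 by rewrite /n exprMn -exprM.
rewrite -exprMn /f0 /f1 /f2 /err1 /err2; congr (_ ^+ 2).
by field; rewrite A0 B0.
Qed.

(** Lagrange's identity for this scalar product: the dual length of the cross product is the Gram
    determinant of a and b. *)
Lemma ip3_cross al A B a b : A != 0 -> B != 0 ->
  (A * val3 al (cross3 a b)) ^+ 2 + (B * ((cross3 a b).1.2%:~R + al * (cross3 a b).2%:~R)) ^+ 2
  + (B * (cross3 a b).2%:~R) ^+ 2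
  = A ^+ 2 * B ^+ 4 * (ip3 al A B a a * ip3 al A B b b - ip3 al A B a b ^+ 2).
Proof.
move=> A0 B0; rewrite /ip3 /err1 /err2 /val3 /cross3 /= !(rmorphD, rmorphM, rmorphN) /=.
by field; rewrite A0 B0.
Qed.

Lemma intr_sqr_ge1 (n : int) : n != 0 -> 1 <= (n%:~R : R) ^+ 2.
Proof. by move=> n0; rewrite -rmorphXn /= -[1]/(1%:~R) ler_int; lia. Qed.

Lemma ip3_lower al A B z : 1 <= A -> 0 < B -> B <= 1 -> z != (0, 0, 0) ->
  A^-1 ^+ 2 <= ip3 al A B z z.
Proof.
move=> A1 B0 B1 z0; have iA0 : 0 < A^-1 by rewrite invr_gt0; lra.
have iA : A^-1 ^+ 2 <= 1 by apply: exprn_ile1; [exact: ltW|rewrite invf_le1 //; lra].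
have iB : 1 <= B^-1 ^+ 2 by rewrite exprn_ege1 // invf_ge1.
have iA2 : 0 <= A^-1 ^+ 2 by exact: sqr_ge0.
rewrite /ip3 -!expr2; set u := _ ^+ 2 + _ ^+ 2.
have [z00|z00] := eqVneq z.1.1 0; last first.
  have h : 0 <= B^-1 ^+ 2 * u by rewrite mulr_ge0 ?sqr_ge0 // /u addr_ge0 ?sqr_ge0.
  have := ler_wpM2l iA2 (intr_sqr_ge1 z00); lra.
have u1 : 1 <= u.
  rewrite /u /err1 /err2 z00 mulr0 sub0r sqrrN.
  have [z10|/intr_sqr_ge1 z10] := eqVneq z.1.2 0; last by have := sqr_ge0 (al * z.1.2%:~R - z.2%:~R : R); lra.
  rewrite z10 mulr0 sub0r sqrrN; have : z.2 != 0.
    by apply: contraNneq z0 => z2; move: z00 z10 z2; case: (z) => [[x y] w] /= -> -> ->.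
  by move=> /intr_sqr_ge1; have := sqr_ge0 (0 : R); lra.
rewrite z00 expr0n mulr0 add0r.
have : B^-1 ^+ 2 * 1 <= B^-1 ^+ 2 * u by rewrite ler_wpM2l // sqr_ge0.
lra.
Qed.

Definition in_box al A B z : Prop :=
  [/\ `|z.1.1%:~R : R| <= A, `|err1 al z| <= B & `|err2 al z| <= B].

Lemma ip3_box al A B z : 0 < A -> 0 < B -> ip3 al A B z z <= 1 -> in_box al A B z.
Proof.
move=> A0 B0; rewrite /ip3 -!expr2 mulrDr -!exprMn.
have := sqr_ge0 (A^-1 * z.1.1%:~R : R); have := sqr_ge0 (B^-1 * err1 al z).
have := sqr_ge0 (B^-1 * err2 al z); set x := _ ^+ 2; set y := _ ^+ 2; set w := _ ^+ 2 => hx hy hw h.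
have aux (c v : R) : 0 < c -> (c^-1 * v) ^+ 2 <= 1 -> `|v| <= c.
  move=> c0; rewrite -[leRHS](expr1n _ 2) => /(norm_le_sqr ler01).
  by rewrite normrM gtr0_norm ?invr_gt0 // mulrC ler_pdivrMr // mul1r.
by split; apply: aux => //; rewrite -?/x -?/y -?/w; lra.
Qed.

(** Take a nearly reduced basis. If one vector has square greater than 1, the squares of the other
    two have product at most 8 / (A^2 B^4), so their cross product p is small in the dual metric,
    with 9 >= 8 giving the constants 3. It is primitive because the basis is unimodular. *)
Lemma box_or_form al A B : 0 < al -> al < 1 -> 1 <= A -> 0 < B -> B <= 1 ->
  (exists b : 'I_3 -> int3, (det3 (b i0) (b i1) (b i2)) ^+ 2 = 1 /\ forall i, in_box al A B (b i))
  \/ exists p u, [/\ dot3 p u = 1, bnd3 p (12 / B) & `|val3 al p| <= 3 / A].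
Proof.
move=> al0 al1 A1 B0 B1.
have A0 : 0 < A by lra.
have iA0 : 0 < A^-1 by rewrite invr_gt0.
(* A thousandth of the lower bound of [ip3_lower] for the square of a nonzero vector. *)
pose d := A^-1 ^+ 2 / 1000.
have d0 : 0 < d by rewrite divr_gt0 // exprn_gt0.
pose f (b : 'I_3 -> int3) := \sum_i ip3 al A B (b i) (b i).
have ip0 z : 0 <= ip3 al A B z z.
  by rewrite /ip3 -!expr2 addr_ge0 // mulr_ge0 ?sqr_ge0 // addr_ge0 ?sqr_ge0.
pose st (i : 'I_3) : int3 := ((i == i0)%:Z, (i == i1)%:Z, (i == i2)%:Z).
have [] := @approx_min _ f (fun b => (det3 (b i0) (b i1) (b i2)) ^+ 2 = 1) d d0 _ st.
- by move=> b; apply: sumr_ge0.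
- by [].
move=> b [db bmin].
have det_perm i j k : i != j -> i != k -> j != k -> (det3 (b j) (b k) (b i)) ^+ 2 = 1.
  have E1 x y z : det3 x y z = det3 y z x by rewrite /det3 /dot3 /cross3 /=; ring.
  have E2 x y z : det3 x y z = - det3 y x z by rewrite /det3 /dot3 /cross3 /=; ring.
  case: (ord3P i) => ->; case: (ord3P j) => ->; case: (ord3P k) => -> // _ _ _; rewrite -db.
  - by rewrite [in RHS]E1.
  - by rewrite E2 sqrrN [in RHS]E1.
  - by rewrite E2 sqrrN E1.
  - by rewrite E1.
  - by rewrite E2 sqrrN.
pose g i j := ip3 al A B (b i) (b j).
have bn0 i : b i != (0, 0, 0).
  apply/eqP => bi; have [j [k [ij ik jk]]] : exists j k, [/\ i != j, i != k & j != k].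
    by case: (ord3P i) => ->; [exists i1, i2|exists i0, i2|exists i0, i1].
  have := det_perm i j k ij ik jk; by rewrite /det3 /dot3 bi /= !mulr0 !addr0 expr0n.
have gmin i j k : i != j -> i != k -> j != k -> forall s t : int,
   - d <= g j j * s%:~R ^+ 2 + g k k * t%:~R ^+ 2 + 2 * s%:~R * g i j + 2 * t%:~R * g i k + 2 * (s%:~R * t%:~R) * g j k.
  move=> ij ik jk s t.
  pose b' l := if l == i then comb3 (b i) s (b j) t (b k) else b l.
  have E x y z : det3 y z (comb3 x s y t z) = det3 y z x by rewrite /det3 /dot3 /cross3 /comb3 /=; ring.
  have E' x y z : det3 z y (comb3 x s y t z) = det3 z y x by rewrite /det3 /dot3 /cross3 /comb3 /=; ring.
  have E1 x y z : det3 x y z = det3 y z x by rewrite /det3 /dot3 /cross3 /=; ring.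
  have db' : det3 (b' i0) (b' i1) (b' i2) ^+ 2 = 1.
    rewrite -db /b'; move: ij ik jk.
    case: (ord3P i) => ->; case: (ord3P j) => ->; case: (ord3P k) => -> //= _ _ _.
    - by rewrite E1 E -E1.
    - by rewrite E1 E' -E1.
    - by rewrite -E1 E' E1.
    - by rewrite -E1 E E1.
    - by rewrite E.
    - by rewrite E'.
  have := bmin b' db'.
  have -> : f b' = f b + (g j j * s%:~R ^+ 2 + g k k * t%:~R ^+ 2 + 2 * s%:~R * g i j + 2 * t%:~R * g i k + 2 * (s%:~R * t%:~R) * g j k).
    rewrite /f (bigD1 i) //= [in RHS](bigD1 i) //= {1 2}/b' eqxx ip3_comb addrAC; congr (_ + _ + _).
    by apply: eq_bigr => l /negbTE li; rewrite /b' li.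
  by lra.
have gd i : 1000 * d <= g i i.
  by apply: le_trans (ip3_lower al A1 B0 B1 (bn0 i)); rewrite /d; lra.
have gs i j k : i != j -> i != k -> j != k -> forall s t : R, (s = 1 \/ s = -1) -> (t = 1 \/ t = -1 \/ t = 0) ->
     - d <= g j j * s ^+ 2 + g k k * t ^+ 2 + 2 * s * g i j + 2 * t * g i k + 2 * (s * t) * g j k.
  move=> ij ik jk s t hs ht.
  have [s' ->] : exists s' : int, s = s'%:~R by case: hs => ->; [exists 1|exists (-1)].
  have [t' ->] : exists t' : int, t = t'%:~R by case: ht => [->|[->|->]]; [exists 1|exists (-1)|exists 0].
  exact: gmin.
have gb := gram_bound (g := g) (d := d) (fun i j => ip3C _ _ _ _ _) gd d0 gs.
case: (pselect (forall i, g i i <= 1)) => [h|/existsNP[i /negP]].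
  by left; exists b; split => // i; apply: ip3_box => //; exact: h.
rewrite -ltNge => gi; right.
have [j [k [ij ik jk]]] : exists j k, [/\ i != j, i != k & j != k].
  by case: (ord3P i) => ->; [exists i1, i2|exists i0, i2|exists i0, i1].
have AB0 : 0 < A ^+ 2 * B ^+ 4 by rewrite mulr_gt0 ?exprn_gt0.
have An0 : A != 0 by rewrite lt0r_neq0.
have Bn0 : B != 0 by rewrite lt0r_neq0.
have D1 := det_perm i j k ij ik jk.
have gjk : A ^+ 2 * B ^+ 4 * (g j j * g k k) <= 8.
  have := ler_wpM2l (ltW AB0) (gb i j k ij ik jk).
  rewrite [leRHS]mulrCA ip3_gram //.
  have -> : (det3 (b i) (b j) (b k))%:~R ^+ 2 = 1 :> R.
    have -> : det3 (b i) (b j) (b k) = det3 (b j) (b k) (b i) by rewrite /det3 /dot3 /cross3 /=; ring.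
    by rewrite -rmorphXn /= D1.
  rewrite mulr1 => h; apply: le_trans h; rewrite ler_pM2l // -mulrA ler_peMl ?mulr_ge0 ?ip0 // ltW //.
pose p := cross3 (b j) (b k).
exists p, (det3 (b j) (b k) (b i) * (b i).1.1, det3 (b j) (b k) (b i) * (b i).1.2, det3 (b j) (b k) (b i) * (b i).2).
have := ip3_cross al (b j) (b k) An0 Bn0; rewrite -/p -/(g j j) -/(g k k) -/(g j k) => E.
have h9 : (A * val3 al p) ^+ 2 + (B * (p.1.2%:~R + al * p.2%:~R)) ^+ 2 + (B * p.2%:~R) ^+ 2 <= 3 ^+ 2.
  rewrite E mulrBr; have : 0 <= A ^+ 2 * B ^+ 4 * g j k ^+ 2 by rewrite mulr_ge0 ?sqr_ge0 // ltW.
  lra.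
have le3 (c v : R) : 0 < c -> (c * v) ^+ 2 <= 3 ^+ 2 -> `|v| <= 3 / c.
  move=> c0 /(norm_le_sqr (ler0n _ 3)).
  by rewrite normrM gtr0_norm // ler_pdivlMr // mulrC.
have s1 := sqr_ge0 (A * val3 al p); have s2 := sqr_ge0 (B * (p.1.2%:~R + al * p.2%:~R)).
have s3 := sqr_ge0 (B * p.2%:~R).
have v1 : `|val3 al p| <= 3 / A by apply: le3 => //; lra.
have v2 : `|p.1.2%:~R + al * p.2%:~R| <= 3 / B by apply: le3 => //; lra.
have v3 : `|p.2%:~R : R| <= 3 / B by apply: le3 => //; lra.
have iB : 1 <= B^-1 by rewrite invf_ge1.
have iA : A^-1 <= 1 by rewrite invf_le1.
have al2 : `|al * p.2%:~R| <= 3 / B.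
  by rewrite normrM gtr0_norm //; apply: le_trans v3; rewrite ler_piMl // ltW.
have v12 : `|p.1.2%:~R : R| <= 6 / B.
  have -> : p.1.2%:~R = (p.1.2%:~R + al * p.2%:~R) - al * p.2%:~R :> R by ring.
  by apply: le_trans (ler_normB _ _) _; lra.
split => //.
- rewrite -[RHS]D1 /det3 /dot3 /=; ring.
- split; [|clear - v12 iB; lra|clear - v3 iB; lra].
  have -> : p.1.1%:~R = val3 al p - al * (p.1.2%:~R + al * p.2%:~R) :> R by rewrite /val3; ring.
  apply: le_trans (ler_normB _ _) _; rewrite normrM gtr0_norm //.
  have : al * `|p.1.2%:~R + al * p.2%:~R| <= `|p.1.2%:~R + al * p.2%:~R| by rewrite ler_piMl // ltW.
  lra.
Qed.

End Dim3.

(** * Liouville's inequality for quadratic polynomials *)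

Section Liouville.
Variable R : realType.

Lemma det_norm_le l (M : 'M[R]_l) (B : R) : 0 <= B -> (forall i j, `|M i j| <= B) ->
  `|\det M| <= (l`!)%:R * B ^+ l.
Proof. exact: (@nrm_det R 0). Qed.

(** Row i of an integer matrix expresses val3 al p * c^(i+2) * al^i, with c the leading coefficient
    of F, on 1, ..., al^(d-1). Minimality of d makes its determinant nonzero. The adjugate writes
    this determinant as val3 al p times a combination of minors of order d - 1, each of size
    O(N^(d-1)). *)
Lemma liouville3 (al : R) (F : {poly int}) d : size F = d.+1 -> (0 < d)%N ->
  root (map_poly intr F) al ->
  (forall G : {poly int}, G != 0 -> root (map_poly intr G) al -> (d < size G)%N) ->
  exists C : R, 0 < C /\ forall (p : int3) N, bnd3 p N -> val3 al p != 0 ->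
    1 <= C * N ^+ d.-1 * `|val3 al p|.
Proof.
move=> sF d0 rt Fmin.
have [B [B0 [a aP]]] := power_reduction sF d0 rt.
set c := lead_coef F in aP.
have c0 : c != 0 by rewrite /c lead_coef_eq0 -size_poly_gt0 sF.
case: d d0 sF Fmin a aP => // d _ sF Fmin a aP.
pose K : R := 3 * B%:R ^+ (d + 8).
have B1 : 1 <= B%:R :> R by rewrite ler1n.
have K0 : 0 < K by rewrite mulr_gt0 ?exprn_gt0 ?ltr0n.
have cB : `|c%:~R : R| <= B%:R.
  by have [_ _ h] := aP 0%N; rewrite -intr_norm -natr_absz ler_nat.
have aB k j : `|(a k j)%:~R : R| <= B%:R ^+ k.
  by have [_ h _] := aP k; rewrite -intr_norm -natr_absz -natrX ler_nat.
pose S : R := \sum_(j < d.+1) `|c%:~R ^+ (j + 2) * al ^+ j|.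
have S0 : 0 <= S by apply: sumr_ge0.
exists ((d`!)%:R * K ^+ d * S + 1); split.
  by rewrite ltr_wpDl // !mulr_ge0 // exprn_ge0 // ltW.
move=> p N [b0 b1 b2] v0 /=.
have N0 : 0 <= N by apply: le_trans b0; exact: normr_ge0.
pose mt (t : nat) : int := if t is 0 then p.1.1 else if t is 1 then p.1.2 else p.2.
have mtN t : `|(mt t)%:~R : R| <= N by rewrite /mt; case: t => [|[]].
pose M : 'M[int]_d.+1 := \matrix_(i, j) \sum_(t < 3) mt t * c ^+ (2 - t) * a (i + t)%N j.
pose MR : 'M[R]_d.+1 := map_mx intr M.
pose v : 'cV[R]_d.+1 := \col_j al ^+ j.
pose Dv : 'cV[R]_d.+1 := \col_j (c%:~R ^+ (j + 2) * al ^+ j).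
have MvE : MR *m v = val3 al p *: Dv.
  apply/colP => i; rewrite !mxE.
  under eq_bigr do rewrite !mxE rmorph_sum /= mulr_suml.
  rewrite exchange_big /=.
  transitivity (\sum_(t < 3) (mt t)%:~R * c%:~R ^+ (2 - t) * (c%:~R ^+ (i + t) * al ^+ (i + t)) : R).
    apply: eq_bigr => t _; have [-> _ _] := aP (i + t)%N; rewrite mulr_sumr.
    by apply: eq_bigr => j _; rewrite !rmorphM rmorphXn /= -!mulrA.
  rewrite !big_ord_recr big_ord0 /= /val3 !exprD; ring.
have nM i j : `|MR i j| <= K * N.
  rewrite !mxE rmorph_sum /=; apply: le_trans (ler_norm_sum _ _ _) _.
  apply: (@le_trans _ _ (\sum_(t < 3) (N * B%:R ^+ (d + 8)))); last first.
    by rewrite !big_ord_recr big_ord0 /= /K; lra.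
  apply: ler_sum => t _; rewrite !rmorphM rmorphXn /= !normrM normrX -mulrA.
  apply: ler_pM => //; first by rewrite mulr_ge0 ?exprn_ge0.
  apply: (@le_trans _ _ (B%:R ^+ (2 - t) * B%:R ^+ (i + t))).
    by apply: ler_pM => //; rewrite ?exprn_ge0 // lerXn2r ?nnegrE.
  by rewrite -exprD ler_weXn2l //; have := ltn_ord i; have := ltn_ord t; clear; lia.
have dM : \det M != 0.
  apply/negP => /det0P[w w0 wM].
  pose G : {poly int} := \poly_(i < d.+1) (w 0 (inord i) * c ^+ (i + 2)).
  have wMR : \sum_i (w 0 i)%:~R * c%:~R ^+ (i + 2) * al ^+ i = 0 :> R.
    have : (map_mx intr w *m MR *m v) 0 0 = 0.
      by rewrite -map_mxM wM !mxE big1 // => j _; rewrite !mxE mul0r.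
    rewrite -mulmxA MvE -scalemxAr !mxE => /eqP; rewrite mulf_eq0 (negbTE v0) /= => /eqP.
    by move=> h; rewrite -[RHS]h; apply: eq_bigr => i _; rewrite !mxE mulrA.
  have Gc (i : 'I_d.+1) : G`_i = w 0 i * c ^+ (i + 2) by rewrite coef_poly ltn_ord inord_val.
  have G0 : G != 0.
    apply: contraNneq w0 => G0; apply/eqP/rowP => i; rewrite mxE; have := Gc i.
    by rewrite G0 coef0 => /esym/eqP; rewrite mulf_eq0 expf_eq0 (negbTE c0) andbF orbF => /eqP.
  suff rG : root (map_poly intr G) al by have := Fmin G G0 rG; rewrite ltnNge size_poly.
  apply/rootP; rewrite (@horner_coef_wide _ d.+1); last first.
    by apply: leq_trans (size_poly _ _) _; exact: size_poly.
  rewrite -[RHS]wMR; apply: eq_bigr => i _.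
  by rewrite coef_map /= Gc rmorphM rmorphXn.
have dM1 : 1 <= `|\det MR|.
  rewrite det_map_mx -intr_norm -[1]/(1%:~R) ler_int.
  by move: dM; move: (\det M); clear; lia.
have E : \det MR = val3 al p * \sum_j (\adj MR) 0 j * (c%:~R ^+ (j + 2) * al ^+ j).
  have : (\adj MR *m (MR *m v)) 0 0 = \det MR.
    by rewrite mulmxA mul_adj_mx mul_scalar_mx !mxE expr0 mulr1.
  rewrite MvE -scalemxAr !mxE => <-; congr (_ * _); apply: eq_bigr => j _; by rewrite !mxE.
apply: le_trans dM1 _; rewrite E normrM mulrC; apply: ler_wpM2r => //.
apply: le_trans (ler_norm_sum _ _ _) _.
apply: (@le_trans _ _ ((d`!)%:R * (K * N) ^+ d * S)); last first.
  by rewrite exprMn mulrDl mul1r -!mulrA [S * _]mulrC lerDl exprn_ge0.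
rewrite /S mulr_sumr; apply: ler_sum => j _; rewrite normrM; apply: ler_wpM2r => //.
rewrite mxE /cofactor normrM normrX normrN1 expr1n mul1r.
apply: det_norm_le; first by rewrite mulr_ge0 // ltW.
by move=> i k; rewrite !mxE; have := nM (lift j i) (lift 0 k); rewrite !mxE.
Qed.

End Liouville.

(** * Parallel integer vectors and points on a conic *)

Section Par.

Lemma cross3_self p : cross3 p p = (0, 0, 0).
Proof. by rewrite /cross3; congr (_, _, _); ring. Qed.

Lemma parallel_primitive p q u : dot3 p u = 1 -> cross3 p q = (0, 0, 0) ->
  q = (dot3 q u * p.1.1, dot3 q u * p.1.2, dot3 q u * p.2).
Proof.
case: p q u => [[p0 p1] p2] [[q0 q1] q2] [[u0 u1] u2]; rewrite /dot3 /cross3 /= => h [h0 h1 h2].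
congr (_, _, _); apply/eqP; rewrite -subr_eq0 -[X in X - _]mulr1 -h; apply/eqP.
- by transitivity (u2 * (p2 * q0 - p0 * q2) - u1 * (p0 * q1 - p1 * q0)); [ring|rewrite h1 h2; ring].
- by transitivity (u0 * (p0 * q1 - p1 * q0) - u2 * (p1 * q2 - p2 * q1)); [ring|rewrite h0 h2; ring].
- by transitivity (u1 * (p1 * q2 - p2 * q1) - u0 * (p2 * q0 - p0 * q2)); [ring|rewrite h0 h1; ring].
Qed.

Lemma parallel_trans p q q' u : dot3 q u = 1 -> cross3 q p = (0, 0, 0) -> cross3 q q' = (0, 0, 0) ->
  cross3 p q' = (0, 0, 0).
Proof.
move=> h h1 h2; rewrite (parallel_primitive h h1) (parallel_primitive h h2) /cross3 /=.
by congr (_, _, _); ring.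
Qed.

Lemma cross3C0 p q : cross3 p q = (0, 0, 0) -> cross3 q p = (0, 0, 0).
Proof.
case: p q => [[p0 p1] p2] [[q0 q1] q2]; rewrite /cross3 /= => -[h0 h1 h2].
by congr (_, _, _); lia.
Qed.

Lemma dot3_cross_l p q : dot3 (cross3 p q) p = 0.
Proof. by rewrite /dot3 /cross3 /=; ring. Qed.

Lemma dot3_cross_r p q : dot3 (cross3 p q) q = 0.
Proof. by rewrite /dot3 /cross3 /=; ring. Qed.

Lemma cross3_orth p q z : dot3 z p = 0 -> dot3 z q = 0 -> cross3 (cross3 p q) z = (0, 0, 0).
Proof.
move=> h1 h2.
have -> : cross3 (cross3 p q) z =
   (q.1.1 * dot3 z p - p.1.1 * dot3 z q, q.1.2 * dot3 z p - p.1.2 * dot3 z q, q.2 * dot3 z p - p.2 * dot3 z q).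
  by rewrite /cross3 /dot3 /=; congr (_, _, _); ring.
by rewrite h1 h2 !mulr0 subr0.
Qed.

(** The multiplier y is a coordinate of z, so that a bound on z bounds it. *)
Lemma cross3_coord w z : cross3 w z = (0, 0, 0) -> w != (0, 0, 0) -> exists x y : int,
  [/\ x != 0, x * z.1.1 = y * w.1.1, x * z.1.2 = y * w.1.2, x * z.2 = y * w.2 & y \in [:: z.1.1; z.1.2; z.2]].
Proof.
case: w z => [[w0 w1] w2] [[z0 z1] z2]; rewrite /cross3 /= => -[h0 h1 h2] nz.
have [e0|n0] := eqVneq w0 0; last by exists w0, z0; split; rewrite ?inE ?eqxx //; lia.
have [e1|n1] := eqVneq w1 0; last by exists w1, z1; split; rewrite ?inE ?eqxx ?orbT //; lia.
have n2 : w2 != 0 by apply: contraNneq nz => e2; rewrite e0 e1 e2.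
by exists w2, z2; split; rewrite ?inE ?eqxx ?orbT //; lia.
Qed.

(** With g the gcd of z0 = u g and z1 = v g, the equation becomes u z2 = v^2 g, so u divides g. *)
Lemma conic_param (z : int3) : z.1.1 * z.2 = z.1.2 ^+ 2 -> z.1.1 != 0 ->
  exists k u v : int, [/\ z = (k * u ^+ 2, k * (u * v), k * v ^+ 2), coprimez u v, u != 0 & k != 0].
Proof.
case: z => [[z0 z1] z2] /= h z00.
pose g := gcdz z0 z1.
have g0 : g != 0 by rewrite gcdz_eq0 negb_and z00.
have [u zu] : exists u, z0 = u * g by apply/dvdzP/dvdz_gcdl.
have [v zv] : exists v, z1 = v * g by apply/dvdzP/dvdz_gcdr.
have cuv : coprimez u v.
  have : gcdz (u * g) (v * g) = g by rewrite -zu -zv.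
  rewrite mulrC [v * g]mulrC /= -mulz_gcdr => /eqP e.
  have gp : `|g|%N%:Z = g by rewrite /g /gcdz.
  rewrite gp -[X in _ == X]mulr1 in e; by rewrite /coprimez -(inj_eq (mulfI g0)).
have e1 : u * z2 = v ^+ 2 * g.
  by apply: (mulfI g0); rewrite mulrA [g * u]mulrC -zu h zv; ring.
have u0 : u != 0 by apply: contraNneq z00 => u0; rewrite zu u0 mul0r.
have [k gk] : exists k, g = k * u.
  apply/dvdzP; rewrite -(@Gauss_dvdzr u (v ^+ 2)) ?coprimezXr // -e1; exact: dvdz_mulr.
exists k, u, v; split => //; last by apply: contraNneq g0 => k0; rewrite gk k0 mul0r.
by congr (_, _, _); [rewrite zu gk; ring|rewrite zv gk; ring|apply: (mulfI u0); rewrite e1 gk; ring].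
Qed.

(** The denominator of a rational root v / u divides the leading coefficient, which is p1 in case p2
    = 0. *)
Lemma conic_root (p : int3) (u v : int) : p != (0, 0, 0) -> coprimez u v -> u != 0 ->
  p.1.1 * u ^+ 2 + p.1.2 * (u * v) + p.2 * v ^+ 2 = 0 ->
  (`|u| <= `|p.2|)%N \/ (`|u| <= `|p.1.2|)%N.
Proof.
case: p => [[p0 p1] p2] /= nz cuv u0 h.
have [p20|p20] := eqVneq p2 0; last first.
  left; apply: dvdn_leq; first by rewrite absz_gt0.
  have : (u %| p2 * v ^+ 2)%Z.
    by apply/dvdzP; exists (- (p0 * u + p1 * v)); move: h; lia.
  by rewrite mulrC Gauss_dvdzr // coprimezXr.
right.
have h' : p0 * u + p1 * v = 0 by apply: (mulfI u0); move: h; rewrite p20; nia.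
apply: dvdn_leq.
  rewrite absz_gt0; apply: contraNneq nz => p10; move: h'; rewrite p20 p10 mul0r addr0 => /eqP.
  by rewrite mulf_eq0 (negbTE u0) orbF => /eqP ->.
have : (u %| p1 * v)%Z by apply/dvdzP; exists (- p0); lia.
by rewrite mulrC Gauss_dvdzr.
Qed.

End Par.

(** * Sequences of small forms at growing scales *)

Section Chain.
Variable R : realType.
Implicit Types (p q z u : int3) (al N V t : R).

Lemma val3_det al p q u : (det3 p q u)%:~R =
  val3 al p * (cross3 q u).1.1%:~R + val3 al q * (cross3 u p).1.1%:~R + val3 al u * (cross3 p q).1.1%:~R.
Proof.
rewrite /det3 /dot3 /cross3 /val3 /= !(rmorphD, rmorphM, rmorphB) /=.
by rewrite !rmorphN !rmorphM; ring.
Qed.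

Lemma dot3_cross p q u : dot3 p (cross3 q u) = det3 p q u.
Proof. by rewrite /det3 /dot3 /cross3 /=; ring. Qed.

Lemma err1_cross al p q : err1 al (cross3 p q) = q.2%:~R * val3 al p - p.2%:~R * val3 al q.
Proof. by rewrite /err1 /cross3 /val3 /= !rmorphB !rmorphM /=; ring. Qed.

Lemma err2_cross al p q : err2 al (cross3 p q) =
  (al * p.2%:~R + p.1.2%:~R) * val3 al q - (al * q.2%:~R + q.1.2%:~R) * val3 al p.
Proof. by rewrite /err2 /cross3 /val3 /= !rmorphB !rmorphM /=; ring. Qed.

Lemma bnd3_ge0 p N : bnd3 p N -> 0 <= N.
Proof. by case=> h _ _; apply: le_trans h. Qed.

Lemma bnd3_le p N N' : bnd3 p N -> N <= N' -> bnd3 p N'.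
Proof. by move=> [h0 h1 h2] h; split; apply: le_trans h. Qed.

Lemma bnd3_cross p q N N' : bnd3 p N -> bnd3 q N' -> bnd3 (cross3 p q) (2 * (N * N')).
Proof.
move=> [p0 p1 p2] [q0 q1 q2].
have H (a b c d : int) : `|a%:~R : R| <= N -> `|b%:~R : R| <= N' -> `|c%:~R : R| <= N -> `|d%:~R : R| <= N' ->
    `|(a * b - c * d)%:~R : R| <= 2 * (N * N').
  move=> ha hb hc hd; rewrite rmorphB !rmorphM /=; apply: le_trans (ler_normB _ _) _.
  rewrite !normrM; have := ler_pM (normr_ge0 _) (normr_ge0 _) ha hb.
  by have := ler_pM (normr_ge0 _) (normr_ge0 _) hc hd; lra.
by split; rewrite /cross3 /=; apply: H.
Qed.

Lemma err_cross_bound al p q N N' V V' : 0 < al -> al < 1 ->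
  bnd3 p N -> bnd3 q N' -> `|val3 al p| <= V -> `|val3 al q| <= V' ->
  `|err1 al (cross3 p q)| <= 2 * (N' * V + N * V') /\ `|err2 al (cross3 p q)| <= 2 * (N' * V + N * V').
Proof.
move=> a0 a1 bp bq vp vq; have N0 := bnd3_ge0 bp; have N'0 := bnd3_ge0 bq.
case: bp bq => [p0 p1 p2] [q0 q1 q2].
have m1 : 0 <= N' * V by rewrite mulr_ge0 //; apply: le_trans vp.
have m2 : 0 <= N * V' by rewrite mulr_ge0 //; apply: le_trans vq.
have H (x y z w : R) : `|x| <= 2 * N' -> `|y| <= 2 * N -> `|z| <= V -> `|w| <= V' ->
    `|x * z - y * w| <= 2 * (N' * V + N * V').
  move=> hx hy hz hw; apply: le_trans (ler_normB _ _) _; rewrite !normrM.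
  have := ler_pM (normr_ge0 _) (normr_ge0 _) hx hz; have := ler_pM (normr_ge0 _) (normr_ge0 _) hy hw.
  by lra.
have G (x y : R) M : `|x| <= M -> `|y| <= M -> `|al * x + y| <= 2 * M.
  move=> hx hy; apply: le_trans (ler_normD _ _) _; rewrite normrM gtr0_norm //.
  have : al * `|x| <= `|x| by rewrite ler_piMl // ltW.
  lra.
split; first by rewrite err1_cross; apply: H => //; lra.
rewrite err2_cross -normrN opprB; apply: H => //; exact: G.
Qed.

Lemma conic_err al z : z.1.2%:~R ^+ 2 - z.1.1%:~R * z.2%:~R = z.1.1%:~R * err2 al z - z.1.2%:~R * err1 al z.
Proof. by rewrite /err1 /err2; ring. Qed.

Lemma intr_norm_ge1 (n : int) : n != 0 -> 1 <= `|n%:~R : R|.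
Proof. by move=> n0; rewrite -intr_norm -[1]/(1%:~R) ler_int; lia. Qed.

(* A nonzero determinant would force t1 >= 1.88 t. Then the resultant of p1 and p2 is less
   than 1, so that p1 and p2 share a rational root v / u, at which p0 takes a nonzero
   integral value less than 1. *)
Lemma no_independent_triple al t t1 p0 p1 p2 : 0 < al -> al < 1 ->
  expR (- (t / 100)) <= 1 / 1000 -> 101 / 100 * t <= t1 ->
  bnd3 p0 (expR (51 / 50 * t)) -> `|val3 al p0| <= expR (- (149 / 50 * t)) ->
  bnd3 p1 (expR (51 / 50 * (101 / 100 * t))) -> `|val3 al p1| <= expR (- (149 / 50 * t1)) ->
  bnd3 p2 (expR (51 / 50 * (101 / 100 * t1))) -> `|val3 al p2| <= expR (- (149 / 50 * (101 / 100 * t1))) ->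
  det3 p0 p1 p2 = 0.
Proof.
move=> al0 al1 tb t1t b0 v0 b1 v1 b2 v2.
have t0 : 0 < t.
  by rewrite ltNge; apply/negP => h; have := expR_ge1Dx (- (t / 100)); clear - h tb; lra.
have sm x : x <= - (t / 100) -> expR x <= 1 / 1000.
  by move=> h; apply: le_trans tb; rewrite ler_expR.
have [//|D0] := eqVneq (det3 p0 p1 p2) 0; exfalso.
(* Otherwise each of the three terms of [val3_det] is at most 1/500, while the integer determinant
   is nonzero. *)
have key : 194 / 100 * t <= 10302 / 10000 * t1 + t / 1000.
  rewrite leNgt; apply/negP => lt1.
  have := intr_norm_ge1 D0; rewrite (val3_det al); apply/negP; rewrite -ltNge.
  have [c12 _ _] := bnd3_cross b1 b2; have [c20 _ _] := bnd3_cross b2 b0; have [c01 _ _] := bnd3_cross b0 b1.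
  rewrite -!expRD in c12 c20 c01.
  have H (v m a b : R) : `|v| <= expR a -> `|m| <= 2 * expR b -> a + b <= - (t / 100) -> `|v * m| <= 1 / 500.
    move=> hv hm ab; rewrite normrM; have := ler_pM (normr_ge0 _) (normr_ge0 _) hv hm.
    by rewrite mulrCA -expRD; have := sm _ ab; clear; lra.
  have h1 := H _ _ _ _ v0 c12; have h2 := H _ _ _ _ v1 c20; have h3 := H _ _ _ _ v2 c01.
  apply: le_lt_trans (ler_normD _ _) _; apply: le_lt_trans (lerD (ler_normD _ _) (lexx _)) _.
  have {}h1 := h1 ltac:(clear - t0 t1t lt1; lra); have {}h2 := h2 ltac:(clear - t0 t1t; lra).
  have {}h3 := h3 ltac:(clear - t0 t1t; lra).
  clear - h1 h2 h3; lra.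
pose z := cross3 p1 p2.
have bz := bnd3_cross b1 b2; rewrite -/z -expRD in bz.
have [e1 e2] := err_cross_bound al0 al1 b1 b2 v1 v2; rewrite -/z -!expRD in e1 e2.
pose E := 4 * expR (- (19498 / 10000 * t1)).
have EE : 2 * (expR (51 / 50 * (101 / 100 * t1) + - (149 / 50 * t1)) +
     expR (51 / 50 * (101 / 100 * t) + - (149 / 50 * (101 / 100 * t1)))) <= E.
  have : expR (51 / 50 * (101 / 100 * t1) + - (149 / 50 * t1)) <= expR (- (19498 / 10000 * t1)) by rewrite ler_expR; clear - t0 t1t; lra.
  have : expR (51 / 50 * (101 / 100 * t) + - (149 / 50 * (101 / 100 * t1))) <= expR (- (19498 / 10000 * t1)) by rewrite ler_expR; clear - t0 t1t; lra.
  rewrite /E; clear; lra.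
have {}e1 : `|err1 al z| <= E by exact: le_trans EE.
have {}e2 : `|err2 al z| <= E by exact: le_trans EE.
have E1 : E < 1 by have := sm (- (19498 / 10000 * t1)); rewrite /E => h; have := h ltac:(clear - t0 t1t; lra); clear; lra.
have Dz : dot3 p0 z = det3 p0 p1 p2 by exact: dot3_cross.
(* The difference of the sides is, up to sign, the resultant of [p1] and [p2]; by [conic_err] it is
   small along with the errors of [z], and [key] brings it below 1. *)
have z0 : z.1.1 * z.2 = z.1.2 ^+ 2.
  apply/eqP; rewrite -subr_eq0; apply/negP => /negP/intr_norm_ge1; apply/negP; rewrite -ltNge.
  have -> : (z.1.1 * z.2 - z.1.2 ^+ 2)%:~R = z.1.2%:~R * err1 al z - z.1.1%:~R * err2 al z :> R.
    by rewrite -[RHS]opprB -conic_err opprB rmorphB rmorphM rmorphXn.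
  have [z0 z1 _] := bz.
  have i1 := ler_pM (normr_ge0 _) (normr_ge0 _) z1 e1.
  have i2 := ler_pM (normr_ge0 _) (normr_ge0 _) z0 e2.
  apply: le_lt_trans (ler_normB _ _) _; rewrite !normrM.
  have : 2 * expR (51 / 50 * (101 / 100 * t) + 51 / 50 * (101 / 100 * t1)) * E <= 8 / 1000.
    rewrite /E mulrACA -expRD; set x := expR _; suff : x <= 1 / 1000 by clear; lra.
    by apply: sm; clear - t0 t1t key; lra.
  clear - i1 i2; lra.
have z00 : z.1.1 != 0.
  apply/eqP => z00; have z10 : z.1.2 = 0.
    by apply/eqP; rewrite -sqrf_eq0 -z0 z00 mul0r.
  have z20 : z.2 != 0.
    apply: contraNneq D0 => z20; by rewrite -Dz /dot3 z00 z10 z20 !mulr0.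
  have := intr_norm_ge1 z20; move: e2; rewrite /err2 z10 mulr0 sub0r normrN; clear - E1; lra.
have [k [u [v [zE cuv u0 k0]]]] := conic_param z0 z00.
have p1z : p1.1.1 * u ^+ 2 + p1.1.2 * (u * v) + p1.2 * v ^+ 2 = 0.
  apply: (mulfI k0); rewrite mulr0 -[RHS](dot3_cross_l p1 p2) -/z zE /dot3 /=; ring.
have p1n : p1 != (0, 0, 0).
  apply: contraNneq D0 => p10; rewrite -Dz /z p10 /dot3 /cross3 /=; apply/eqP; ring.
have ub : `|u%:~R : R| <= expR (51 / 50 * (101 / 100 * t)).
  have [_ h1 h2] := b1; have [h|h] := conic_root p1n cuv u0 p1z; [apply: le_trans h2|apply: le_trans h1];
  by rewrite -!intr_norm -!natr_absz ler_nat.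
(* [w] is u^2 times the value of [p0] at v / u, and [k * w] is the determinant. *)
pose w := p0.1.1 * u ^+ 2 + p0.1.2 * (u * v) + p0.2 * v ^+ 2.
have w0 : w != 0.
  apply: contraNneq D0 => w0; rewrite -Dz zE /dot3 /=; apply/eqP; transitivity (k * w); first by rewrite /w; ring.
  by rewrite w0 mulr0.
pose f1 : R := al * u%:~R ^+ 2 - u%:~R * v%:~R; pose f2 : R := al * (u%:~R * v%:~R) - v%:~R ^+ 2.
have k1 := intr_norm_ge1 k0.
have f1E : err1 al z = k%:~R * f1 by rewrite /err1 zE /f1 /= !rmorphM ?rmorphXn /=; ring.
have f2E : err2 al z = k%:~R * f2 by rewrite /err2 zE /f2 /= !rmorphM ?rmorphXn /=; ring.
have lek x : `|x| <= `|k%:~R * x| :> R by rewrite normrM ler_peMl.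
have f1b : `|f1| <= E by apply: le_trans e1; rewrite f1E; exact: lek.
have f2b : `|f2| <= E by apply: le_trans e2; rewrite f2E; exact: lek.
have wE : w%:~R = u%:~R ^+ 2 * val3 al p0 - (p0.1.2%:~R * f1 + p0.2%:~R * (al * f1 + f2)) :> R.
  by rewrite /w /val3 /f1 /f2 !rmorphD !rmorphM /= ?rmorphXn /=; ring.
have := intr_norm_ge1 w0; apply/negP; rewrite -ltNge wE.
apply: le_lt_trans (ler_normB _ _) _; rewrite normrM normrX.
have j1 : `|u%:~R : R| ^+ 2 * `|val3 al p0| <= 1 / 1000.
  apply: (@le_trans _ _ (expR (51 / 50 * (101 / 100 * t)) ^+ 2 * expR (- (149 / 50 * t)))).
    by apply: ler_pM; rewrite ?exprn_ge0 // lerXn2r ?nnegrE // expR_ge0.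
  by rewrite expr2 -!expRD; apply: sm; clear - t0; lra.
have [_ h1 h2] := b0.
have j2 : `|p0.1.2%:~R * f1 + p0.2%:~R * (al * f1 + f2)| <= 3 * (expR (51 / 50 * t) * E).
  apply: le_trans (ler_normD _ _) _; rewrite !normrM.
  have g1 := ler_pM (normr_ge0 _) (normr_ge0 _) h1 f1b.
  have : `|al * f1 + f2| <= 2 * E.
    apply: le_trans (ler_normD _ _) _; rewrite normrM gtr0_norm //.
    have : al * `|f1| <= `|f1| by rewrite ler_piMl // ltW.
    clear - f1b f2b; lra.
  move=> /(ler_pM (normr_ge0 _) (normr_ge0 _) h2) g2; clear - g1 g2; lra.
have j3 : expR (51 / 50 * t) * E <= 4 / 1000.
  rewrite /E mulrCA -expRD; set x := expR _; suff : x <= 1 / 1000 by clear; lra.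
  by apply: sm; clear - t0 t1t; lra.
clear - j1 j2 j3; lra.
Qed.

(** An integer vector parallel to the primitive p is an integer multiple of it. *)
Lemma parallel_smaller al p q u : dot3 p u = 1 -> q != (0, 0, 0) -> cross3 p q = (0, 0, 0) ->
  `|val3 al p| <= `|val3 al q|.
Proof.
move=> pu q0 pq; have E := parallel_primitive pu pq.
have m0 : dot3 q u != 0.
  by apply: contraNneq q0 => m0; rewrite E m0 !mul0r.
have -> : val3 al q = (dot3 q u)%:~R * val3 al p.
  by rewrite {1}E /val3 /= !rmorphM /=; ring.
by rewrite normrM ler_peMl // intr_norm_ge1.
Qed.

Lemma primitive_neq0 p u : dot3 p u = 1 -> p != (0, 0, 0).
Proof. by move=> h; apply/eqP => p0; move: h; rewrite p0 /dot3 /= !mul0r. Qed.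

(* With T = expR t and eta = 1/100, the box has sides T^(3 - eta) and T^(-1 - eta); the
   forms below satisfy |p| <= T^(1 + 2 eta) and |p(al)| <= T^(-3 + 2 eta). *)
Definition good_box al t : Prop := exists b : 'I_3 -> int3,
  (det3 (b i0) (b i1) (b i2)) ^+ 2 = 1 /\
  forall i, in_box al (expR (299 / 100 * t)) (expR (- (101 / 100 * t))) (b i).

Definition small_form al t p : Prop :=
  [/\ exists u, dot3 p u = 1, bnd3 p (expR (51 / 50 * t)) & `|val3 al p| <= expR (- (149 / 50 * t))].

(** The constants 12 and 3 of [box_or_form] are absorbed by a factor exp(t/100) >= 1000. *)
Lemma good_or_form al t : 0 < al -> al < 1 -> expR (- (t / 100)) <= 1 / 1000 ->
  good_box al t \/ exists p, small_form al t p.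
Proof.
move=> al0 al1 tb.
have t0 : 0 < t.
  by rewrite ltNge; apply/negP => h; have := expR_ge1Dx (- (t / 100)); clear - h tb; lra.
have A1 : 1 <= expR (299 / 100 * t) by rewrite -[leLHS]expR0 ler_expR; clear - t0; lra.
have B0 : 0 < expR (- (101 / 100 * t)) by exact: expR_gt0.
have B1 : expR (- (101 / 100 * t)) <= 1 by rewrite -[leRHS]expR0 ler_expR; clear - t0; lra.
have [[b hb]|[p [u [pu bp vp]]]] := box_or_form al0 al1 A1 B0 B1; first by left; exists b.
right; exists p.
have e1 : 1000 <= expR (t / 100).
  have := ler_wpM2r (expR_ge0 (t / 100)) tb; rewrite -expRD addNr expR0; clear; lra.
split; first by exists u.
- apply: bnd3_le bp _; rewrite expRN invrK.
  have -> : 51 / 50 * t = t / 100 + 101 / 100 * t by clear; lra.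
  rewrite expRD; apply: ler_wpM2r; first exact: expR_ge0.
  by clear - e1; lra.
- apply: le_trans vp _; rewrite -expRN.
  have -> : - (149 / 50 * t) = t / 100 + - (299 / 100 * t) by clear; lra.
  rewrite expRD; apply: ler_wpM2r; first exact: expR_ge0.
  by clear - e1; lra.
Qed.

(** Turns Liouville's inequality with D = d - 1 into a linear inequality between exponents; one
    further x absorbs ln C. *)
Lemma expR_intbound (C x : R) (D : nat) : 0 < C -> `|ln C| <= x -> 
  forall y, 1 <= C * expR x ^+ D * expR (- y) -> y <= D.+1%:R * x.
Proof.
move=> C0 hC y; rewrite -expRM_natl -{1}(lnK C0) -!expRD -[leLHS]expR0 ler_expR => h.
have := ler_norm (ln C); rewrite -natr1 mulrDl mul1r; lra.
Qed.

(** As linear polynomials these triples take the values err1 and err2 at al. One of them is nonzero,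
    so Liouville's inequality bounds that error from below. *)
Lemma shift3_neq0 (z : int3) : z != (0, 0, 0) ->
  ((- z.1.2, z.1.1, 0) : int3) = (0, 0, 0) -> ((- z.2, z.1.2, 0) : int3) != (0, 0, 0).
Proof.
case: z => [[a b] c] /= z0 [b0 a0]; apply: contraNneq z0 => -[c0 _]; apply/eqP.
by congr (_, _, _); [|rewrite -[b]opprK b0 oppr0|rewrite -[c]opprK c0 oppr0].
Qed.

(* If all boxes fail, every scale tk k carries a small form P k. Liouville's inequality
   prevents the P k from lying in a plane; j is the first index at which they leave it
   and i the last one for which P i is not parallel to P j.-1. *)
Lemma good_box_exists al (F : {poly int}) d : size F = d.+1 -> (2 < d)%N ->
  root (map_poly intr F) al ->
  (forall G : {poly int}, G != 0 -> root (map_poly intr G) al -> (d < size G)%N) ->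
  0 < al -> al < 1 ->
  exists (K : nat) (t0 : R), forall t, t0 <= t ->
    exists2 k, (k <= K)%N & good_box al ((101 / 100) ^+ k * t).
Proof.
move=> sF d2 rt Fmin al0 al1.
have [C [C0 liou]] := liouville3 sF (ltnW (ltnW d2)) rt Fmin.
have v0 p : p != (0, 0, 0) -> val3 al p != 0.
  move=> p0; apply/eqP => v; pose G : {poly int} := Poly [:: p.1.1; p.1.2; p.2].
  have G0 : G != 0.
    apply: contraNneq p0 => /polyP G0.
    have := G0 0%N; have := G0 1%N; have := G0 2%N; rewrite !coef_Poly !coef0 /=.
    by case: (p) => [[a b] c] /= -> -> ->.
  have := Fmin G G0; suff rG : root (map_poly intr G) al.
    by move=> /(_ rG) dG; have sG : (size G <= 3)%N := size_Poly _; have := leq_trans dG sG; rewrite ltnNge d2.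
  apply/rootP; rewrite (@horner_coef_wide _ 3); last first.
    by apply: leq_trans (size_poly _ _) _; exact: size_Poly.
  rewrite !big_ord_recr big_ord0 /= !coef_map /= !coef_Poly /= -[RHS]v /val3; ring.
pose D1 : R := d%:R.
have D10 : 0 < D1 by rewrite ltr0n; lia.
have liouE p (x y : R) : `|ln C| <= x -> p != (0, 0, 0) -> bnd3 p (expR x) -> `|val3 al p| <= expR (- y) ->
    y <= D1 * x.
  move=> hx p0 bp vp; have dE : d = d.-1.+1 by rewrite prednK //; lia.
  rewrite /D1 dE; apply: (expR_intbound C0 hx).
  apply: le_trans (liou p _ bp (v0 p p0)) _; apply: ler_wpM2l => //.
  by rewrite mulr_ge0 ?exprn_ge0 ?expR_ge0 // ltW.
pose rho : R := 101 / 100.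
have rho1 : 1 < rho by rewrite /rho; lra.
have rho0 : 0 < rho by lra.
have rhoX (x : R) : exists n : nat, x <= rho ^+ n.
  have h (n : nat) : n%:R / 100 <= rho ^+ n.
    elim: n => [|n IH]; first by rewrite mul0r ler01.
    have : 1 <= rho ^+ n by rewrite exprn_ege1 // ltW.
    by rewrite exprS -natr1; move: (rho ^+ n) IH => X IH h1; rewrite /rho; clear - IH h1; lra.
  exists (Num.truncn (x * 100)).+1; apply: le_trans (h _).
  by rewrite ler_pdivlMr //; apply: ltW; exact: truncnS_gt.
(* Liouville's inequality fails for a form that keeps its direction over [K1] scales, and for the
   normal vector of a plane that still contains the forms after [K2] scales. *)
have [K1 hK1] := rhoX (D1 + 1).
have [K2 hK2] := rhoX (2 * (D1 + 2) * rho ^+ K1).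
exists (K2 + K1)%N, (Num.max (`|ln C|) (100 * ln 1000)) => t.
rewrite ge_max => /andP[tC t1000].
have smt (x : R) : t <= x -> expR (- (x / 100)) <= 1 / 1000.
  move=> tx; rewrite div1r expRN lef_pV2 ?posrE ?expR_gt0 //.
  rewrite -[leLHS](@lnK _ (1000 : R)) ?posrE // ler_expR; lra.
have t0 : 0 < t by apply: lt_le_trans t1000; rewrite mulr_gt0 // ln_gt0 // ltr1n.
apply: contrapT => /forall2NP nk.
pose tk k := rho ^+ k * t.
have tk_ge k : t <= tk k by rewrite /tk ler_peMl ?exprn_ege1 // ltW.
have exP k : exists p, (k <= K2 + K1)%N -> small_form al (tk k) p.
  have [kK|_] := leqP k (K2 + K1); last by exists (0, 0, 0).
  have [//|ng] := nk k; have [//|[p hp]] := good_or_form al0 al1 (smt _ (tk_ge k)).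
  by exists p.
pose P k := projT1 (cid (exP k)).
have hP k : (k <= K2 + K1)%N -> small_form al (tk k) (P k) by rewrite /P; case: (cid _).
move: P hP => P hP.
have tkS k : tk k.+1 = 101 / 100 * tk k by rewrite /tk exprS -mulrA.
have tk_mono k l : (k <= l)%N -> tk k <= tk l.
  by move=> kl; rewrite /tk ler_pM2r // ler_weXn2l // ltW.
pose par p q := cross3 p q == (0, 0, 0).
have prim k : (k <= K2 + K1)%N -> exists u, dot3 (P k) u = 1 by move=> /hP[].
have Pn0 k : (k <= K2 + K1)%N -> P k != (0, 0, 0) by move=> /prim[u]; exact: primitive_neq0.
have parC p q : par p q -> par q p by move=> /eqP/cross3C0 h; apply/eqP.
have par_tr k p q : (k <= K2 + K1)%N -> par p (P k) -> par (P k) q -> par p q.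
  by move=> /prim[u hu] /parC/eqP h1 /eqP h2; apply/eqP; exact: (parallel_trans hu).
have change s : (s + K1 <= K2 + K1)%N ->
    exists m, [/\ (s < m)%N, (m <= s + K1)%N & ~~ par (P m.-1) (P m)].
  move=> sK; have ex : exists m, (s < m <= s + K1)%N && ~~ par (P s) (P m).
    apply: contrapT => /forallNP nm.
    have pK : par (P s) (P (s + K1)%N).
      case: (posnP K1) => [->|K10]; first by rewrite addn0 /par cross3_self.
      have := nm (s + K1)%N => /negP; rewrite leqnn andbT -[X in (X < _)%N]addn0 ltn_add2l K10 /= negbK //.
    have sK' : (s <= K2 + K1)%N by apply: leq_trans sK; exact: leq_addr.
    have [[u pu] bs _] := hP s sK'; have [_ _ vK] := hP _ sK.
    have vs := le_trans (parallel_smaller al pu (Pn0 _ sK) (eqP pK)) vK.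
    have := liouE (P s) (51 / 50 * tk s) _ _ (Pn0 _ sK') bs vs.
    have := tk_ge s => ts /(_ _).
    have -> : tk (s + K1)%N = rho ^+ K1 * tk s by rewrite /tk exprD mulrCA mulrA.
    have ts0 : 0 < tk s by clear - ts t0; lra.
    have := ler_wpM2r (ltW ts0) hK1; have := mulr_gt0 D10 ts0.
    move: (rho ^+ K1 * tk s) => X h1 h2 h3.
    have : 149 / 50 * X <= D1 * (51 / 50 * tk s) by apply: h3; clear - ts tC t0; lra.
    by clear - h1 h2 ts0; lra.
  case: (ex_minnP ex) => m /andP[/andP[sm ms] npm] mmin; exists m; split => //.
  apply: contra npm => pm; case: (ltngtP s m.-1) => [sm1|sm1|sm1]; last by rewrite sm1.
    have mk : (m.-1 <= K2 + K1)%N by clear - ms sK; lia.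
    apply: (par_tr _ _ _ mk _ pm); rewrite -[par _ _]negbK; apply/negP => np.
    have : (s < m.-1 <= s + K1)%N && ~~ par (P s) (P m.-1) by rewrite np sm1 /=; clear - ms; lia.
    by move=> /mmin; clear - sm; lia.
  by move: sm1 sm; clear; lia.
have [m [m0 mK npm]] := change 0%N (leq_addl _ _).
rewrite add0n in mK.
have mKK : (m <= K2 + K1)%N by clear - mK; lia.
have m1KK : (m.-1 <= K2 + K1)%N by clear - mK; lia.
pose z := cross3 (P m.-1) (P m).
have z0 : z != (0, 0, 0) by exact: npm.
have zm1 : dot3 z (P m.-1) = 0 by exact: dot3_cross_l.
have zm : dot3 z (P m) = 0 by exact: dot3_cross_r.
have bz : bnd3 z (expR (102 / 50 * (rho ^+ K1 * t) + ln 2)).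
  have [_ b1 _] := hP _ m1KK; have [_ b2 _] := hP _ mKK.
  apply: bnd3_le (bnd3_cross b1 b2) _; rewrite expRD lnK ?posrE // mulrC ler_wpM2r // -expRD ler_expR.
  have i1 : tk m.-1 <= rho ^+ K1 * t by apply: (tk_mono _ K1); clear - mK; lia.
  have i2 : tk m <= rho ^+ K1 * t by apply: (tk_mono _ K1).
  by clear - i1 i2; lra.
have ln2b : 0 <= ln (2 : R) /\ ln (2 : R) <= t / 100.
  split; first by rewrite ln_ge0 // ler1n.
  have : ln (2 : R) <= ln (1000 : R) by rewrite ler_ln ?posrE // ler_nat.
  by clear - t1000; lra.
have [k [k0 kK npk]] := change K2 (leqnn _).
(* If both forms were orthogonal to [z], then [z] would be parallel to their cross product. Its
   errors are tiny at scale K2, whereas the height of [z] is bounded in terms of K1. *)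
have kz : dot3 z (P k) != 0 \/ dot3 z (P k.-1) != 0.
  apply: contrapT => /not_orP[/negP/negPn/eqP zk /negP/negPn/eqP zk1].
  have k1K : (k.-1 <= K2 + K1)%N by clear - kK; lia.
  pose z' := cross3 (P k.-1) (P k).
  have [x [y [x0 xy0 xy1 xy2 yin]]] := cross3_coord (cross3_orth zk1 zk) npk.
  rewrite -/z' in xy0 xy1 xy2.
  have [_ bk1 vk1] := hP _ k1K; have [_ bk vk] := hP _ kK.
  have [e1 e2] := err_cross_bound al0 al1 bk1 bk vk1 vk; rewrite -/z' in e1 e2.
  have kE : k = k.-1.+1 by clear - k0; lia.
  set E := 2 * _ in e1 e2.
  have EE : E <= 4 * expR (- (19 / 10 * (rho ^+ K2 * t))).
    have i1 : rho ^+ K2 * t <= tk k.-1 by apply: (tk_mono K2); clear - k0; lia.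
    rewrite /E kE tkS /= -!expRD.
    set a1 := expR _; set a2 := expR _; set a3 := expR _.
    have tp : 0 < tk k.-1 by apply: lt_le_trans (tk_ge _).
    have j1 : a1 <= a3 by rewrite /a1 /a3 ler_expR; clear - i1 tp; lra.
    have j2 : a2 <= a3 by rewrite /a2 /a3 ler_expR; clear - i1 tp; lra.
    by clear - j1 j2; lra.
  set X := rho ^+ K1 * t; set Y := rho ^+ K2 * t in EE.
  pose x1 : R := 102 / 50 * X + ln 2; rewrite -/X -/x1 in bz.
  have yb : `|y%:~R : R| <= expR x1.
    by case: bz => ? ? ?; move: yin; rewrite !inE => /or3P[] /eqP ->.
  have scal (a b : R) : x%:~R * a = y%:~R * b -> `|b| <= E -> `|a| <= expR (- (19 / 10 * Y - x1 - ln 4)).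
    move=> ab hb; apply: (@le_trans _ _ (`|x%:~R * a|)).
      by rewrite normrM ler_peMl // intr_norm_ge1.
    rewrite ab normrM; apply: le_trans (ler_pM (normr_ge0 _) (normr_ge0 _) yb (le_trans hb EE)) _.
    rewrite -{1}(@lnK _ (4 : R)) ?posrE // -!expRD ler_expR; clear; lra.
  have s1 : `|err1 al z| <= expR (- (19 / 10 * Y - x1 - ln 4)).
    apply: scal e1; rewrite /err1 !mulrBr !(mulrCA _ al) -!intrM xy0 xy1 !intrM; ring.
  have s2 : `|err2 al z| <= expR (- (19 / 10 * Y - x1 - ln 4)).
    apply: scal e2; rewrite /err2 !mulrBr !(mulrCA _ al) -!intrM xy1 xy2 !intrM; ring.
  have tX : t <= X by exact: tk_ge.
  have hx1 : `|ln C| <= x1 by case: ln2b => l1 l2; clear - tC tX t0 l1; rewrite /x1; lra.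
  have fin p : p != (0, 0, 0) -> bnd3 p (expR x1) -> `|val3 al p| <= expR (- (19 / 10 * Y - x1 - ln 4)) -> False.
    move=> p0 bp vp; have := liouE _ _ _ hx1 p0 bp vp; apply/negP; rewrite -ltNge.
    have hY : 2 * (D1 + 2) * X <= Y by have := ler_wpM2r (ltW t0) hK2; rewrite -[leLHS]mulrA.
    have l4 : ln 4 = ln 2 + ln 2 :> R by rewrite -lnM ?posrE //; congr ln; rewrite -natrM.
    case: ln2b => l1 l2.
    have q1 : x1 <= 205 / 100 * X by rewrite /x1; clear - l2 tX; lra.
    have q2 := ler_wpM2l (ltW D10) q1.
    have q3 : 0 < D1 * X by rewrite mulr_gt0 //; clear - tX t0; lra.
    by rewrite l4; clear - q1 q2 q3 hY l1 l2 tX t0; lra.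
  have [z0b z1b z2b] := bz.
  have zero1 : bnd3 (- z.1.2, z.1.1, 0) (expR x1).
    by split => /=; rewrite ?rmorphN ?normrN ?normr0 ?expR_ge0.
  have zero2 : bnd3 (- z.2, z.1.2, 0) (expR x1).
    by split => /=; rewrite ?rmorphN ?normrN ?normr0 ?expR_ge0.
  have [zz|zz] := eqVneq ((- z.1.2, z.1.1, 0) : int3) (0, 0, 0); last first.
    apply: (fin _ zz zero1); rewrite (_ : val3 _ _ = err1 al z) //.
    by rewrite /val3 /err1 /= rmorphN /=; ring.
  have zz2 : (- z.2, z.1.2, 0) != (0, 0, 0) :> int3 by exact: shift3_neq0.
  apply: (fin _ zz2 zero2); rewrite (_ : val3 _ _ = err2 al z) //.
  by rewrite /val3 /err2 /= rmorphN /=; ring.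
have exj : exists j, (m <= j <= K2 + K1)%N && (dot3 z (P j) != 0).
  have mK2 : (m <= K2)%N.
    apply: leq_trans mK _; rewrite -(@ler_eXn2l _ rho) //; apply: le_trans hK2.
    have : 0 <= rho ^+ K1 by rewrite exprn_ge0 // ltW.
    have : 0 <= D1 * rho ^+ K1 by rewrite mulr_ge0 ?exprn_ge0 // ltW.
    clear; lra.
  by case: kz => kz; [exists k|exists k.-1]; rewrite kz andbT; clear - mK2 k0 kK; lia.
case: (ex_minnP exj) => j /andP[/andP[mj jK] zj] jmin.
have mj' : (m < j)%N.
  by rewrite ltn_neqAle mj andbT; apply: contraNneq zj => <-; rewrite zm.
have orth l : (m.-1 <= l)%N -> (l < j)%N -> dot3 z (P l) = 0.
  move=> ml lj; have [lm|ml'] := ltnP l m; first by have -> : l = m.-1 by clear - ml lm m0; lia.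
  apply/eqP; rewrite -[_ == _]negbK; apply/negP => nz.
  have : (m <= l <= K2 + K1)%N && (dot3 z (P l) != 0) by rewrite nz; clear - ml' lj jK; lia.
  by move=> /jmin; clear - lj; lia.
have jK1 : (j.-1 <= K2 + K1)%N by clear - jK; lia.
have exi : exists i, (m.-1 <= i < j.-1)%N && ~~ par (P i) (P j.-1).
  apply: contrapT => /forallNP ni.
  have pl l : (m.-1 <= l)%N -> (l <= j.-1)%N -> par (P l) (P j.-1).
    move=> ml; rewrite leq_eqVlt => /orP[/eqP ->|lj]; first by rewrite /par cross3_self.
    by rewrite -[par _ _]negbK; apply/negP => np; apply: (ni l); rewrite ml lj np.
  move: npm => /negP; apply; apply: (par_tr j.-1 _ _ jK1).
    by apply: pl; clear - mj'; lia.
  by apply: parC; apply: pl; clear - mj'; lia.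
have ubi i : (m.-1 <= i < j.-1)%N && ~~ par (P i) (P j.-1) -> (i <= j)%N by move=> /andP[/andP[_ h] _]; clear - h; lia.
case: (ex_maxnP exi ubi) => i /andP[/andP[mi ij] npi] imax.
have iK : (i <= K2 + K1)%N by clear - ij jK1; lia.
have iK1 : (i.+1 <= K2 + K1)%N by clear - ij jK1; lia.
have pi1 : par (P i.+1) (P j.-1).
  have : (i.+1 <= j.-1)%N by [].
  rewrite leq_eqVlt => /orP[/eqP ->|lj]; first by rewrite /par cross3_self.
  rewrite -[par _ _]negbK; apply/negP => np.
  have : (m.-1 <= i.+1 < j.-1)%N && ~~ par (P i.+1) (P j.-1) by rewrite np lj; clear - mi; lia.
  by move=> /imax; clear; lia.
have npi1 : ~~ par (P i) (P i.+1) by apply: contra npi => h; exact: (par_tr i.+1 _ _ iK1 h pi1).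
have [[ui1 pui1] bi1 _] := hP _ iK1.
have [_ bi vi] := hP _ iK; have [_ bj vj] := hP _ jK; have [_ _ vj1] := hP _ jK1.
(* [P i.+1] has the height of its own scale but a value as small as that of the later scale j.-1: it
   is the form p1 of [no_independent_triple]. *)
have vi1 := le_trans (parallel_smaller al pui1 (Pn0 _ jK1) (eqP pi1)) vj1.
have jE : j = j.-1.+1 by clear - mj'; lia.
have tj : tk j = 101 / 100 * tk j.-1 by rewrite {1}jE tkS.
rewrite tkS in bi1; rewrite tj in bj vj.
have tij : 101 / 100 * tk i <= tk j.-1 by rewrite -tkS; apply: tk_mono.
have := no_independent_triple al0 al1 (smt _ (tk_ge i)) tij bi vi bi1 vi1 bj vj.
rewrite /det3 => dz.
have ij1 : (i < j)%N by clear - ij; lia.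
have ij2 : (i.+1 < j)%N by clear - ij; lia.
have mi1 : (m.-1 <= i.+1)%N by clear - mi; lia.
(* [z] is parallel to the cross product of [P i] and [P i.+1], so the vanishing determinant makes it
   orthogonal to [P j], against the choice of [j]. *)
have [x [y [x0 xy0 xy1 xy2 _]]] := cross3_coord (cross3_orth (orth i mi ij1) (orth i.+1 mi1 ij2)) npi1.
move: zj => /negP; apply; apply/eqP; apply: (mulfI x0); rewrite mulr0.
transitivity (y * dot3 (cross3 (P i) (P i.+1)) (P j)); last by rewrite dz mulr0.
by rewrite /dot3 !mulrDr !mulrA xy0 xy1 xy2.
Qed.

End Chain.

(** * Continued fractions *)

Require Import Defs.
From mathcomp Require Import all_classical all_reals all_analysis.
Import Order.TTheory GRing.Theory Num.Theory numFieldNormedType.Exports.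
Local Open Scope classical_set_scope.

Section ContinuedFractions.
Variable R : realType.
Implicit Type a : nat -> nat.

Definition shiftw a (r : nat) : nat -> nat := fun i => a (r + i)%N.

Definition posw a := forall l, (1 <= l)%N -> (0 < a l)%N.

Lemma posw_shift a r : posw a -> posw (shiftw a r).
Proof. by move=> h l l1; apply: h; rewrite ltn_addl. Qed.

Lemma cf_fin_itv a l : posw a -> 0 <= cf_fin R a l /\ cf_fin R a l <= 1.
Proof.
move=> ap; rewrite /cf_fin.
have : {in [seq a i | i <- iota 1 l], forall b, (0 < b)%N}.
  by move=> b /mapP[i]; rewrite mem_iota => /andP[i1 _] ->; exact: ap.
elim: [seq a i | i <- iota 1 l] => [|b s IH] h /=; first by split.
have [h0 h1] : 0 <= foldr (fun b x => (b%:R + x)^-1) 0 s :> R /\ foldr (fun b x => (b%:R + x)^-1) 0 s <= 1 :> R.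
  by apply: IH => c cs; apply: h; rewrite inE cs orbT.
have b1 : 1 <= b%:R :> R by rewrite ler1n h // inE eqxx.
split; first by rewrite invr_ge0; lra.
by rewrite invf_le1; lra.
Qed.

Lemma cf_val_cvg a : posw a -> cf_fin R a n @[n --> \oo] --> cf_val R a.
Proof. by move=> ap; exact: cf_fin_cvg. Qed.

Lemma cf_val_itv a : posw a -> 0 <= cf_val R a /\ cf_val R a <= 1.
Proof.
move=> ap; have c := @cf_fin_cvg R a ap; split; [apply: limr_ge => //|apply: limr_le => //];
  by apply: nearW => n; have [] := cf_fin_itv n ap.
Qed.

Lemma cf_fin_tail a r l : posw a ->
  cf_fin R a (l + r.+1) * ((cf_q a r.+1)%:R + cf_fin R (shiftw a r.+1) l * (cf_q a r)%:R) =
  (cf_p a r.+1)%:R + cf_fin R (shiftw a r.+1) l * (cf_p a r)%:R.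
Proof.
move=> ap; have [x0 _] := cf_fin_itv l (posw_shift r.+1 ap).
have -> : cf_fin R a (l + r.+1) =
    foldr (fun b x => (b%:R + x)^-1) (cf_fin R (shiftw a r.+1) l) [seq a i | i <- iota 1 r.+1].
  rewrite /cf_fin addnC iotaD map_cat foldr_cat; congr foldr; congr foldr.
  by rewrite addnC iotaDl -map_comp.
rewrite (cf_foldE ap) // divfK // lt0r_neq0 // ltr_pwDl ?mulr_ge0 // ltr0n; exact: cf_q_gt0.
Qed.

Lemma cf_tailE a r : posw a ->
  cf_val R a * ((cf_q a r.+1)%:R + cf_val R (shiftw a r.+1) * (cf_q a r)%:R) =
  (cf_p a r.+1)%:R + cf_val R (shiftw a r.+1) * (cf_p a r)%:R.
Proof.
move=> ap; set b := shiftw a r.+1.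
have cb : cf_fin R b n @[n --> \oo] --> cf_val R b by apply: cf_val_cvg; exact: posw_shift.
have ca : cf_fin R a (n + r.+1)%N @[n --> \oo] --> cf_val R a.
  by rewrite (cvg_shiftn r.+1 (cf_fin R a)); exact: cf_val_cvg.
have c1 : (cf_fin R a (n + r.+1)%N * ((cf_q a r.+1)%:R + cf_fin R b n * (cf_q a r)%:R)) @[n --> \oo] -->
    cf_val R a * ((cf_q a r.+1)%:R + cf_val R b * (cf_q a r)%:R).
  by apply: cvgM => //; apply: cvgD; [exact: cvg_cst|apply: cvgMl].
have c2 : ((cf_p a r.+1)%:R + cf_fin R b n * (cf_p a r)%:R) @[n --> \oo] -->
    (cf_p a r.+1)%:R + cf_val R b * (cf_p a r)%:R.
  by apply: cvgD; [exact: cvg_cst|apply: cvgMl].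
rewrite (eq_fun (fun n => cf_fin_tail r n ap)) in c1.
by apply: (cvg_unique _ c1 c2).
Qed.

Lemma cf_val_head a : posw a -> cf_val R a = ((a 1%N)%:R + cf_val R (shiftw a 1))^-1.
Proof.
move=> ap; have := cf_tailE 0 ap; rewrite /= mulr0 addr0 mulr1 => h.
have [t0 _] := cf_val_itv (posw_shift 1 ap).
have d0 : 0 < (a 1%N)%:R + cf_val R (shiftw a 1) by rewrite ltr_pwDl // ltr0n ap.
by apply: (mulIf (lt0r_neq0 d0)); rewrite h mulVf // lt0r_neq0.
Qed.

Lemma cf_val_gt0 a : posw a -> 0 < cf_val R a.
Proof.
move=> ap; rewrite cf_val_head // invr_gt0.
have [t0 _] := cf_val_itv (posw_shift 1 ap).
by rewrite ltr_pwDl // ltr0n ap.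
Qed.

Lemma cf_val_lt1 a : posw a -> cf_val R a < 1.
Proof.
move=> ap; have t0 := cf_val_gt0 (posw_shift 1 ap).
have a1 : 1 <= (a 1%N)%:R :> R by rewrite ler1n ap.
by rewrite cf_val_head // invf_lt1; lra.
Qed.

Lemma nat_close_eq (m n : nat) (x y : R) : 0 < x -> x < 1 -> 0 < y -> y < 1 ->
  m%:R + x = n%:R + y -> m = n.
Proof.
move=> x0 x1 y0 y1 e; case: (ltngtP m n) => // h; exfalso; move: h; rewrite -(ler_nat R) -natr1; lra.
Qed.

(** All values lie strictly between 0 and 1, so the reciprocal determines the first quotient and the
    value of the tail. *)
Lemma cf_val_inj a (b : nat -> nat) : posw a -> posw b -> cf_val R a = cf_val R b ->
  forall i, (0 < i)%N -> a i = b i.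
Proof.
move=> ap bp e i; case: i => // i _; elim: i a b ap bp e => [|i IH] a b ap bp;
  rewrite (cf_val_head ap) (cf_val_head bp) => /invr_inj.
all: have pa := posw_shift 1 ap; have pb := posw_shift 1 bp;
  have a0 := cf_val_gt0 pa; have a1 := cf_val_lt1 pa;
  have b0 := cf_val_gt0 pb; have b1 := cf_val_lt1 pb.
all: move=> e; have ab := nat_close_eq a0 a1 b0 b1 e.
- by [].
- by move: e; rewrite ab => /addrI e; have := IH _ _ pa pb e; rewrite /shiftw !add1n.
Qed.

Lemma cf_eps a r : posw a ->
  ((cf_q a r)%:R * cf_val R a - (cf_p a r)%:R) *
    ((cf_q a r.+1)%:R + cf_val R (shiftw a r.+1) * (cf_q a r)%:R) = (-1) ^+ r.
Proof. by move=> ap; rewrite -(@cf_det R a r) mulrBl -mulrA cf_tailE //; ring. Qed.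

Lemma cf_q_ge0 a r : posw a -> 0 < (cf_q a r)%:R :> R.
Proof. by move=> ap; rewrite ltr0n cf_q_gt0. Qed.

Lemma cf_eps_le a r : posw a ->
  `|(cf_q a r)%:R * cf_val R a - (cf_p a r)%:R| <= ((cf_q a r.+1)%:R)^-1.
Proof.
move=> ap; have [t0 _] := cf_val_itv (posw_shift r.+1 ap).
have q1 := cf_q_ge0 r.+1 ap; have q0 := cf_q_ge0 r ap.
have := congr1 Num.norm (cf_eps r ap); rewrite normrM normrX normrN1 expr1n.
set e := `|_| => h; rewrite -[leRHS]mul1r ler_pdivlMr // -[leRHS]h; apply: ler_wpM2l; first exact: normr_ge0.
by rewrite ger0_norm ?lerDl // ?addr_ge0 // ?mulr_ge0 // ltW.
Qed.

Lemma cf_eps_neq0 a r : posw a -> (cf_q a r)%:R * cf_val R a - (cf_p a r)%:R != 0.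
Proof.
move=> ap; apply/eqP => e; have := cf_eps r ap; rewrite e mul0r => /esym/eqP.
by rewrite signr_eq0.
Qed.

(** In [cf_core] this factors the quadratic value as (al - tail) (q_r al - p_r). *)
Lemma cf_eps_rec a r : posw a ->
  (cf_q a r.+1)%:R * cf_val R a - (cf_p a r.+1)%:R =
  - cf_val R (shiftw a r.+1) * ((cf_q a r)%:R * cf_val R a - (cf_p a r)%:R).
Proof.
move=> ap; have h := cf_tailE r ap; apply/eqP; rewrite -subr_eq0; apply/eqP.
rewrite [LHS](_ : _ = cf_val R a * ((cf_q a r.+1)%:R + cf_val R (shiftw a r.+1) * (cf_q a r)%:R)
   - ((cf_p a r.+1)%:R + cf_val R (shiftw a r.+1) * (cf_p a r)%:R)); last by ring.
by rewrite h subrr.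
Qed.

Lemma cf_pq_ext a (b : nat -> nat) s : (forall i, (0 < i <= s)%N -> a i = b i) ->
  cf_p a s = cf_p b s /\ cf_q a s = cf_q b s.
Proof.
elim/ltn_ind: s => -[|[|s]] IH h //; first by rewrite /= h.
have [p1 q1] : cf_p a s.+1 = cf_p b s.+1 /\ cf_q a s.+1 = cf_q b s.+1.
  by apply: IH => // i /andP[i0 is_]; apply: h; rewrite i0 ltnW.
have [p0 q0] : cf_p a s = cf_p b s /\ cf_q a s = cf_q b s.
  by apply: IH => // i /andP[i0 is_]; apply: h; rewrite i0 ltnW // ltnW.
by rewrite !cf_pSS !cf_qSS p1 q1 p0 q0 h // leqnn.
Qed.

(** Both values are images of numbers x, y in [0, 1] under the same Moebius map, of determinant 1 or
    -1 and with denominators at least q_s. *)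
Lemma cf_close a (b : nat -> nat) s : posw a -> posw b -> (0 < s)%N -> (forall i, (0 < i <= s)%N -> a i = b i) ->
  `|cf_val R a - cf_val R b| <= ((cf_q a s)%:R ^+ 2)^-1.
Proof.
case: s => // s ap bp _ h.
have [pE qE] := cf_pq_ext h.
have [pE' qE'] : cf_p a s = cf_p b s /\ cf_q a s = cf_q b s.
  by apply: cf_pq_ext => i /andP[i0 is_]; apply: h; rewrite i0 ltnW.
have ta := cf_tailE s ap; have tb := cf_tailE s bp; rewrite -pE -qE -pE' -qE' in tb.
have [x0 x1] := cf_val_itv (posw_shift s.+1 ap); have [y0 y1] := cf_val_itv (posw_shift s.+1 bp).
have q1 := cf_q_ge0 s.+1 ap; have q0 := cf_q_ge0 s ap.
have dt := @cf_det R a s.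
move: (cf_val R (shiftw a s.+1)) (cf_val R (shiftw b s.+1)) ta tb x0 x1 y0 y1 => x y ta tb x0 x1 y0 y1.
move: (cf_val R a) (cf_val R b) ta tb => al be ta tb.
move: q1 q0 dt ta tb; set Q := (cf_q a s.+1)%:R; set q := (cf_q a s)%:R; set P := (cf_p a s.+1)%:R; set p := (cf_p a s)%:R.
move=> Q0 q0 dt ta tb.
have dx : Q <= Q + x * q by rewrite lerDl mulr_ge0 // ltW.
have dy : Q <= Q + y * q by rewrite lerDl mulr_ge0 // ltW.
have E : (al - be) * ((Q + x * q) * (Q + y * q)) = (y - x) * (-1) ^+ s.
  rewrite -dt (_ : _ * _ = al * (Q + x * q) * (Q + y * q) - be * (Q + y * q) * (Q + x * q)); last by ring.
  by rewrite ta tb; ring.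
have := congr1 Num.norm E; rewrite !normrM normrX normrN1 expr1n mulr1 => h2.
rewrite -[leRHS]mul1r ler_pdivlMr ?exprn_gt0 //.
apply: (@le_trans _ _ `|y - x|); last by rewrite ler_norml; lra.
rewrite -h2 ler_wpM2l // expr2 !ger0_norm; [|lra|lra].
by apply: ler_pM => //; exact: ltW.
Qed.

Lemma cf_q_leS a r : posw a -> (cf_q a r <= cf_q a r.+1)%N.
Proof.
move=> ap; case: r => [|r]; first by rewrite /= ap.
by rewrite cf_qSS; apply: leq_trans (leq_addr _ _); rewrite leq_pmull // ap.
Qed.

Lemma cf_q_mono a r s : posw a -> (r <= s)%N -> (cf_q a r <= cf_q a s)%N.
Proof.
move=> ap; elim: s => [|s IH]; first by rewrite leqn0 => /eqP ->.
rewrite leq_eqVlt => /orP[/eqP -> //|/IH h]; exact: leq_trans h (cf_q_leS _ ap).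
Qed.

Lemma cf_q_unbounded a (Q0 : R) : posw a -> exists n0, forall r, (n0 <= r)%N -> Q0 <= (cf_q a r)%:R.
Proof.
move=> ap; pose n := (Num.truncn Q0).+1; exists (2 * n).+1 => r nr.
apply: (@le_trans _ _ n%:R); first by apply: ltW; exact: truncnS_gt.
rewrite ler_nat; apply: leq_trans (cf_q_mono ap nr).
have h : (2 ^ (2 * n) <= cf_q a (2 * n).+1 ^ 2)%N.
  by apply: leq_trans (cf_q_prod ap _) _; rewrite -mulnn leq_mul2r cf_q_leS ?orbT.
have : (2 ^ n <= cf_q a (2 * n).+1)%N by rewrite -(@leq_exp2r _ _ 2) // -expnM mulnC.
by apply: leq_trans; apply: ltnW; exact: ltn_expl.
Qed.

End ContinuedFractions.

(** * From a basis of Z^3 in a box to a spanned hyperplane *)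

Section Application.
Variable R : realType.

(** Exponents of the four forms to base q_r for the box with T = q_r^t. Their sum is 4 th - t / 25;
    [th] pays for a constant factor 3. *)
Definition hyp_exp (t th : R) (l : 'I_4) : R :=
  match val l with
  | 0 => 1 + 299 / 100 * t + th
  | 1 => 1 - 101 / 100 * t + th
  | _ => - 1 - 101 / 100 * t + th
  end.

Definition hyp_pt (q0 q1 p0 p1 : int) (k : 'I_4) : int :=
  match val k with 0 => q0 | 1 => q1 | 2 => p0 | _ => p1 end.

(** Multiplying the matrix with rows (p1, p0) and (q1, q0) by the symmetric matrix with rows (z0,
    z1) and (z1, z2) gives the rows (y_1, y_0) and (-y_3, -y_2). Orthogonality to [hyp_pt] is the
    symmetry of the second factor. *)
Definition hyp_vec (q0 q1 p0 p1 : int) (z : int3) (k : 'I_4) : int :=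
  match val k with
  | 0 => z.1.2 * p1 + z.2 * p0
  | 1 => z.1.1 * p1 + z.1.2 * p0
  | 2 => - (z.1.2 * q1 + z.2 * q0)
  | _ => - (z.1.1 * q1 + z.1.2 * q0)
  end.

Lemma det3_cramer (b0 b1 b2 : int3) (Z0 Z1 Z2 : R) : (det3 b0 b1 b2) ^+ 2 = 1 ->
  exists u : 'I_3 -> R, [/\ Z0 = u i0 * b0.1.1%:~R + u i1 * b1.1.1%:~R + u i2 * b2.1.1%:~R,
    Z1 = u i0 * b0.1.2%:~R + u i1 * b1.1.2%:~R + u i2 * b2.1.2%:~R
    & Z2 = u i0 * b0.2%:~R + u i1 * b1.2%:~R + u i2 * b2.2%:~R].
Proof.
move=> d1; pose dt (x y z : R * R * R) :=
  (x.1.2 * y.2 - x.2 * y.1.2) * z.1.1 + (x.2 * y.1.1 - x.1.1 * y.2) * z.1.2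
  + (x.1.1 * y.1.2 - x.1.2 * y.1.1) * z.2.
pose im (b : int3) : R * R * R := (b.1.1%:~R, b.1.2%:~R, b.2%:~R).
pose d := dt (im b0) (im b1) (im b2).
have dE : d = (det3 b0 b1 b2)%:~R.
  by rewrite /d /dt /im /det3 /dot3 /cross3 /= !(rmorphD, rmorphM, rmorphB, rmorphN).
have dd : d ^+ 2 = 1 by rewrite dE -rmorphXn /= d1.
pose Z := (Z0, Z1, Z2).
pose u (i : 'I_3) : R := match val i with
  | 0 => d * dt Z (im b1) (im b2) | 1 => d * dt (im b0) Z (im b2) | _ => d * dt (im b0) (im b1) Z end.
have fin (x e : R) : d * x = e -> x = d * e by move=> <-; rewrite mulrA -expr2 dd mul1r.
exists u; split; rewrite /u /= -!(mulrA d) -!mulrDr; apply: fin; rewrite /d /dt /im /Z /=; ring.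
Qed.

Lemma hyp_vec_span (q0 q1 p0 p1 : int) (b0 b1 b2 : int3) (y : 'I_4 -> R) :
  (p1 * q0 - p0 * q1) ^+ 2 = 1 -> (det3 b0 b1 b2) ^+ 2 = 1 ->
  \sum_k (hyp_pt q0 q1 p0 p1 k)%:~R * y k = 0 ->
  exists u : 'I_3 -> R, forall k,
    y k = u i0 * (hyp_vec q0 q1 p0 p1 b0 k)%:~R + u i1 * (hyp_vec q0 q1 p0 p1 b1 k)%:~R
        + u i2 * (hyp_vec q0 q1 p0 p1 b2 k)%:~R.
Proof.
move=> D1 d1; rewrite big4 /hyp_pt /= => orth.
pose r0 : R := q0%:~R; pose r1 : R := q1%:~R; pose s0 : R := p0%:~R; pose s1 : R := p1%:~R.
pose D : R := s1 * r0 - s0 * r1.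
have DD : D * D = 1.
  by have := congr1 (intr : int -> R) D1; rewrite rmorphXn /= !(rmorphD, rmorphM, rmorphN) /= expr2.
(* The symmetry: inverting the unimodular factor gives two expressions for the entry z1, which agree
   by [orth]. *)
have rel : D * (y k0 * r0 + y k2 * s0) = - D * (y k1 * r1 + y k3 * s1).
  apply/eqP; rewrite -subr_eq0 -[X in _ == X](mulr0 D) -orth /r0 /r1 /s0 /s1; apply/eqP; ring.
have [u [u0 u1 u2]] := det3_cramer (D * (y k1 * r0 + y k3 * s0)) (- D * (y k1 * r1 + y k3 * s1))
   (- D * (y k0 * r1 + y k2 * s1)) d1.
exists u => k; elim/ord4P: k; rewrite /hyp_vec /= ?rmorphN ?rmorphD ?rmorphM /=; rewrite -/r0 -/r1 -/s0 -/s1.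
- transitivity ((- D * (y k1 * r1 + y k3 * s1)) * s1 + (- D * (y k0 * r1 + y k2 * s1)) * s0); last by rewrite u1 u2; ring.
  by rewrite -rel -[LHS]mul1r -DD {1}/D; ring.
- transitivity ((D * (y k1 * r0 + y k3 * s0)) * s1 + (- D * (y k1 * r1 + y k3 * s1)) * s0); last by rewrite u0 u1; ring.
  by rewrite -[LHS]mul1r -DD {1}/D; ring.
- transitivity (- ((- D * (y k1 * r1 + y k3 * s1)) * r1 + (- D * (y k0 * r1 + y k2 * s1)) * r0)); last by rewrite u1 u2; ring.
  by rewrite -rel -[LHS]mul1r -DD {1}/D; ring.
- transitivity (- ((D * (y k1 * r0 + y k3 * s0)) * r1 + (- D * (y k1 * r1 + y k3 * s1)) * r0)); last by rewrite u0 u1; ring.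
  by rewrite -[LHS]mul1r -DD {1}/D; ring.
Qed.

(** The exponent -1 - 4 t is matched to the box: times T^(299/100), the bound on the triple up to a
    factor 2, it gives T^(-101/100) / q1, the same size as the error of z times q0 al - p0. *)
Lemma hyperplane_of_box (al t th : R) (q0 q1 p0 p1 : nat) : 0 < al -> al < 1 -> (0 < q1)%N -> (q0 <= q1)%N ->
  (p1%:Z * q0%:Z - p0%:Z * q1%:Z) ^+ 2 = 1 ->
  `|q0%:R * al - p0%:R| <= (q1%:R)^-1 ->
  `|(q1%:R * al - p1%:R) + al * (q0%:R * al - p0%:R)| <= expR (- ln q1%:R - 4 * (t * ln q1%:R)) ->
  0 <= t -> 3 <= expR (th * ln q1%:R) -> good_box al (t * ln q1%:R) ->
  exists x b, small_hyperplane al (hyp_exp t th) q1 x b.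
Proof.
move=> al0 al1 q10 q01 D1 e0 e01 t0 th3 [z [d1 zbox]].
exists (hyp_pt q0 q1 p0 p1), (fun i => hyp_vec q0 q1 p0 p1 (z i)); split => //.
- rewrite /hyp_pt /= /coprimez; apply/eqP.
  have /dvdzP[u eu] := dvdz_gcdl q0%:Z q1%:Z; have /dvdzP[v ev] := dvdz_gcdr q0%:Z q1%:Z.
  move: eu ev; have : 0 <= gcdz q0%:Z q1%:Z by [].
  move: (gcdz _ _) => g g0 eu ev; move: D1; rewrite eu ev => D1.
  have : g ^+ 2 * (p1%:Z * u - p0%:Z * v) ^+ 2 = 1 by rewrite -D1; ring.
  move: (p1%:Z * u - p0%:Z * v) => w h.
  have : (g %| 1)%Z by apply/dvdzP; exists (g * w ^+ 2); transitivity (g ^+ 2 * w ^+ 2); [rewrite h|ring].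
  by rewrite dvdz1; clear - g0; lia.
- move=> y hy; have [u hu] := hyp_vec_span D1 d1 hy.
  by exists u => k; rewrite big3 hu.
set L : R := ln q1%:R in e01 th3 zbox *.
have q1R : q1%:R = expR L :> R by rewrite lnK // posrE ltr0n.
have L0 : 0 <= L by rewrite ln_ge0 // ler1n.
have tL0 : 0 <= t * L by rewrite mulr_ge0.
move=> i; have [] := zbox i; set A := expR _; set B := expR _.
have A1 : 1 <= A by rewrite -[leLHS]expR0 ler_expR; clear - tL0; lra.
have B1 : B <= 1 by rewrite -[leRHS]expR0 ler_expR; clear - tL0; lra.
have B0 : 0 <= B by exact: expR_ge0.
rewrite /err1 /err2; case: (z i) => [[z0 z1] z2] /=.
set w0 : R := z0%:~R; set w1 : R := z1%:~R; set w2 : R := z2%:~R => b0 b1 b2.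
have w1A : `|w1| <= 2 * A.
  have -> : w1 = al * w0 - (al * w0 - w1) by ring.
  apply: le_trans (ler_normB _ _) _; rewrite normrM gtr0_norm //.
  have : al * `|w0| <= `|w0| by rewrite ler_piMl // ltW.
  clear - b0 b1 A1 B1; lra.
set Q0 : R := q0%:R in e0 e01; set Q1 : R := q1%:R in e0 q1R e01.
set P0 : R := p0%:R in e0 e01; set P1 : R := p1%:R in e01.
have Q00 : 0 <= Q0 by exact: ler0n.
have Q10 : 0 < Q1 by rewrite ltr0n.
have Q01 : Q0 <= Q1 by rewrite ler_nat.
have norm2 (x y u v X Y U V : R) : `|x| <= X -> `|y| <= Y -> `|u| <= U -> `|v| <= V -> `|x * y + u * v| <= X * Y + U * V.
  move=> hx hy hu hv; apply: le_trans (ler_normD _ _) _; rewrite !normrM.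
  by apply: lerD; apply: ler_pM.
have nQ0 : `|Q0| <= Q1 by rewrite ger0_norm.
have nQ1 : `|Q1| <= Q1 by rewrite ger0_norm // ltW.
have AB : A * expR (- L - 4 * (t * L)) = B * Q1^-1.
  by rewrite q1R -expRN -!expRD; congr expR; clear; lra.
have Bq : 0 <= B * Q1^-1 by rewrite mulr_ge0 ?invr_ge0 // ltW.
have main (x y : R) : `|x| <= 2 * A -> `|y| <= B ->
    `|- x * ((Q1 * al - P1) + al * (Q0 * al - P0)) + y * (Q0 * al - P0)| <= 3 * (B * Q1^-1).
  move=> hx hy; apply: le_trans (norm2 _ _ _ _ _ _ _ _ _ e01 hy e0) _; first by rewrite normrN; exact: hx.
  by rewrite -mulrA AB; clear; lra.
have fin (x : R) (l : 'I_4) : `|x| <= 3 * expR (hyp_exp t 0 l * L) -> `|x| <= expR (hyp_exp t th l * L).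
  move=> h; apply: le_trans h _.
  have -> : hyp_exp t th l * L = th * L + hyp_exp t 0 l * L by elim/ord4P: l; rewrite /hyp_exp /=; ring.
  by rewrite expRD ler_wpM2r // expR_ge0.
move=> l; apply: fin; elim/ord4P: l; rewrite /Yform /hyp_vec /hyp_exp /= ?rmorphN ?rmorphD ?rmorphM /=;
  rewrite -/w0 -/w1 -/w2 -?/Q0 -?/Q1 -?/P0 -?/P1.
- have -> : (1 + 299 / 100 * t + 0) * L = 299 / 100 * (t * L) + L by ring.
  rewrite expRD -q1R -/A normrN; apply: le_trans (norm2 _ _ _ _ _ _ _ _ b0 nQ1 w1A nQ0) _.
  by clear; lra.
- have -> : (1 - 101 / 100 * t + 0) * L = - (101 / 100 * (t * L)) + L by ring.
  rewrite expRD -q1R -/B.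
  have -> : - (w1 * Q1 + w2 * Q0) - al * - (w0 * Q1 + w1 * Q0) = (al * w0 - w1) * Q1 + (al * w1 - w2) * Q0 by ring.
  apply: le_trans (norm2 _ _ _ _ _ _ _ _ b1 nQ1 b2 nQ0) _.
  have : 0 <= B * Q1 by rewrite mulr_ge0 // ltW.
  by clear; lra.
- have -> : (- 1 - 101 / 100 * t + 0) * L = - (101 / 100 * (t * L)) + - L by ring.
  rewrite expRD expRN -q1R -/B.
  have -> : w1 * P1 + w2 * P0 + al * - (w1 * Q1 + w2 * Q0) =
     - w1 * ((Q1 * al - P1) + al * (Q0 * al - P0)) + (al * w1 - w2) * (Q0 * al - P0) by ring.
  exact: main.
- have -> : (- 1 - 101 / 100 * t + 0) * L = - (101 / 100 * (t * L)) + - L by ring.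
  rewrite expRD expRN -q1R -/B.
  have -> : w0 * P1 + w1 * P0 + al * - (w0 * Q1 + w1 * Q0) =
     - w0 * ((Q1 * al - P1) + al * (Q0 * al - P0)) + (al * w0 - w1) * (Q0 * al - P0) by ring.
  by apply: main => //; clear - b0 A1; lra.
Qed.

End Application.

(** * Repetitions in the word *)

Section Words.

Lemma cat_rat_power (V : seq nat) (x : rat) :
  exists t, V ++ rat_power V x = rat_power V x ++ t.
Proof.
rewrite /rat_power; move: `|_|%N => m; elim: (Num.truncn x) => [|n [t IH]] /=.
  by exists (drop m V ++ take m V); rewrite catA cat_take_drop.
by exists t; rewrite -!catA IH !catA.
Qed.

Lemma rat_power_nth (V : seq nat) (x : rat) i : (i + size V < size (rat_power V x))%N ->
  nth 0%N (rat_power V x) (i + size V) = nth 0%N (rat_power V x) i.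
Proof.
move=> h; have [t e] := cat_rat_power V x.
have := congr1 (nth 0%N ^~ (i + size V)%N) e; rewrite !nth_cat h ltnNge leq_addl /= addnK.
by move=> <-.
Qed.

Lemma rat_power_size (V : seq nat) (x : rat) : 0 <= x -> x * (size V)%:R <= (size (rat_power V x))%:R.
Proof.
move=> x0; set r := size V.
rewrite /rat_power size_cat size_flatten /shape map_nseq sumn_nseq size_take -/r.
have n1 : (Num.truncn x)%:R <= x by rewrite truncn_le.
have n2 := truncnS_gt x.
set n := Num.truncn x in n1 n2 *; set m := `|_|%N.
have hm : (x - n%:R) * r%:R <= m%:R.
  have c0 : 0 <= (x - n%:R) * r%:R by rewrite mulr_ge0 // subr_ge0.
  apply: le_trans (ceil_ge _) _; rewrite natr_absz ler_int; exact: ler_norm.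
have hr : (x - n%:R) * r%:R <= r%:R.
  by rewrite ler_piMl // lerBlDr; apply: ltW; rewrite addrC natr1.
have -> : x * r%:R = r%:R * n%:R + (x - n%:R) * r%:R by ring.
by rewrite natrD natrM lerD2l; case: ifP.
Qed.

(** V^w has period |V|, so what follows its first copy of V repeats the beginning of the word; this
    part has length at least (w - 1) |V|. *)
Lemma star_overlap (w : rat) (a : nat -> nat) : 1 < w -> condition_star w a ->
  forall n0 : nat, exists r s : nat, [/\ (n0 <= r)%N, (w - 1) * r%:R <= s%:R
    & forall i, (0 < i <= s)%N -> a (r + i)%N = a i].
Proof.
move=> w1 [_ [V [pre inc]]] n0.
have szV n : (n <= size (V n.+1))%N.
  by elim: n => // n IH; apply: leq_ltn_trans IH (inc _ _).
exists (size (V n0.+1)), (size (rat_power (V n0.+1) w) - size (V n0.+1))%N.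
have w0 : 0 <= w by lra.
have := rat_power_size (V n0.+1) w0; have pr := pre n0.+1 isT.
set W := rat_power _ _ in pr *; set v := V n0.+1 in W pr *.
move=> hs; have vW : (size v <= size W)%N.
  rewrite -(ler_nat rat); apply: le_trans hs; rewrite ler_peMl // ltW //.
split; first exact: szV.
  by rewrite natrB // mulrBl mul1r lerD2r.
have nW i : (i < size W)%N -> nth 0%N W i = a i.+1.
  by move=> iW; rewrite pr (nth_map 0%N) ?size_iota // nth_iota // add1n.
move=> [|i] // /andP[_ h].
have h2 : (i + size v < size W)%N by rewrite addnC -ltn_subRL.
rewrite addnS -nW 1?addnC // -nW ?rat_power_nth //.
by apply: leq_ltn_trans h2; rewrite leq_addr.
Qed.

End Words.

(** * Transcendence from long repetitions *)

Section Core.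
Variable R : realType.
Implicit Type a : nat -> nat.

Lemma algebraic_minimal (al : R) : algebraicOver (@ratr R) al ->
  exists (F : {poly int}) d, [/\ size F = d.+1, (0 < d)%N, root (map_poly intr F) al &
    forall G : {poly int}, G != 0 -> root (map_poly intr G) al -> (d < size G)%N].
Proof.
move=> [p p0 rp].
pose Pn (n : nat) := `[< exists G : {poly int}, [/\ G != 0, root (map_poly intr G) al & size G = n] >].
have exn : exists n, Pn n.
  have [G [c c0 pE]] := rat_poly_scale p.
  exists (size G); apply/asboolP; exists G; split => //.
    by apply: contraNneq p0 => G0; rewrite pE G0 rmorph0 scaler0.
  move: rp; rewrite pE map_polyZ /= rootZ; last by rewrite fmorph_eq0 invr_eq0 intr_eq0.
  rewrite -map_poly_comp; congr (root _ _); apply: eq_map_poly => x /=; exact: ratr_int.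
case: (ex_minnP exn) => n /asboolP[F [F0 rF sF]] nmin.
have n0 : (0 < n)%N by rewrite -sF size_poly_gt0.
exists F, n.-1; rewrite prednK //; split => //.
- case: n sF n0 nmin => // -[|n] // sF _ _; have := size_poly1P F; move: rF.
  move/eqP: sF => /size_poly1P[c c0 ->]; rewrite map_polyC /= rootC intr_eq0 (negbTE c0) //.
- move=> G G0 rG; apply: nmin; apply/asboolP; by exists G.
Qed.

(** The inequality between ln q_r and ln q_s is the form in which both conditions on w enter. *)
Lemma cf_core a (sg : R) : posw a -> 0 < sg ->
  (forall n0 : nat, exists r s : nat, [/\ (n0 <= r)%N, (0 < s)%N,
     forall i, (0 < i <= s)%N -> a (r + i)%N = a i &
     sg * ln (cf_q a r)%:R <= ln (cf_q a s)%:R]) ->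
  ~ eventually_periodic a -> transcendental (cf_val R a).
Proof.
move=> ap sg0 H nper alg.
have [F [d [sF d0 rF Fmin]]] := algebraic_minimal alg.
set al := cf_val R a in rF Fmin.
have al0 : 0 < al by exact: cf_val_gt0.
have al1 : al < 1 by exact: cf_val_lt1.
have lnq_ge (x : R) : exists n0, forall r, (n0 <= r)%N -> x <= ln (cf_q a r)%:R.
  have [n0 h] := cf_q_unbounded (expR x) ap; exists n0 => r /h hr.
  by rewrite -ler_expR lnK // posrE cf_q_ge0.
have data (x : R) : exists r s, [/\ x <= ln (cf_q a r.+1)%:R, sg * ln (cf_q a r.+1)%:R <= ln (cf_q a s)%:R,
    `|((cf_q a r.+1)%:R * al - (cf_p a r.+1)%:R) + al * ((cf_q a r)%:R * al - (cf_p a r)%:R)|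
      <= expR (- ln (cf_q a r.+1)%:R - 2 * ln (cf_q a s)%:R)
    & ((cf_q a r.+1)%:R * al - (cf_p a r.+1)%:R) + al * ((cf_q a r)%:R * al - (cf_p a r)%:R) != 0].
  have [n0 hn] := lnq_ge x; have [r [s [nr s0 per sgq]]] := H (n0 + 1)%N.
  have r0 : (0 < r)%N by apply: leq_trans nr; rewrite addn1.
  have [r' rE] : exists r', r = r'.+1 by exists r.-1; rewrite prednK.
  rewrite rE in nr per sgq; exists r', s.
  have xr : x <= ln (cf_q a r'.+1)%:R by apply: hn; apply: leq_trans nr; rewrite leq_addr.
  have psh := posw_shift r'.+1 ap.
  have E : ((cf_q a r'.+1)%:R * al - (cf_p a r'.+1)%:R) + al * ((cf_q a r')%:R * al - (cf_p a r')%:R) =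
     (al - cf_val R (shiftw a r'.+1)) * ((cf_q a r')%:R * al - (cf_p a r')%:R).
    by rewrite cf_eps_rec // -/al; ring.
  have cl : `|al - cf_val R (shiftw a r'.+1)| <= ((cf_q a s)%:R ^+ 2)^-1.
    by apply: cf_close => // i hi; rewrite /shiftw per.
  split => //; rewrite E.
    rewrite normrM; apply: le_trans (ler_pM (normr_ge0 _) (normr_ge0 _) cl (cf_eps_le R r' ap)) _.
    have -> : - ln (cf_q a r'.+1)%:R - 2 * ln (cf_q a s)%:R = - (2%:R * ln (cf_q a s)%:R) + - ln (cf_q a r'.+1)%:R :> R by ring.
    by rewrite expRD !expRN expRM_natl !lnK ?posrE ?cf_q_ge0.
  rewrite mulf_neq0 ?cf_eps_neq0 //; apply/eqP => /eqP; rewrite subr_eq0 => /eqP e.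
  apply: nper; exists 1%N, r'.+1; split => // n n1.
  by have := cf_val_inj ap psh e n1; rewrite /shiftw addnC.
have [d2|d3] := leqP d 2.
  have [C [C0 liou]] := liouville3 sF d0 rF Fmin.
  have [r [s [x1 x2 x3 x4]]] := data ((`|ln C| + 1) / sg).
  pose q1 : R := (cf_q a r.+1)%:R.
  have q11 : 1 <= q1 by rewrite ler1n cf_q_gt0.
  pose p : int3 := (- (cf_p a r.+1)%:Z, (cf_q a r.+1)%:Z - (cf_p a r)%:Z, (cf_q a r)%:Z).
  have pv : val3 al p = ((cf_q a r.+1)%:R * al - (cf_p a r.+1)%:R) + al * ((cf_q a r)%:R * al - (cf_p a r)%:R).
    by rewrite /val3 /p /= rmorphN rmorphB /= -!pmulrn; ring.
  have pq n : ((cf_p a n)%:R : R) <= (cf_q a n)%:R.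
    have [_] := cf_fin_itv R n ap; rewrite (cf_finE R ap) ler_pdivrMr ?mul1r //; exact: cf_q_ge0.
  have bp : bnd3 p q1.
    have := pq r.+1; have := pq r; have := cf_q_leS r ap; rewrite /p /q1 -(ler_nat R).
    move: (cf_p a r.+1) (cf_q a r.+1) (cf_p a r) (cf_q a r) => P1 Q1 P0 Q0 h1 h2 h3.
    split => /=.
    - by rewrite rmorphN normrN /= -pmulrn ger0_norm.
    - rewrite rmorphB /= -!pmulrn ger0_norm ?lerBlDr ?lerDl // subr_ge0.
      exact: le_trans h1.
    - by rewrite -pmulrn ger0_norm.
  have := liou p q1 bp; rewrite pv => /(_ x4); apply/negP; rewrite -ltNge.
  have qd : q1 ^+ d.-1 <= q1.
    by case: (d) d2 => [|[|[|]]] //= _; rewrite ?expr0 ?expr1.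
  apply: (@le_lt_trans _ _ (C * q1 * expR (- ln q1 - 2 * ln (cf_q a s)%:R))).
    apply: ler_pM => //; last by rewrite ler_pM2l.
    by rewrite mulr_ge0 ?exprn_ge0 ?ltW //; apply: lt_le_trans q11.
  have -> : C * q1 = expR (ln C + ln q1).
    by rewrite expRD !lnK ?posrE //; apply: lt_le_trans q11.
  rewrite -expRD expR_lt1.
  have : `|ln C| + 1 <= ln (cf_q a s)%:R.
    by apply: le_trans x2; rewrite -ler_pdivrMl // mulrC.
  have := ler_norm (ln C); have := normr_ge0 (ln C); clear; lra.
have [K [t0 good]] := good_box_exists sF d3 rF Fmin al0 al1.
pose rho : R := 101 / 100.
have rho1 : 1 <= rho by rewrite /rho; lra.
have rhoK k : 1 <= rho ^+ k by rewrite exprn_ege1.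
(* All exponents [tk k] with k <= K are then at most sg / 2, so that the bound q_r^(-1 - 2 sg) on
   the quadratic value suffices for each of them. *)
pose tb := sg / (2 * rho ^+ K).
have rK0 : 0 < 2 * rho ^+ K by rewrite mulr_gt0 //; apply: lt_le_trans (rhoK K).
have tb0 : 0 < tb by rewrite divr_gt0.
pose tk k := rho ^+ k * tb.
have tk0 k : tb <= tk k by rewrite /tk ler_peMl // ltW.
(* With th = tk k / 200 the four exponents add up to - tk k / 50. *)
have noh k : exists Q : R, forall (q : nat) x b, Q <= q%:R -> ~ small_hyperplane al (hyp_exp (tk k) (tk k / 200)) q x b.
  apply: contrapT => /forallNP h.
  apply: (@no_small_hyperplanes R al F d (hyp_exp (tk k) (tk k / 200)) sF d0 rF).
    by rewrite big4 /hyp_exp /=; have := tk0 k; clear - tb0; lra.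
  move=> Q; have /existsNP[q /existsNP[x /existsNP[b /not_implyP[qQ /contrapT sh]]]] := h Q.
  by exists q, x, b.
(* Which scale succeeds depends on r, so the bound on q has to serve all of them. *)
have [Q hQ] : exists Q : R, forall k, (k <= K)%N -> forall (q : nat) x b, Q <= q%:R ->
     ~ small_hyperplane al (hyp_exp (tk k) (tk k / 200)) q x b.
  elim: (K) => [|K' [Q IH]].
    by have [Q h] := noh 0%N; exists Q => k; rewrite leqn0 => /eqP ->.
  have [Q' h] := noh K'.+1; exists (Num.max Q Q') => k; rewrite leq_eqVlt ltnS => /orP[/eqP ->|kK] q x b;
    rewrite ge_max => /andP[h1 h2]; [exact: h|exact: (IH k kK)].
have [r [s [x1 x2 x3 _]]] := data (Num.max (ln (Num.max Q 1)) (Num.max (t0 / tb) (200 * ln (3 : R) / tb))).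
move: x1; rewrite !ge_max => /andP[y1 /andP[y2 y3]].
set L : R := ln (cf_q a r.+1)%:R in y1 y2 y3 x2 x3.
have qp : 0 < (cf_q a r.+1)%:R :> R by exact: cf_q_ge0.
have QL : Q <= (cf_q a r.+1)%:R.
  have m1 : 0 < Num.max Q 1 by rewrite lt_max ltr01 orbT.
  by have := y1; rewrite ler_ln ?posrE // ge_max => /andP[].
have L0 : 0 <= L by rewrite ln_ge0 // ler1n cf_q_gt0.
have [k kK gb] := good (tb * L) ltac:(by rewrite mulrC -ler_pdivrMr).
rewrite mulrA -/rho -/(tk k) in gb.
have [x [b sh]] : exists x b, small_hyperplane al (hyp_exp (tk k) (tk k / 200)) (cf_q a r.+1) x b.
  apply: (@hyperplane_of_box R al (tk k) (tk k / 200) (cf_q a r) (cf_q a r.+1) (cf_p a r) (cf_p a r.+1)) => //.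
  - exact: cf_q_gt0.
  - exact: cf_q_leS.
  - apply/(@intr_inj R); have := @cf_det R a r; rewrite rmorphXn rmorphB !rmorphM /= -!pmulrn => ->.
    by rewrite -exprM mulnC exprM sqrrN !expr1n.
  - exact: cf_eps_le.
  - apply: le_trans x3 _; rewrite ler_expR -/L lerD2l lerN2.
    have : 2 * (tk k * L) <= sg * L.
      rewrite mulrA ler_wpM2r // /tk /tb.
      have : rho ^+ k <= rho ^+ K by rewrite ler_weXn2l.
      move=> h; have -> : 2 * (rho ^+ k * (sg / (2 * rho ^+ K))) = (rho ^+ k / rho ^+ K) * sg.
        by field; apply: lt0r_neq0; apply: lt_le_trans (rhoK K).
      have rK : 0 < rho ^+ K by apply: lt_le_trans (rhoK K).
      have q1 : rho ^+ k / rho ^+ K <= 1 by rewrite ler_pdivrMr // mul1r.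
      by rewrite ler_piMl // ltW.
    by clear - x2; lra.
  - by apply: le_trans (tk0 k); exact: ltW.
  - rewrite -[leLHS](@lnK _ (3 : R)) ?posrE // ler_expR -/L.
    have : 200 * ln (3 : R) <= tk k * L.
      apply: (@le_trans _ _ (tb * L)); first by rewrite [tb * L]mulrC -ler_pdivrMr.
      by rewrite ler_wpM2r.
    by clear; lra.
by apply: (hQ k kK _ x b QL).
Qed.

End Core.

(** * The two conditions on w *)

Section Final.
Variable R : realType.
Implicit Type a : nat -> nat.

(** Here s >= r, so q_s >= q_r and the exponent 1 serves, whatever the growth of the q_l. *)
Lemma star_transcendental_2 a (w : rat) : posw a -> 2 <= w -> condition_star w a ->
  transcendental (cf_val R a).
Proof.
move=> ap w2 st; apply: (@cf_core R a 1 ap ltr01); last by case: st.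
move=> n0; have w1 : 1 < w by lra.
have [r [s [nr rs per]]] := star_overlap w1 st (n0 + 1)%N.
have rs' : (r <= s)%N.
  by rewrite -(ler_nat rat); apply: le_trans rs; rewrite ler_peMl //; lra.
exists r, s; split => //.
- by apply: leq_trans nr; rewrite leq_addr.
- by apply: leq_trans rs'; apply: leq_trans nr; rewrite addn1.
- by rewrite mul1r ler_ln ?posrE ?cf_q_ge0 // ler_nat cf_q_mono.
Qed.

Lemma cf_q_log_upper a : posw a -> cf_q_roots_bounded R a ->
  exists m : R, 1 <= m /\ forall l, (0 < l)%N -> ln (cf_q a l)%:R <= l%:R * m.
Proof.
move=> ap [M hM]; exists (`|ln M| + 1); split; first by rewrite lerDr.
move=> l l0; have l0R : 0 < l%:R :> R by rewrite ltr0n.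
have q0 : 0 < (cf_q a l)%:R :> R by exact: cf_q_ge0.
have := hM l l0; rewrite ger0_norm ?powR_ge0 // => h.
have p0 : 0 < (cf_q a l)%:R `^ l%:R^-1 :> R by exact: powR_gt0.
have M0 : 0 < M by exact: lt_le_trans h.
have : ln ((cf_q a l)%:R `^ l%:R^-1) <= ln M :> R by rewrite ler_ln ?posrE.
rewrite ln_powR mulrC ler_pdivrMr // => h2; apply: le_trans h2 _.
by rewrite mulrC ler_pM2l //; have := ler_norm (ln M); lra.
Qed.

Lemma cf_q_log_lower a l : posw a -> (l%:R - 1) * ln (2 : R) <= 2 * ln (cf_q a l)%:R :> R.
Proof.
move=> ap; case: l => [|l].
  have : 0 <= ln (2 : R) by rewrite ln_ge0 // ler1n.
  by rewrite /= ln1; lra.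
rewrite -natr1 addrK; have q0 := @cf_q_ge0 R a l ap; have q1 := @cf_q_ge0 R a l.+1 ap.
have h : (2 ^ l)%:R <= (cf_q a l)%:R * (cf_q a l.+1)%:R :> R by rewrite -natrM ler_nat cf_q_prod.
have : ln ((2 : R) ^+ l) <= ln ((cf_q a l)%:R * (cf_q a l.+1)%:R).
  by rewrite ler_ln ?posrE ?exprn_gt0 ?mulr_gt0 // -natrX.
rewrite lnXn // lnM ?posrE // -mulr_natl => h2.
have : ln (cf_q a l)%:R <= ln (cf_q a l.+1)%:R :> R by rewrite ler_ln ?posrE // ler_nat cf_q_leS.
by clear - h2; lra.
Qed.

Lemma star_transcendental_bounded a (w : rat) : posw a -> 1 < w -> condition_star w a ->
  cf_q_roots_bounded R a -> transcendental (cf_val R a).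
Proof.
move=> ap w1 st bd; have [m [m1 hm]] := cf_q_log_upper ap bd.
pose v : R := ratr (w - 1).
have v0 : 0 < v by rewrite ltr0q subr_gt0.
have ln20 : 0 < ln (2 : R) by rewrite ln_gt0 // ltr1n.
have m0 : 0 < m by lra.
(* With v = w - 1 and v r >= 2, which [n1] ensures, ln q_s is at least (s - 1) ln 2 / 2 >= v r ln 2
   / 4, while ln q_r <= r m. *)
pose sg : R := v * ln (2 : R) / (4 * m).
have m4 : 0 < 4 * m by lra.
have sg0 : 0 < sg by apply: divr_gt0 => //; exact: mulr_gt0.
apply: (@cf_core R a sg ap sg0); last by case: st.
move=> n0; pose n1 := (Num.truncn (2 / v)).+1.
have [r [s [nr rs per]]] := star_overlap w1 st (n0 + n1)%N.
have rn1 : n1%:R <= r%:R :> R by rewrite ler_nat; apply: leq_trans nr; rewrite leq_addl.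
have vr : 2 <= v * r%:R.
  by rewrite mulrC -ler_pdivrMr //; apply: le_trans rn1; apply: ltW; exact: truncnS_gt.
have vs : v * r%:R <= s%:R.
  by have := rs; rewrite -(ler_rat R) rmorphM /= !ratr_nat.
have r0 : (0 < r)%N by apply: leq_trans nr; rewrite /n1 addnS.
exists r, s; split => //.
- by apply: leq_trans nr; rewrite leq_addr.
- by rewrite -(ltr_nat R); lra.
have h1 := @cf_q_log_lower a s ap; have h2 := hm r r0.
have h3 : sg * ln (cf_q a r)%:R <= v * ln (2 : R) / 4 * r%:R.
  apply: (@le_trans _ _ (sg * (r%:R * m))); first by rewrite ler_pM2l.
  have -> : sg * (r%:R * m) = v * ln (2 : R) / 4 * r%:R by rewrite /sg; field; rewrite lt0r_neq0.
  by [].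
have h4 : (v * r%:R / 2) * ln (2 : R) <= (s%:R - 1) * ln (2 : R) by rewrite ler_pM2r //; lra.
apply: le_trans h3 _; clear - h1 h4; lra.
Qed.

Lemma bounded_roots a M : posw a -> (forall l, (1 <= l)%N -> (a l <= M)%N) -> cf_q_roots_bounded R a.
Proof.
move=> ap aM; have qM l : (cf_q a l <= M.+1 ^ l)%N.
  elim: l => [|[|l] IH] //; first by rewrite expn1 /=; apply: leqW; exact: aM.
  rewrite cf_qSS expnS; apply: leq_trans (_ : (M.+1 * cf_q a l.+1 <= _)%N); last by rewrite leq_mul2l IH orbT.
  rewrite mulSn addnC leq_add ?cf_q_leS // leq_mul2r aM ?orbT //.
exists M.+1%:R => l l0; rewrite ger0_norm ?powR_ge0 //.
apply: (@le_trans _ _ ((M.+1%:R ^+ l) `^ l%:R^-1)).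
  rewrite ge0_ler_powR ?invr_ge0 ?nnegrE ?exprn_ge0 //.
  by rewrite -natrX ler_nat.
by rewrite -powR_mulrn // -powRrM mulfV ?powRr1 // pnatr_eq0 -lt0n.
Qed.

End Final.

Theorem theorem1 (R : realType) (a : nat -> nat)
    (a_gt0 : forall l, (1 <= l)%N -> (0 < a l)%N) :
  [/\ (exists w : rat, 2 <= w /\ condition_star w a) ->
        transcendental (cf_val R a),
      (exists w : rat, 1 < w /\ condition_star w a) ->
        cf_q_roots_bounded R a -> transcendental (cf_val R a)
    & (exists M : nat, forall l, (1 <= l)%N -> (a l <= M)%N) ->
        cf_q_roots_bounded R a].
Proof.
split=> [[w [w2 st]]|[w [w1 st]] bd|[M aM]].
- exact: star_transcendental_2 st.
- exact: star_transcendental_bounded st bd.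
- exact: bounded_roots aM.
Qed.
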